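(* Let $M$ be an irreducible quasi-finite highest weight $\widehat{\mathcal A}$-module with highest weight $\xi$. Then $M$ is unitarizable (with respect to the $\ast$-structure $\omega$) if and only if $\xi=\Lambda^{\widehat{\mathcal A}}(\lambda)$ for some generalized partition $\lambda$. In other words, $M$ is unitarizable if and only if $$\xi=\sum_{j\in\frac12\mathbb N,\ j\le r}\xi^+_j\omega_j-\sum_{j\in-\frac12\mathbb N,\ j\ge-s}\xi^-_{-j}\omega_j+d\Lambda_0$$ for some $d\in\mathbb Z_+$, $s,r\in\mathbb N$ and $\xi^\pm_j\in\mathbb Z$ satisfying: (i) $\xi^+_{\frac12}>\xi^+_{\frac32}>\cdots>\xi^+_{r-\frac12}\ge0$, $\ \xi^+_1>\xi^+_2>\cdots>\xi^+_r\ge0$, and $\xi^+_{r-\frac12}=0$ if and only if $r=1$ and $\xi^+_{\frac12}=\xi^+_1=0$; (ii) $\xi^-_{\frac12}>\xi^-_{\frac32}>\cdots>\xi^-_{s-\frac12}\ge0$, $\ \xi^-_1>\xi^-_2>\cdots>\xi^-_s\ge0$, and $\xi^-_{s-\frac12}=0$ if and only if $s=1$ and $\xi^-_{\frac12}=\xi^-_1=0$; (iii) $\min\{\xi^+_{\frac12},1\}+\min\{\xi^-_{\frac12},1\}+\xi^+_1+\xi^-_1\le d$.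
   Context: All vector spaces are over $\mathbb C$; $\mathbb N=\{1,2,\dots\}$, $\mathbb Z_+=\{0,1,2,\dots\}$, $\frac12\mathbb Z^*=\frac12\mathbb Z\setminus\{0\}$. Let $\mathrm{gl}_{\infty|\infty}$ be the space of complex matrices $(a_{ij})_{i,j\in\frac12\mathbb Z}$ with $a_{ij}=0$ for $|i-j|\gg0$; $e_{pq}$ denotes the matrix unit. It is $\frac12\mathbb Z$-graded: the degree-$k$ component consists of all $\sum_{j\in\frac12\mathbb Z}a_je_{j-k,j}$. Elements of integer degree are even, elements of degree in $\frac12+\mathbb Z$ are odd, and $[A,B]=AB-(-1)^{|A||B|}BA$. Let $J=\sum_{r\le0}e_{rr}$, $\mathrm{Str}(D)=\sum_{r}(-1)^{2r}d_{rr}$, $\alpha(A,B)=\mathrm{Str}([J,A]B)$. Then $\widehat{\mathrm{gl}}_{\infty|\infty}=\mathrm{gl}_{\infty|\infty}\oplus\mathbb CC$ is the central extension with $C$ even, central, of degree $0$, and the bracket of $A,B\in\mathrm{gl}_{\infty|\infty}$ equal to $[A,B]+\alpha(A,B)C$. Let $\mathcal A\subset\mathrm{gl}_{\infty|\infty}$ be the matrices with $a_{ij}=0$ if $i=0$ or $j=0$, and $\widehat{\mathcal A}=\mathcal A\oplus\mathbb CC\subset\widehat{\mathrm{gl}}_{\infty|\infty}$ with the induced grading. Weights $\omega_s$ ($s\in\frac12\mathbb Z^*$), $\Lambda_0\in(\widehat{\mathcal A}_0)^*$: $\omega_s(\sum_ra_re_{rr}+dC)=a_s$, $\Lambda_0(\sum_ra_re_{rr}+dC)=d$.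 For a $\frac12\mathbb Z$-graded Lie superalgebra $\mathfrak g$ with $\mathfrak g_0$ abelian, put $\mathfrak g_\pm=\bigoplus_{r>0}\mathfrak g_{\pm r}$. A highest weight module with highest weight $\xi\in\mathfrak g_0^*$ is a module $M$ containing $v_\xi\neq0$ with $hv_\xi=\xi(h)v_\xi$ for $h\in\mathfrak g_0$, $\mathfrak g_+v_\xi=0$, $\mathcal U(\mathfrak g_-)v_\xi=M$; it is graded by giving $v_\xi$ degree $0$, and is quasi-finite if all homogeneous components are finite dimensional. $\ast$-structure: $\omega$ is the anti-linear map with $\omega(C)=C$, $\omega(\sum_pa_pe_{p-k,p})=\sum_p(-1)^{[p]+[p-k]}\overline{a_p}\,e_{p,p-k}$, where $[r]=1$ if $r\in\frac12+\mathbb Z$ and $r<0$, and $[r]=0$ otherwise; it satisfies $\omega([x,y])=[\omega(y),\omega(x)]$. A module $M$ is unitarizable if it admits a positive definite Hermitian form with $\langle xv|v'\rangle=\langle v|\omega(x)v'\rangle$ for all $x$ and all $v,v'\in M$. A generalized partition of length $d\in\mathbb Z_+$ is a non-increasing sequence of integers $\lambda=(\lambda_1,\dots,\lambda_d)$; it is a partition of length $d$ if all $\lambda_i\ge0$ (zeros allowed). For a partition $\mu$, $\mu'_j=\#\{i:\mu_i\ge j\}$ and $\mathrm{rank}(\mu)$ is the largest $i$ with $\mu_i\ge i$. The shifted Frobenius coordinates of a non-zero partition $\mu$ of rank $r$ are $\xi_i=\mu_{i+\frac12}-i+\frac12$ ($i=\frac12,\frac32,\dots,r-\frac12$) and $\xi_j=\mu'_j-j$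 ($j=1,\dots,r$); for $\mu=0$ put $r=1$, $\xi_{\frac12}=\xi_1=0$. Given $\lambda$, let $\lambda^+_i=\max\{\lambda_i,0\}$, $\lambda^-_i=\min\{\lambda_i,0\}$, let $\xi^+_j$ ($j\in\frac12\mathbb N$, $j\le r$) be the shifted Frobenius coordinates of the partition $\lambda^+$ and $\xi^-_j$ ($j\in\frac12\mathbb N$, $j\le s$) those of the partition $(-\lambda^-_d,\dots,-\lambda^-_1)$. Then $\Lambda^{\widehat{\mathcal A}}(\lambda):=\sum_{j\in\frac12\mathbb N,\,j\le r}\xi^+_j\omega_j-\sum_{j\in-\frac12\mathbb N,\,j\ge-s}\xi^-_{-j}\omega_j+d\Lambda_0$. *)

(* Defs.v *)
From HB Require Import structures.
From mathcomp Require Import all_boot all_order all_algebra.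
From mathcomp Require Import sesquilinear complex zify.
From mathcomp Require Import boolp classical_sets functions fsbigop reals.

Set Implicit Arguments.
Unset Strict Implicit.
Unset Printing Implicit Defensive.
Import Order.TTheory GRing.Theory Num.Theory.
Local Open Scope ring_scope.

(* The complex numbers are [R[i]] for an arbitrary [R : realType].

   A half-integer r in (1/2)Z is represented by the integer 2r.  Matrix
   indices, degrees and the subscripts of the weights omega_s all follow this
   convention.  So r is an integer iff its representative is even. *)

Definition podd (k : int) : bool := odd `|k|%N.

Section SuperMatrices.
Variable R : realType.
Local Notation C := R[i].

Definition band : {pred int -> int -> C^o} := fun a =>
  `[< exists N : nat, forall i j : int, N%:Z < `|i - j| -> a i j = 0 >].

Fact band_submod : submod_closed band.
Proof.
split=> [|c a b]; first by apply/asboolP; exists 0%N.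
move=> /asboolP[N aN] /asboolP[M bM]; apply/asboolP; exists (N + M)%N => i j ij.
have E : (c *: a + b) i j = c * a i j + b i j by [].
by rewrite E aN ?bM ?mulr0 ?addr0 //; lia.
Qed.
HB.instance Definition _ := GRing.isSubmodClosed.Build C (int -> int -> C^o)
  band band_submod.

Record gl := Gl { glval :> int -> int -> C^o; _ : glval \in band }.
HB.instance Definition _ := [isSub for glval].
HB.instance Definition _ := [Choice of gl by <:].
HB.instance Definition _ := [SubChoice_isSubLmodule of gl by <:].

Fact gl_mul_band (A B : gl) :
  (fun i j => \sum_(k \in [set: int]) (A i k * B k j : C)) \in band.
Proof.
have /asboolP[N aN] := valP A; have /asboolP[M bM] := valP B.
apply/asboolP; exists (N + M)%N => i j ij; apply: fsbig1 => k _ /=.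
have [ik|ik] := ltP N%:Z `|i - k|; first by rewrite aN ?mul0r.
by rewrite bM ?mulr0 //; lia.
Qed.
(* For fixed i and j only finitely many terms of the sum are non-zero. *)
Definition gl_mul (A B : gl) : gl := Gl (gl_mul_band A B).

Fact gl_part_band (b : bool) (A : gl) :
  (fun i j => if podd (j - i) == b then A i j else 0) \in band.
Proof.
have /asboolP[N aN] := valP A; apply/asboolP; exists N => i j ij /=.
by rewrite aN ?if_same.
Qed.
(* The even (b = false) and odd (b = true) components of A. *)
Definition gl_part (b : bool) (A : gl) : gl := Gl (gl_part_band b A).

(* The bilinear extension of AB - (-1)^(|A||B|) BA. *)
Definition gl_br (A B : gl) : gl :=
  gl_mul A B - \sum_(a : bool) \sum_(b : bool)
                 (-1) ^+ (a && b) *: gl_mul (gl_part b B) (gl_part a A).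

Fact gl_J_band : (fun i j => if (i == j) && (i <= 0) then 1 else 0 : C) \in band.
Proof.
apply/asboolP; exists 0%N => i j ij; case: eqP => //= ij0.
by move: ij; rewrite ij0 subrr normr0.
Qed.
Definition gl_J : gl := Gl gl_J_band.

(* Only applied to matrices with finitely many non-zero diagonal entries. *)
Definition Str (D : gl) : C :=
  \sum_(r \in [set: int]) ((-1) ^+ podd r * D r r : C).

Definition gl_cocycle (A B : gl) : C := Str (gl_mul (gl_br gl_J A) B).

Definition glhat : Type := (gl * C^o)%type.
HB.instance Definition _ := GRing.Lmodule.on glhat.

Definition glhat_br (x y : glhat) : glhat :=
  (gl_br x.1 y.1, gl_cocycle x.1 y.1).

Definition in_Ahat : {pred glhat} := fun x =>
  `[< forall i j : int, i = 0 \/ j = 0 -> x.1 i j = 0 >].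

Fact in_Ahat_submod : submod_closed in_Ahat.
Proof.
split=> [|c a b]; first by apply/asboolP.
move=> /asboolP aN /asboolP bM; apply/asboolP=> i j ij.
have E : (c *: a + b).1 i j = c * a.1 i j + b.1 i j by [].
by rewrite E aN // bM // mulr0 addr0.
Qed.
HB.instance Definition _ := GRing.isSubmodClosed.Build C glhat
  in_Ahat in_Ahat_submod.

Record Ahat := MkAhat { Ahat_val :> glhat; _ : Ahat_val \in in_Ahat }.
HB.instance Definition _ := [isSub for Ahat_val].
HB.instance Definition _ := [Choice of Ahat by <:].
HB.instance Definition _ := [SubChoice_isSubLmodule of Ahat by <:].

Fact Ahat_br_in (x y : Ahat) : glhat_br x y \in in_Ahat.
Proof.
have /asboolP a0 := valP x; have /asboolP b0 := valP y.
apply/asboolP=> i j ij; rewrite [X in X.1]/glhat_br [(_, _).1]/=.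
have m0 (A B : gl) : (forall i j : int, i = 0 \/ j = 0 -> A i j = 0) ->
    (forall i j : int, i = 0 \/ j = 0 -> B i j = 0) -> gl_mul A B i j = 0.
  move=> A0 B0; apply: fsbig1 => k _.
  by case: ij => ij0; [rewrite A0 ?mul0r //; left|rewrite B0 ?mulr0 //; right].
have p0 t (A : gl) : (forall i j : int, i = 0 \/ j = 0 -> A i j = 0) ->
    (forall i j : int, i = 0 \/ j = 0 -> gl_part t A i j = 0).
  by move=> A0 k l kl /=; rewrite A0 ?if_same.
rewrite /gl_br !big_bool.
have vD (A B : gl) : (A + B) i j = A i j + B i j by [].
have vB (A B : gl) : (A - B) i j = A i j - B i j by [].
have vZ t (A : gl) : (t *: A) i j = t * A i j by [].
rewrite vB !vD !vZ !m0 ?mulr0 ?addr0 ?subr0 //;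
  by move=> *; solve [exact: a0|exact: b0|exact: p0].
Qed.
Definition Ahat_br (x y : Ahat) : Ahat := MkAhat (Ahat_br_in x y).

(* The degree-k component: e_(j-k,j) has degree k, and C has degree 0. *)
Definition Ahat_deg (k : int) : {pred Ahat} := fun x =>
  `[< (forall i j : int, j - i != k -> (Ahat_val x).1 i j = 0) /\
      (k != 0 -> (Ahat_val x).2 = 0) >].

Fact Ahat_deg_submod k : submod_closed (Ahat_deg k).
Proof.
split=> [|c a b]; first by apply/asboolP.
move=> /asboolP[a1 a2] /asboolP[b1 b2]; apply/asboolP; split=> [i j ij|k0].
  have E : (Ahat_val (c *: a + b)).1 i j =
    c * (Ahat_val a).1 i j + (Ahat_val b).1 i j by [].
  by rewrite E a1 // b1 // mulr0 addr0.
have E : (Ahat_val (c *: a + b)).2 = c * (Ahat_val a).2 + (Ahat_val b).2 by [].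
by rewrite E a2 // b2 // mulr0 addr0.
Qed.
HB.instance Definition _ k := GRing.isSubmodClosed.Build C Ahat
  (Ahat_deg k) (Ahat_deg_submod k).

Record Ahat0 := MkAhat0 { Ahat0_val :> Ahat; _ : Ahat0_val \in Ahat_deg 0 }.
HB.instance Definition _ := [isSub for Ahat0_val].
HB.instance Definition _ := [Choice of Ahat0 by <:].
HB.instance Definition _ := [SubChoice_isSubLmodule of Ahat0 by <:].

(* [r] = 1 iff r is a negative element of 1/2 + Z. *)
Definition sbrk (r : int) : bool := podd r && (r < 0).

Fact star_band (A : gl) :
  (fun i j => (-1) ^+ (sbrk i + sbrk j) * (A j i : C)^* ) \in band.
Proof.
have /asboolP[N aN] := valP A; apply/asboolP; exists N => i j ij /=.
by rewrite aN ?conjC0 ?mulr0 // distrC.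
Qed.

Fact star_in (x : Ahat) :
  ((Gl (star_band (Ahat_val x).1), ((Ahat_val x).2 : C)^* ) : glhat) \in in_Ahat.
Proof.
have /asboolP a0 := valP x; apply/asboolP=> i j ij /=.
by rewrite a0 ?conjC0 ?mulr0 //; case: ij; [right|left].
Qed.
Definition star (x : Ahat) : Ahat := MkAhat (star_in x).

End SuperMatrices.

Section Modules.
Variables (R : realType) (V : lmodType R[i]).
Variables (Vpar : bool -> {pred V}) (act : Ahat R -> V -> V).
Local Notation C := R[i].

(* [V] is a superspace with even part [Vpar false] and odd part [Vpar true],
   on which the Lie superalgebra acts through [act].  The relation between
   brackets and super commutators is bilinear, so it is stated on homogeneous
   elements, which span. *)
Record is_supermodule : Prop := {
  par_submod : forall b, submod_closed (Vpar b);
  par_add : forall w : V, exists2 w0, w0 \in Vpar false & w - w0 \in Vpar true;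
  par_cap : forall w : V, w \in Vpar false -> w \in Vpar true -> w = 0;
  act_linearl : forall w, linear (act^~ w);
  act_linearr : forall x, linear (act x);
  act_par : forall (k : int) x b w,
    x \in Ahat_deg k -> w \in Vpar b -> act x w \in Vpar (podd k (+) b);
  act_br : forall (k l : int) x y w, x \in Ahat_deg k -> y \in Ahat_deg l ->
    act (Ahat_br x y) w =
      act x (act y w) - (-1) ^+ (podd k && podd l) *: act y (act x w)
}.

(* Submodules of a supermodule are graded by parity. *)
Definition is_subsupermodule (W : {pred V}) : Prop :=
  [/\ submod_closed W,
      forall x w, w \in W -> act x w \in W &
      forall w0 w1, w0 \in Vpar false -> w1 \in Vpar true ->
        w0 + w1 \in W -> w0 \in W].

Definition irreducible_module : Prop :=
  (exists w : V, w != 0) /\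
  forall W : {pred V}, is_subsupermodule W ->
    (forall w, w \in W -> w = 0) \/ (forall w, w \in W).

Definition lspan (P : V -> Prop) (w : V) : Prop :=
  exists2 s : seq (C * V), (forall p, p \in s -> P p.2) &
    w = \sum_(p <- s) p.1 *: p.2.

(* [w] is of the form x_1 ... x_n v with x_i homogeneous of negative degree,
   the degrees of the x_i adding up to [k]. *)
Definition neg_monomial (v : V) (k : int) (w : V) : Prop :=
  exists s : seq (int * Ahat R),
    [/\ forall p, p \in s -> p.1 < 0 /\ p.2 \in Ahat_deg p.1,
        k = \sum_(p <- s) p.1 &
        w = foldr (fun p u => act p.2 u) v s].

Definition is_highest_weight_module (xi : {scalar Ahat0 R}) (v : V) : Prop :=
  [/\ v != 0,
      forall h : Ahat0 R, act h v = xi h *: v,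
      forall (k : int) x, 0 < k -> x \in Ahat_deg k -> act x v = 0 &
      forall w, lspan (fun u => exists k, neg_monomial v k u) w].

Definition homogeneous_component (v : V) (k : int) : V -> Prop :=
  lspan (neg_monomial v k).

Definition quasi_finite (v : V) : Prop :=
  forall k : int, exists s : seq V,
    forall w, homogeneous_component v k w -> lspan (fun u => u \in s) w.

Definition unitarizable : Prop :=
  exists form : {dot V for @Num.conj C},
    forall x w w', form (act x w) w' = form w (act (star x) w').

End Modules.

Section Weights.
Variable R : realType.
Local Notation C := R[i].

Definition omega_wt (s : int) : Ahat0 R -> C^o :=
  fun h => (Ahat_val (Ahat0_val h)).1 s s.
Definition Lambda0 : Ahat0 R -> C^o := fun h => (Ahat_val (Ahat0_val h)).2.

(* sum_(0 < j <= r) xip_j omega_j - sum_(0 > j >= -s) xim_(-j) omega_j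
   + d Lambda_0, where j runs over half-integers; [m] stands for 2j or -2j. *)
Definition frob_weight (xip xim : nat -> int) (r s d : nat) : Ahat0 R -> C^o :=
  \sum_(1 <= m < (2 * r).+1) (xip m)%:~R *: omega_wt m%:Z
  - \sum_(1 <= m < (2 * s).+1) (xim m)%:~R *: omega_wt (- m%:Z)
  + d%:R *: Lambda0.

End Weights.

Definition is_gen_partition (la : seq int) : bool := sorted >=%R la.

(* Partitions are non-increasing sequences of non-negative integers, trailing
   zeros allowed; the part mu_i is [mu`_i.-1]. *)
Section Frobenius.
Variable mu : seq int.

Definition zero_part : bool := all (pred1 0) mu.

Definition conj_part (j : nat) : nat := count (fun x : int => j%:Z <= x) mu.

Definition part_rank : nat :=
  \max_(i < size mu | (nat_of_ord i).+1%:Z <= mu`_i) i.+1.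

Definition frob_rank : nat := if zero_part then 1 else part_rank.

(* xi_j at m = 2j.  For m odd, xi_(m/2) = mu_(m./2 + 1) - m./2. *)
Definition frob_coord (m : nat) : int :=
  if zero_part then 0
  else if odd m then mu`_m./2 - m./2%:Z
  else (conj_part m./2)%:Z - m./2%:Z.

End Frobenius.

Definition pos_part (la : seq int) : seq int := [seq Num.max x 0 | x <- la].
Definition neg_part (la : seq int) : seq int :=
  rev [seq - Num.min x 0 | x <- la].

Definition Lambda_Ahat (R : realType) (la : seq int) : Ahat0 R -> R[i]^o :=
  frob_weight (frob_coord (pos_part la)) (frob_coord (neg_part la))
    (frob_rank (pos_part la)) (frob_rank (neg_part la)) (size la).

(* Conditions (i) and (ii) on xi_(1/2), xi_1, ..., xi_(r-1/2), xi_r, with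
   [xi m] standing for xi_(m/2). *)
Definition frob_cond (r : nat) (xi : nat -> int) : Prop :=
  [/\ forall t : nat, (t.+1 < r)%N -> xi (2 * t + 3)%N < xi (2 * t + 1)%N,
      0 <= xi (2 * r - 1)%N,
      forall t : nat, (0 < t < r)%N -> xi (2 * t + 2)%N < xi (2 * t)%N,
      0 <= xi (2 * r)%N &
      xi (2 * r - 1)%N = 0 <-> [/\ r = 1%N, xi 1%N = 0 & xi 2%N = 0]].

(* Main.v *)
(* A unitarizable module is restricted by rank one computations: for [p < q] of
   equal parity the matrix units [e_pq], [e_qp] span an sl_2 whose unitary highest
   weights are natural numbers, and for [p], [q] of different parity the odd
   reflection [e_qp v] is again a highest weight vector for a neighbouring Borel
   subalgebra.  Applying the first to [v] and to its odd reflections yields the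
   strict inequalities (i), (ii) and the bound (iii).

   Conversely, [d] copies of bosonic and fermionic oscillators carry a unitary
   representation.  The monomial in the fermions given by the columns of
   [lambda^+] and [- lambda^-] is a highest weight vector for the order that
   places the fermionic indices next to the middle; finitely many odd reflections
   move it to the standard order, and turn column lengths into Frobenius
   coordinates.  The submodule of [M (+) Fock] generated by the pair of highest
   weight vectors is the graph of an intertwiner, which is injective since [M] is
   irreducible and pulls the form back to [M].

   Infinite matrices play no role beyond the following: by quasi-finiteness the
   elements of degree [k < 0] killing [v] form an ideal of finite codimension in
   the ring of all sequences, so they contain all sequences supported far from 0,
   and every matrix acts on a given vector as a finite one. *)

From HB Require Import structures.
Require Import Defs.
From mathcomp Require Import all_boot all_order all_algebra.
From mathcomp Require Import sesquilinear complex zify ring.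
From mathcomp Require Import boolp classical_sets functions cardinality fsbigop reals.

Set Implicit Arguments.
Unset Strict Implicit.
Unset Printing Implicit Defensive.
Import Order.TTheory GRing.Theory Num.Theory.
Local Open Scope ring_scope.

(** * Unitary representations of matrix units *)

(** Between half-integers of opposite sign [star] defines a non-compact real form, whose unitary
    weights need not be integral. The rank one argument is therefore restricted to pairs with
    [sbrk p = sbrk q], and the integrality of the level has to come from a pair of integers of
    opposite sign. The same sign rule makes integers fermionic and half-integers bosonic in the
    oscillator model.

    An odd reflection sends highest weight vectors to highest weight vectors only if the reflected
    pair is adjacent in the current order, so the reflections are performed in a fixed sequence of
    adjacent swaps. Each either moves one unit of weight or, when the two weights cancel, leaves the
    vector alone; counting the former gives the Frobenius coordinates.

    The submodule generated in the direct sum is not known to be irreducible. That it is a graph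
    follows from definiteness of the form on the oscillator side: the fibre over 0 is orthogonal to
    the whole projection, hence to itself. The intertwiner need not respect parity, whereas
    irreducibility concerns graded submodules only, so the form is pulled back on the even and odd
    parts separately. *)

Lemma poddBC (p q : int) : podd (p - q) = podd (q - p).
Proof. by rewrite /podd -abszN opprB. Qed.

Lemma poddB (p q : int) : podd (q - p) = podd q (+) podd p.
Proof. rewrite /podd; lia. Qed.

Section UnitaryRepresentations.
Variables (C : numClosedFieldType).

Record is_inner (M : lmodType C) (f : M -> M -> C) : Prop := {
  innerDl : forall u v w, f (u + v) w = f u w + f v w;
  innerZl : forall c u w, f (c *: u) w = c * f u w;
  innerC : forall u w, f u w = (f w u)^*;
  inner_gt0 : forall u, u != 0 -> 0 < f u u
}.

(** Index 0 is left out because [Ahat] has no row or column there. No central term occurs: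
    [unit_elt] is normalised so as to absorb the cocycle. *)
Record is_gl_rep (M : lmodType C) (E : int -> int -> M -> M) : Prop := {
  rep_linear : forall p q, linear (E p q);
  rep_br : forall p q r s u, p != 0 -> q != 0 -> r != 0 -> s != 0 ->
    E p q (E r s u) = (-1) ^+ (podd (q - p) && podd (s - r)) *: E r s (E p q u)
      + ((q == r)%:R *: E p s u
         - ((-1) ^+ (podd (q - p) && podd (s - r)) * (s == p)%:R) *: E r q u)
}.

Definition is_star_form (M : lmodType C) (E : int -> int -> M -> M)
    (f : M -> M -> C) : Prop :=
  forall p q u w, p != 0 -> q != 0 ->
    f (E p q u) w = (-1) ^+ (sbrk p + sbrk q) * f u (E q p w).

Definition has_weight (M : lmodType C) (E : int -> int -> M -> M)
    (eta : int -> C) (u : M) : Prop :=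
  forall p, p != 0 -> E p p u = eta p *: u.

Section Inner.
Variables (M : lmodType C) (f : M -> M -> C).
Hypothesis fP : is_inner f.

Lemma innerDr u v w : f u (v + w) = f u v + f u w.
Proof. by rewrite (innerC fP) (innerDl fP) rmorphD [LHS]/= -!(innerC fP). Qed.

Lemma innerZr c u w : f u (c *: w) = c^* * f u w.
Proof. by rewrite (innerC fP) (innerZl fP) rmorphM [LHS]/= -!(innerC fP). Qed.

Lemma inner0l w : f 0 w = 0.
Proof. by rewrite -(scale0r (0 : M)) (innerZl fP) mul0r. Qed.

Lemma inner0r w : f w 0 = 0.
Proof. by rewrite (innerC fP) inner0l conjC0. Qed.

Lemma inner_ge0 u : 0 <= f u u.
Proof. by have [->|/(inner_gt0 fP)/ltW//] := eqVneq u 0; rewrite inner0l. Qed.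

Lemma inner_eq0 u : f u u = 0 -> u = 0.
Proof.
by move=> fu; apply/eqP/negPn/negP => /(inner_gt0 fP); rewrite fu ltxx.
Qed.

End Inner.

Section Rep.
Variables (M : lmodType C) (E : int -> int -> M -> M).
Hypothesis EP : is_gl_rep E.

Lemma repD p q u w : E p q (u + w) = E p q u + E p q w.
Proof. by have := rep_linear EP p q 1 u w; rewrite !scale1r. Qed.

Lemma rep0 p q : E p q 0 = 0.
Proof. by have := rep_linear EP p q (-1) 0 0; rewrite !scaleN1r !addNr. Qed.

Lemma repZ p q c u : E p q (c *: u) = c *: E p q u.
Proof. by have := rep_linear EP p q c u 0; rewrite !addr0 rep0 addr0. Qed.

Lemma has_weight_rep eta (p q : int) (u : M) : p != 0 -> q != 0 -> has_weight E eta u ->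
  has_weight E (fun t => eta t + (t == p)%:R - (t == q)%:R) (E p q u).
Proof.
move=> p0 q0 wu t t0; rewrite (rep_br EP) // wu // repZ subrr /= scale1r mul1r.
rewrite addrA !scalerBl !scalerDl (eq_sym q t).
by congr (_ + _ - _); [case: (eqVneq t p) => [->|_]|case: (eqVneq t q) => [->|_]];
  rewrite ?scale0r.
Qed.

Lemma rep_lower eta (p q : int) (u : M) : p != 0 -> q != 0 -> p != q ->
    has_weight E eta u -> E p q u = 0 ->
  E p q (E q p u) = (eta p - (-1) ^+ podd (q - p) * eta q) *: u.
Proof.
move=> p0 q0 pq wu Eu; rewrite (rep_br EP) // Eu rep0 scaler0 add0r !eqxx.
rewrite (poddBC p q).
by rewrite andbb scale1r !wu // mulr1 scalerBl scalerA.
Qed.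

Lemma rep_comm0 (p q r s : int) (u : M) : p != 0 -> q != 0 -> r != 0 -> s != 0 ->
  q != r -> s != p -> E p q u = 0 -> E p q (E r s u) = 0.
Proof.
move=> p0 q0 r0 s0 /negPf qr /negPf sp Eu.
by rewrite (rep_br EP) // Eu rep0 qr sp mulr0 !scale0r scaler0 subr0 addr0.
Qed.

Lemma rep_odd_sqr (p q : int) (u : M) : p != 0 -> q != 0 -> podd (q - p) ->
  E p q (E p q u) = 0.
Proof.
move=> p0 q0 o; have qp : (q == p) = false.
  by apply/negP => /eqP qp; move: o; rewrite qp subrr.
have := rep_br EP u p0 q0 p0 q0.
rewrite o expr1 qp mulr0 !scale0r subr0 addr0 scaleN1r => h.
have : (2%:R : C) *: E p q (E p q u) = 0.
  by rewrite scaler_nat mulr2n [X in X + _]h addNr.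
by move/eqP; rewrite scaler_eq0 pnatr_eq0 => /eqP.
Qed.

End Rep.

Section Unitary.
Variables (M : lmodType C) (E : int -> int -> M -> M) (f : M -> M -> C).
Hypotheses (EP : is_gl_rep E) (fP : is_inner f) (fE : is_star_form E f).

Lemma weight_real eta (u : M) (p : int) : p != 0 -> u != 0 -> has_weight E eta u ->
  eta p \is Num.real.
Proof.
move=> p0 u0 wu; have fu := inner_gt0 fP u0.
have := fE u u p0 p0; rewrite wu // (innerZl fP) (innerZr fP).
rewrite addnn -mul2n mulnC exprM sqrr_sign mul1r.
move=> /(mulIf (lt0r_neq0 fu)) h; exact/CrealP.
Qed.

(* [e_qp u] has norm [eta p + eta q] up to sign. *)
Lemma odd_reflection_neq0 eta (p q : int) (u : M) : p != 0 -> q != 0 -> podd (q - p) ->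
    u != 0 -> has_weight E eta u -> E p q u = 0 -> eta p + eta q != 0 ->
  E q p u != 0.
Proof.
move=> p0 q0 o u0 wu Eu; apply: contraNneq => Fu.
have pq : p != q by apply/eqP => pq; move: o; rewrite pq subrr.
have := rep_lower EP p0 q0 pq wu Eu.
rewrite Fu rep0 // o expr1 mulN1r opprK => /esym/eqP.
by rewrite scaler_eq0 (negPf u0) orbF.
Qed.

(** The square norm of [E q p u] is a multiple of [eta p + eta q], and definiteness turns norm zero
    into vanishing. *)
Lemma odd_reflection_eq0 eta (p q : int) (u : M) : p != 0 -> q != 0 -> podd (q - p) ->
    has_weight E eta u -> E p q u = 0 -> eta p + eta q = 0 ->
  E q p u = 0.
Proof.
move=> p0 q0 o wu Eu h; apply: (inner_eq0 fP); rewrite fE //.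
have pq : p != q by apply/eqP => pq; move: o; rewrite pq subrr.
rewrite (rep_lower EP p0 q0 pq wu Eu) o expr1 mulN1r opprK h.
by rewrite scale0r inner0r // mulr0.
Qed.

(** If [m = eta p - eta q] is not a natural number, no vector of the lowering string through [u]
    vanishes. The norm ratios [(n + 1) (m - n)] are then all positive, so [m] exceeds every natural
    number. Over a general closed field this is no contradiction yet. *)
Lemma dominance_gt eta (p q : int) (u : M) : p != 0 -> q != 0 -> p != q -> ~~ podd (q - p) ->
    ~~ odd (sbrk p + sbrk q) -> u != 0 -> has_weight E eta u -> E p q u = 0 ->
  (forall n : nat, eta p - eta q != n%:R) -> forall n : nat, n%:R < eta p - eta q.
Proof.
move=> p0 q0 pq o sg u0 wu Eu; set m := eta p - eta q => mn.
have mR : m \is Num.real by rewrite rpredB // (weight_real _ u0 wu).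
have oo : podd (p - q) = false by rewrite poddBC; apply/negbTE.
have [F [F1 FS]] : exists F : nat -> M, F 0%N = u /\
    forall n, F n.+1 = E q p (F n) by exists (fun n => iter n (E q p) u).
(* The raising operator on an sl_2 string, by induction on [n] from the weights of the string
   vectors. *)
have EF n : E p q (F n.+1) = (n.+1%:R * (m - n%:R)) *: F n.
  have wF k : has_weight E (fun t => eta t + ((t == q)%:R - (t == p)%:R) *+ k)
      (F k).
    elim: k => [|k IH] t t0; first by rewrite F1 wu // mulr0n addr0.
    by rewrite FS (has_weight_rep EP q0 p0 IH) //= mulrSr !addrA.
  elim: n => [|n IH].
    by rewrite FS F1 (rep_lower EP p0 q0 pq wu Eu) (negbTE o) !mul1r subr0.
  rewrite FS (rep_br EP) // (negbTE o) andFb eqxx expr0 scale1r IH.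
  rewrite repZ // -FS eqxx scale1r mul1r scale1r !wF // !eqxx.
    rewrite (negPf pq) [q == p]eq_sym (negPf pq) -scalerBl -scalerDl.
  congr (_ *: _); rewrite -(mulr_natr (_ - _)) -(mulr_natr (true%:R - _)) !mulr0n !mulr1n.
  rewrite /m -[n.+2%:R]natr1 -[n.+1%:R]natr1.
  move: (n%:R : C) (eta p) (eta q) => x a b.
  ring.
have fF n : f (F n.+1) (F n.+1) = n.+1%:R * (m - n%:R) * f (F n) (F n).
  rewrite {1}FS fE // EF (innerZr fP) addnC.
  rewrite -signr_odd (negPf sg) mul1r conj_Creal //.
  by apply: rpredM; [exact: realn|rewrite rpredB // realn].
have F0 n : F n != 0.
  elim: n => [|n IH]; first by rewrite F1.
  apply/eqP => Fn; have := fF n.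
  rewrite Fn (inner0l fP) => /esym/eqP; rewrite !mulf_eq0 pnatr_eq0 subr_eq0.
  by rewrite (negPf (mn n)) /= => /eqP /(inner_eq0 fP) Fn0; rewrite Fn0 eqxx in IH.
move=> n; have := inner_gt0 fP (F0 n.+1); rewrite fF pmulr_lgt0 ?(inner_gt0 fP) //.
by rewrite pmulr_rgt0 ?ltr0n // subr_gt0.
Qed.

End Unitary.
End UnitaryRepresentations.

(** The Archimedean property of [R] excludes an element above all natural numbers. *)
Lemma dominance (R : realType) (M : lmodType R[i]) (E : int -> int -> M -> M)
    (f : M -> M -> R[i]) (eta : int -> R[i]) (p q : int) (u : M) :
    is_gl_rep E -> is_inner f -> is_star_form E f ->
    p != 0 -> q != 0 -> p != q -> ~~ podd (q - p) ->
    ~~ odd (sbrk p + sbrk q) -> u != 0 -> has_weight E eta u -> E p q u = 0 ->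
  exists n : nat, eta p - eta q = n%:R.
Proof.
move=> EP fP fE p0 q0 pq o sg u0 wu Eu; apply: contrapT => nm.
have mge := dominance_gt EP fP fE p0 q0 pq o sg u0 wu Eu.
have {mge}/mge mge : forall n : nat, eta p - eta q != n%:R.
  by move=> n; apply/eqP => mn; apply: nm; exists n.
move: (eta p - eta q) mge => m mge {nm}.
have mRe : m = (complex.Re m)%:C%C.
  by rewrite RRe_real // realE (ltW (mge 0%N)).
have Re0 : 0 <= complex.Re m by rewrite -lecR -mRe; exact: ltW (mge 0%N).
have := mge (Num.bound (complex.Re m)).
rewrite mRe -(rmorph_nat (real_complex R)) ltcR.
by move=> /(lt_trans (archi_boundP Re0)); rewrite ltxx.
Qed.

(** * Bosonic and fermionic oscillators *)

Section Fock.
Variables (C : numClosedFieldType) (fer : nat -> bool).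

Definition finsupp : {pred (nat -> nat) -> C^o} := fun f =>
  `[< finite_set [set n | f n != 0] >].

Fact finsupp_submod : submod_closed finsupp.
Proof.
split=> [|c f g].
  by apply/asboolP; rewrite (_ : mkset _ = classical_sets.set0) // -subset0 => n /=; rewrite eqxx.
move=> /asboolP ff /asboolP gf; apply/asboolP.
apply: (@sub_finite_set _ _ ([set n | f n != 0] `|` [set n | g n != 0])%classic);
  last by rewrite finite_setU.
move=> n /=; have -> : (c *: f + g) n = c * f n + g n by [].
by have [->|] := eqVneq (f n) 0; [rewrite mulr0 add0r; right|left].
Qed.
HB.instance Definition _ := GRing.isSubmodClosed.Build C ((nat -> nat) -> C^o)
  finsupp finsupp_submod.

(* The modes are numbered by [nat] and [fer] selects the fermionic ones; a
   function [n : nat -> nat] is an occupation number state. *)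
Record fock := Fock { fockval :> (nat -> nat) -> C^o; _ : fockval \in finsupp }.
HB.instance Definition _ := [isSub for fockval].
HB.instance Definition _ := [Choice of fock by <:].
HB.instance Definition _ := [SubChoice_isSubLmodule of fock by <:].

Definition raise (m : nat) (n : nat -> nat) : nat -> nat :=
  fun i => (n i + (i == m))%N.
Definition lower (m : nat) (n : nat -> nat) : nat -> nat :=
  fun i => (n i - (i == m))%N.

Lemma raiseK m : cancel (raise m) (lower m).
Proof. by move=> n; apply/funext => i; rewrite /raise /lower addnK. Qed.

Lemma lowerK m n : (0 < n m)%N -> raise m (lower m n) = n.
Proof.
move=> nm; apply/funext => i; rewrite /raise /lower.
by case: eqP => [->|_]; rewrite ?subn0 ?addn0 // subnK.
Qed.

Lemma raiseC m m' n : raise m (raise m' n) = raise m' (raise m n).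
Proof. by apply/funext => i; rewrite /raise addnAC. Qed.

Lemma lowerC m m' n : lower m (lower m' n) = lower m' (lower m n).
Proof. by apply/funext => i; rewrite /lower subnAC. Qed.

Lemma raise_lower m m' n : m != m' ->
  raise m (lower m' n) = lower m' (raise m n).
Proof.
move=> mm; apply/funext => i; rewrite /raise /lower.
by case: (eqVneq i m) => [->|]; rewrite ?(negPf mm) ?subn0 ?addn0.
Qed.

(* The Jordan-Wigner sign. *)
Definition jw (n : nat -> nat) (m : nat) : bool :=
  fer m && odd (\sum_(i < m | fer i) n i).

Lemma jw_raise m m' n :
  jw (raise m n) m' = jw n m' (+) [&& fer m', fer m & (m < m')%N].
Proof.
rewrite /jw; case: (fer m') => //=; rewrite -[RHS]/(_ (+) _).
have -> : (\sum_(i < m' | fer i) raise m n i =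
           \sum_(i < m' | fer i) n i + (fer m && (m < m'))%N)%N.
  rewrite big_split /=; congr addn.
  case: ltnP => mm'; last first.
    rewrite andbF big1 // => i _; case: eqP => // im.
    by have := ltn_ord i; rewrite im ltnNge mm'.
  rewrite andbT big_mkcond (bigD1 (Ordinal mm')) //= eqxx big1 ?addn0 => [|i im].
    by case: (fer m).
  by rewrite (negPf (_ : nat_of_ord i != m)) ?if_same // -[m]/(nat_of_ord (Ordinal mm')).
by rewrite oddD oddb.
Qed.

Lemma jw_lower m m' n : (0 < n m)%N ->
  jw (lower m n) m' = jw n m' (+) [&& fer m', fer m & (m < m')%N].
Proof. by move=> nm; rewrite -{2}(lowerK nm) jw_raise addbK. Qed.

(* A fermionic mode also ranges over all of [nat]: the occupation numbers [2k]
   and [2k+1] span one copy of the two-dimensional fermionic space for each [k]. *)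
Definition amp (b : bool) (k : nat) : C :=
  if b then (~~ odd k)%:R else sqrtC k.+1%:R.

Lemma amp_real b k : (amp b k)^* = amp b k.
Proof.
rewrite /amp; case: b; first by rewrite conjC_nat.
by rewrite conj_Creal // ger0_real // sqrtC_ge0 ler0n.
Qed.

Definition annfun (m : nat) (f : (nat -> nat) -> C^o) : (nat -> nat) -> C^o :=
  fun n => (-1) ^+ jw n m * amp (fer m) (n m) * f (raise m n).
Definition crefun (m : nat) (f : (nat -> nat) -> C^o) : (nat -> nat) -> C^o :=
  fun n => if (0 < n m)%N
           then (-1) ^+ jw n m * amp (fer m) (n m).-1 * f (lower m n) else 0.

Fact ann_subproof m (f : fock) : annfun m f \in finsupp.
Proof.
have /asboolP ff := valP f; apply/asboolP.
apply: (@sub_finite_set _ _ (raise m @^-1` [set n | f n != 0])%classic).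
  by move=> n /=; apply: contraNneq => fn; rewrite /annfun fn mulr0.
apply: finite_preimage ff => n n' _ _; exact: (can_inj (raiseK m)).
Qed.
Definition ann m (f : fock) : fock := Fock (ann_subproof m f).

Fact cre_subproof m (f : fock) : crefun m f \in finsupp.
Proof.
have /asboolP ff := valP f; apply/asboolP.
apply: (@sub_finite_set _ _ (raise m @` [set n | f n != 0])%classic).
  move=> n /=; rewrite /crefun; case: ifP => [nm fn|]; last by rewrite eqxx.
  by exists (lower m n); [apply: contraNneq fn => ->; rewrite mulr0|rewrite lowerK].
exact: finite_image.
Qed.
Definition cre m (f : fock) : fock := Fock (cre_subproof m f).

Lemma fockP (f g : fock) : (forall n, f n = g n) -> f = g.
Proof. by move=> fg; apply/val_inj/funext. Qed.

Lemma fockD (f g : fock) n : (f + g) n = f n + g n. Proof. by []. Qed.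
Lemma fockZ c (f : fock) n : (c *: f) n = c * f n. Proof. by []. Qed.
Lemma annE m (f : fock) n :
  ann m f n = (-1) ^+ jw n m * amp (fer m) (n m) * f (raise m n).
Proof. by []. Qed.
Lemma creE m (f : fock) n :
  cre m f n = if (0 < n m)%N
    then (-1) ^+ jw n m * amp (fer m) (n m).-1 * f (lower m n) else 0.
Proof. by []. Qed.

Fact ann_linear m : linear (ann m).
Proof. by move=> c f g; apply: fockP => n; rewrite fockD fockZ !annE fockD fockZ; ring. Qed.
HB.instance Definition _ m :=
  GRing.isLinear.Build C fock fock *:%R (ann m) (ann_linear m).

Fact cre_linear m : linear (cre m).
Proof.
move=> c f g; apply: fockP => n; rewrite fockD fockZ !creE fockD fockZ.
by case: ifP => _; [ring|rewrite mulr0 addr0].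
Qed.
HB.instance Definition _ m :=
  GRing.isLinear.Build C fock fock *:%R (cre m) (cre_linear m).

Lemma neq_ltn_sign m m' : m != m' ->
  (-1) ^+ (fer m && fer m') =
    (-1) ^+ [&& fer m', fer m & (m < m')%N] * (-1) ^+ [&& fer m, fer m' & (m' < m)%N] :> C.
Proof.
case: (fer m); case: (fer m') => /=; rewrite ?mulr1 //.
by case: ltngtP; rewrite ?mulr1 ?mul1r.
Qed.

Lemma raise_neq m m' n : m' != m -> raise m n m' = n m'.
Proof. by move=> /negPf mm; rewrite /raise mm addn0. Qed.

Lemma lower_neq m m' n : m' != m -> lower m n m' = n m'.
Proof. by move=> /negPf mm; rewrite /lower mm subn0. Qed.

Lemma ann_ann m m' f :
  ann m (ann m' f) = (-1) ^+ (fer m && fer m') *: ann m' (ann m f).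
Proof.
apply: fockP => n; rewrite fockZ !annE raiseC !jw_raise.
have [->|mm] := eqVneq m m'.
  rewrite andbb ltnn !andbF addbF /raise eqxx addn1 /amp.
  case: (fer m'); last by rewrite expr0 mul1r.
  by rewrite /=; case: (odd _); rewrite /= ?mulr0n !(mulr0, mul0r).
rewrite neq_ltn_sign // (raise_neq n mm) raise_neq 1?eq_sym // !signr_addb.
set s := (-1) ^+ [&& _, _ & (m < _)%N]; set t := (-1) ^+ [&& _, _ & (_ < m)%N].
have ss : s * s = 1 by rewrite /s -expr2 sqrr_sign.
have tt : t * t = 1 by rewrite /t -expr2 sqrr_sign.
ring: ss tt.
Qed.

Lemma cre_cre m m' f :
  cre m (cre m' f) = (-1) ^+ (fer m && fer m') *: cre m' (cre m f).
Proof.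
apply: fockP => n; rewrite fockZ !creE lowerC.
have [->|mm] := eqVneq m m'.
  rewrite andbb; case: ifP => [nm|]; last by rewrite mulr0.
  rewrite /lower eqxx subn1; case: ifP => [nm'|]; last by rewrite !mulr0.
  rewrite /amp; case: (fer m'); last by rewrite expr0 mul1r.
  rewrite -[X in odd X](prednK nm') /=.
  by case: (odd _); rewrite ?mulr0n !(mulr0, mul0r).
rewrite (lower_neq n mm) lower_neq 1?eq_sym //.
case: (boolP (0 < n m)%N) => nm; last by rewrite mulr0 if_same mulr0.
case: (boolP (0 < n m')%N) => nm'; last by rewrite !mulr0.
rewrite !jw_lower // neq_ltn_sign // !signr_addb.
set s := (-1) ^+ [&& _, _ & (m < _)%N]; set t := (-1) ^+ [&& _, _ & (_ < m)%N].
have ss : s * s = 1 by rewrite /s -expr2 sqrr_sign.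
have tt : t * t = 1 by rewrite /t -expr2 sqrr_sign.
ring: ss tt.
Qed.

(** For [m = m'] the bosonic amplitudes give [(k + 1) - k = 1]; in the fermionic case exactly one of
    [k] and [k - 1] is even, so the two terms add up to 1. *)
Lemma ann_cre m m' f : ann m (cre m' f) =
  (-1) ^+ (fer m && fer m') *: cre m' (ann m f) + (m == m')%:R *: f.
Proof.
apply: fockP => n; rewrite fockD !fockZ !creE !annE.
have [->|mm] := eqVneq m m'.
  rewrite creE raiseK jw_raise ltnn !andbF addbF andbb mul1r.
  have sgn2 (b : bool) (x y z : C) : (-1) ^+ b * x * ((-1) ^+ b * y * z) = x * y * z.
    have bb : (-1) ^+ b * (-1) ^+ b = 1 :> C by rewrite -expr2 sqrr_sign.
    ring: bb.
  rewrite {1 2}/raise eqxx addn1 /= sgn2.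
  have [n0|nm] := posnP (n m').
    rewrite mulr0 add0r n0 /amp; case: (fer m') => /=.
      by rewrite !mul1r.
    by rewrite sqrtC1 !mul1r.
  rewrite lowerK // jw_lower // ltnn !andbF addbF [lower m' n m']/lower eqxx subn1.
  rewrite sgn2 /amp.
  case: (fer m').
    rewrite -{1 2}(prednK nm) /= negbK expr1.
    by case: (odd _); rewrite /= ?mulr0n ?mulr1n; ring.
  rewrite expr0 mul1r -!expr2 !sqrtCK prednK // -natr1; ring.
rewrite creE mul0r addr0 (raise_neq n) 1?eq_sym //.
case: ifP => nm; last by rewrite !mulr0.
rewrite raise_lower // lower_neq // jw_raise jw_lower // neq_ltn_sign // !signr_addb.
set s := (-1) ^+ [&& _, _ & (m < _)%N]; set t := (-1) ^+ [&& _, _ & (_ < m)%N].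
have ss : s * s = 1 by rewrite /s -expr2 sqrr_sign.
have tt : t * t = 1 by rewrite /t -expr2 sqrr_sign.
ring: ss tt.
Qed.

Definition fock_form (f g : fock) : C := \sum_(n \in [set: nat -> nat]) (f n * (g n)^*).

Lemma fock_form_supp (f g : fock) (s : seq (nat -> nat)) : uniq s ->
  (forall n, n \notin s -> f n = 0) ->
  fock_form f g = \sum_(n <- s) f n * (g n)^*.
Proof.
move=> us fs; rewrite /fock_form (fsbigE s) // => [|n _ /fs ->];
    [by apply: eq_bigl => n; rewrite in_setT|by rewrite mul0r].
Qed.

Lemma fock_supp (f g : fock) : exists s : seq (nat -> nat), uniq s /\
  forall n, n \notin s -> f n = 0 /\ g n = 0.
Proof.
have /asboolP/finite_seqP[s sE] := valP f.
have /asboolP/finite_seqP[t tE] := valP g.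
exists (undup (s ++ t)); rewrite undup_uniq; split=> // n.
rewrite mem_undup mem_cat => /norP[ns nt]; split; apply: contrapT => /eqP h.
  by have /= : [set` s]%classic n by [rewrite -sE]; rewrite (negPf ns).
by have /= : [set` t]%classic n by [rewrite -tE]; rewrite (negPf nt).
Qed.

Lemma fock_form_inner : is_inner fock_form.
Proof.
split.
- move=> u v w; have [s [us sP]] := fock_supp u v.
  rewrite !(@fock_form_supp _ _ s) //;
    try by move=> n /sP[un vn]; rewrite ?fockD ?un ?vn ?addr0.
  by rewrite -big_split /=; apply: eq_bigr => n _; rewrite mulrDl.
- move=> c u w; have [s [us sP]] := fock_supp u w.
  rewrite !(@fock_form_supp _ _ s) //;
    try by move=> n /sP[un _]; rewrite ?fockZ ?un ?mulr0.
  by rewrite mulr_sumr; apply: eq_bigr => n _; rewrite mulrA.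
- move=> u w; have [s [us sP]] := fock_supp u w.
  rewrite !(@fock_form_supp _ _ s) //; try by move=> n /sP[].
  rewrite rmorph_sum; apply: eq_bigr => n _.
  by rewrite rmorphM /= conjCK mulrC.
- move=> u u0; have [s [us sP]] := fock_supp u u.
  rewrite (@fock_form_supp _ _ s) //; last by move=> n /sP[].
  rewrite lt0r sumr_ge0 ?andbT => [|n _]; last exact: mul_conjC_ge0.
  apply: contraNneq u0 => /eqP; rewrite psumr_eq0 => [|n _]; last exact: mul_conjC_ge0.
  move=> /allP us0; apply/eqP/fockP => n.
  have [/us0|/sP[]//] := boolP (n \in s).
  by rewrite /= mul_conjC_eq0 => /eqP.
Qed.

(** [raise m] is a bijection from all states onto those with mode [m] occupied, and [cre m g] is
    supported on the latter. The amplitudes are real, so reindexing the sum moves the operator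
    across. *)
Lemma fock_form_ann m f g : fock_form (ann m f) g = fock_form f (cre m g).
Proof.
rewrite /fock_form.
have -> : \sum_(n \in [set: nat -> nat]) (f n * (cre m g n)^*) =
          \sum_(n \in [set n : nat -> nat | (0 < n m)%N]) (f n * (cre m g n)^*).
  apply/esym/fsbig_widen => // n [_ nm].
  have cn : cre m g n = 0 by rewrite creE; case: ifP nm.
  by change (f n * (cre m g n)^* = 0); rewrite cn conjC0 mulr0.
have bij : set_bij [set: nat -> nat] [set n : nat -> nat | (0 < n m)%N] (raise m).
  split=> [n _ /=|n n' _ _|n /= nm]; first by rewrite /raise eqxx addn1.
    exact: (can_inj (raiseK m)).
  by exists (lower m n) => //; rewrite lowerK.
rewrite (reindex_fsbig _ _ _ _ bij); apply: eq_fsbigr => n _; rewrite annE.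
rewrite -[RHS]/(f (raise m n) * (cre m g (raise m n))^*) creE raiseK.
have -> : raise m n m = (n m).+1 by rewrite /raise eqxx addn1.
rewrite ltn0Sn succnK jw_raise ltnn !andbF addbF !rmorphM /= amp_real.
by rewrite rmorph_sign; ring.
Qed.

Lemma fock_form_cre m f g : fock_form (cre m f) g = fock_form f (ann m g).
Proof.
by rewrite (innerC fock_form_inner) -fock_form_ann -(innerC fock_form_inner).
Qed.

Definition state_fun (n0 : nat -> nat) : (nat -> nat) -> C^o :=
  fun n => (`[< n = n0 >])%:R.

Fact state_subproof n0 : state_fun n0 \in finsupp.
Proof.
apply/asboolP; apply: (@sub_finite_set _ _ [set n0]%classic); last exact: finite_set1.
by move=> n /=; rewrite /state_fun; case: asboolP => // _; rewrite eqxx.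
Qed.
Definition state n0 : fock := Fock (state_subproof n0).

Lemma stateE n0 n : state n0 n = (`[< n = n0 >])%:R. Proof. by []. Qed.

Lemma state_neq0 n0 : state n0 != 0.
Proof.
apply/eqP => /(congr1 (fun f : fock => f n0)); rewrite stateE asboolT // => /eqP.
by rewrite (_ : (0 : fock) n0 = 0) // oner_eq0.
Qed.

Lemma ann_state0 m n0 : n0 m = 0%N -> ann m (state n0) = 0.
Proof.
move=> n0m; apply: fockP => n; rewrite annE stateE asboolF ?mulr0 //.
by move=> h; move: n0m; rewrite -h /raise eqxx addn1.
Qed.

Lemma cre_state1 m n0 : fer m -> n0 m = 1%N -> cre m (state n0) = 0.
Proof.
move=> fm n0m; apply: fockP => n; rewrite creE stateE; case: ifP => // nm.
case: asboolP => [h|_]; last by rewrite mulr0.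
have : n0 m = (n m).-1 by rewrite -h /lower eqxx subn1.
by rewrite n0m fm => <-; rewrite /amp /= mulr0 mul0r.
Qed.

Lemma cre_ann_state m n0 : fer m -> (n0 m <= 1)%N ->
  cre m (ann m (state n0)) = (n0 m)%:R *: state n0.
Proof.
move=> fm; case E : (n0 m) => [|[|//]] _; first by rewrite ann_state0 // linear0 scale0r.
have := ann_cre m m (state n0).
rewrite cre_state1 // linear0 fm eqxx expr1 scaleN1r addrC => /esym/eqP.
by rewrite subr_eq0 => /eqP <-.
Qed.

End Fock.

(** * The oscillator representation *)

Section FockRepresentation.
Variables (C : numClosedFieldType) (d : nat).

Definition mode (p : int) (a : nat) : nat := pickle (p, a).
Definition fermionic (c : nat) : bool :=
  if @unpickle (int * nat)%type c is Some pa then ~~ podd pa.1 else false.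

Local Notation F := (fock C).
Local Notation ann := (@ann C fermionic).
Local Notation cre := (@cre C fermionic).

Lemma fermionic_mode p a : fermionic (mode p a) = ~~ podd p.
Proof. by rewrite /fermionic /mode pickleK. Qed.

Lemma mode_eq p q a b : (mode p a == mode q b) = (p == q) && (a == b).
Proof. by rewrite (inj_eq (pcan_inj pickleK)) xpair_eqE. Qed.

(* Negative modes are in their dual vacuum, so that creation and annihilation
   operators are exchanged there; the bosonic ones acquire a sign. *)
Definition opP (p : int) (a : nat) (f : F) : F :=
  if 0 < p then cre (mode p a) f else ann (mode p a) f.
Definition opQ (p : int) (a : nat) (f : F) : F :=
  if 0 < p then ann (mode p a) f
  else (-1) ^+ podd p *: cre (mode p a) f.

Fact opP_linear p a : linear (opP p a).
Proof. by move=> c f g; rewrite /opP; case: ifP => _; rewrite linearP. Qed.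
HB.instance Definition _ p a :=
  GRing.isLinear.Build C F F *:%R (opP p a) (opP_linear p a).
Fact opQ_linear p a : linear (opQ p a).
Proof.
move=> c f g; rewrite /opQ; case: ifP => _; rewrite linearP //.
by rewrite scalerDr !scalerA mulrC.
Qed.
HB.instance Definition _ p a :=
  GRing.isLinear.Build C F F *:%R (opQ p a) (opQ_linear p a).

Local Notation eps p q := ((-1) ^+ (~~ podd p && ~~ podd q)).

Lemma eps2 p q : eps p q * eps p q = 1 :> C.
Proof. by rewrite -expr2 sqrr_sign. Qed.

Lemma cre_ann p q a b (f : F) : cre (mode p a) (ann (mode q b) f) =
  eps p q *: ann (mode q b) (cre (mode p a) f)
    - (eps p q * ((p == q) && (a == b))%:R) *: f.
Proof.
rewrite ann_cre !fermionic_mode mode_eq scalerDr !scalerA.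
rewrite andbC eps2 scale1r [(q == p)]eq_sym [(b == a)]eq_sym.
by rewrite addrK.
Qed.

Lemma opPP p r a b f : opP p a (opP r b f) = eps p r *: opP r b (opP p a f).
Proof.
rewrite /opP; case: ifP => p0; case: ifP => r0.
- by rewrite cre_cre !fermionic_mode.
- rewrite cre_ann (negPf (_ : p != r)) ?andFb ?mulr0 ?scale0r ?subr0 //; lia.
- rewrite ann_cre !fermionic_mode mode_eq (negPf (_ : p != r)); last by lia.
  by rewrite andFb scale0r addr0.
- by rewrite ann_ann !fermionic_mode.
Qed.

Lemma opQQ p r a b f : opQ p a (opQ r b f) = eps p r *: opQ r b (opQ p a f).
Proof.
rewrite /opQ; case: ifP => p0; case: ifP => r0.
- by rewrite ann_ann !fermionic_mode.
- rewrite linearZ /= ann_cre !fermionic_mode mode_eq (negPf (_ : p != r)); last by lia.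
  by rewrite andFb scale0r addr0 !scalerA mulrC.
- rewrite cre_ann (negPf (_ : p != r)) ?andFb ?mulr0 ?scale0r ?subr0; last by lia.
  by rewrite [in RHS]linearZ /= !scalerA mulrC.
- by rewrite !linearZ /= cre_cre !fermionic_mode !scalerA.
Qed.

Lemma opQP q r a b f : opQ q a (opP r b f) =
  eps q r *: opP r b (opQ q a f) + ((q == r) && (a == b))%:R *: f.
Proof.
rewrite /opP /opQ; case: ifP => q0; case: ifP => r0.
- by rewrite ann_cre !fermionic_mode mode_eq.
- rewrite ann_ann !fermionic_mode (negPf (_ : q != r)); last by lia.
  by rewrite andFb scale0r addr0.
- rewrite cre_cre !fermionic_mode (negPf (_ : q != r)); last by lia.
  by rewrite andFb scale0r addr0 [cre (mode r b) (_ *: _)]linearZ /= !scalerA mulrC.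
- rewrite cre_ann [ann _ (_ *: _)]linearZ /= scalerBr !scalerA [_ * eps _ _]mulrC; congr (_ + _).
  rewrite -scaleNr; congr (_ *: _).
  case: eqP => [->|_]; last by rewrite !mulr0 oppr0.
  case: (a == b); last by rewrite !mulr0 oppr0.
  by case: (podd r); rewrite /= ?expr1 ?expr0 ?mul1r ?mulN1r ?opprK.
Qed.

(** The quadratic oscillator realisation familiar from Howe duality with GL_d; [a] is the colour. *)
Definition fock_rep (p q : int) (f : F) : F := \sum_(a < d) opP p a (opQ q a f).

Fact fock_rep_linear p q : linear (fock_rep p q).
Proof.
move=> c f g; rewrite /fock_rep scaler_sumr -big_split; apply: eq_bigr => a _ /=.
by rewrite !linearP.
Qed.

Lemma fock_rep_comm p q r s a b f :
  opP p a (opQ q a (opP r b (opQ s b f))) =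
    (-1) ^+ (podd (q - p) && podd (s - r)) *:
      opP r b (opQ s b (opP p a (opQ q a f)))
    + (a == b)%:R *: ((q == r)%:R *: opP p a (opQ s a f)
    - ((-1) ^+ (podd (q - p) && podd (s - r)) * (s == p)%:R) *: opP r a (opQ q a f)).
Proof.
have PQ x : opP p a (opQ s b x) = eps s p *: opQ s b (opP p a x)
    - (eps s p * ((s == p) && (b == a))%:R) *: x.
  rewrite opQP scalerDr !scalerA eps2 scale1r.
  by rewrite addrK.
rewrite opQP linearD /= !linearZ /= opPP opQQ !linearZ /= PQ.
rewrite (linearB (opP r b)) !(linearZ_LR (opP r b)) /=.
rewrite ![_ *: (_ - _)]scalerBr !scalerN !scalerA -addrA.
(* The signs from exchanging the two factors of one product with the two of the other combine to the
   super sign. *)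
have sgn : eps p r * eps q s * eps q r * eps s p =
    (-1) ^+ (podd (q - p) && podd (s - r)) :> C.
  rewrite -!signr_addb !poddB; congr (_ ^+ _).
  by case: (podd p); case: (podd q); case: (podd r); case: (podd s).
rewrite !mulrA sgn; congr (_ + _).
have [->|ab] := eqVneq a b.
  by rewrite ?eqxx !andbT scale1r addrC.
rewrite !andbF mulr0 !scale0r.
by rewrite oppr0 addr0.
Qed.

Lemma fock_rep_gl : is_gl_rep fock_rep.
Proof.
split=> [p q|p q r s f p0 q0 r0 s0]; first exact: fock_rep_linear.
rewrite /fock_rep.
transitivity (\sum_(a < d) \sum_(b < d) opP p a (opQ q a (opP r b (opQ s b f)))).
  by apply: eq_bigr => a _; rewrite !linear_sum.
set sg := (-1) ^+ _.
rewrite (eq_bigr (fun a : 'I_d => \sum_(b < d)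
   sg *: opP r b (opQ s b (opP p a (opQ q a f))) +
   ((q == r)%:R *: opP p a (opQ s a f) - (sg * (s == p)%:R) *: opP r a (opQ q a f)))).
  rewrite big_split /= exchange_big /= scaler_sumr; congr (_ + _).
    by apply: eq_bigr => b _; rewrite !linear_sum.
  by rewrite sumrB -!scaler_sumr.
move=> a _; rewrite (eq_bigr _ (fun (b : 'I_d) _ => fock_rep_comm p q r s a b f)).
rewrite big_split /=; congr (_ + _).
rewrite (bigD1 a) //= eqxx scale1r big1 ?addr0 // => b ba.
by rewrite -val_eqE eq_sym /= in ba; rewrite (negPf ba) scale0r.
Qed.

Local Notation form := (@fock_form C).

Lemma opP_adj p a f g : p != 0 ->
  form (opP p a f) g = (-1) ^+ sbrk p * form f (opQ p a g).
Proof.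
move=> p0; rewrite /opP /opQ /sbrk; case: ifP => p1.
  by rewrite fock_form_cre ltNge ltW // andbF mul1r.
have -> : p < 0 by lia.
rewrite andbT fock_form_ann (innerZr (fock_form_inner C)) rmorph_sign mulrA.
by rewrite -expr2 sqrr_sign mul1r.
Qed.

Lemma opQ_adj p a f g : p != 0 ->
  form (opQ p a f) g = (-1) ^+ sbrk p * form f (opP p a g).
Proof.
move=> p0; rewrite (innerC (fock_form_inner C)) [in RHS](innerC (fock_form_inner C)).
rewrite opP_adj // rmorphM rmorph_sign /= mulrA.
by rewrite -expr2 sqrr_sign mul1r.
Qed.

Lemma fock_rep_star : is_star_form fock_rep form.
Proof.
have fI := fock_form_inner C.
move=> p q u w p0 q0; rewrite /fock_rep.
have formsl (I : Type) (s : seq I) (G : I -> F) z :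
    form (\sum_(i <- s) G i) z = \sum_(i <- s) form (G i) z.
  by elim: s => [|i s IH]; rewrite ?big_nil ?(inner0l fI) // !big_cons (innerDl fI) IH.
have formsr (I : Type) (s : seq I) (G : I -> F) z :
    form z (\sum_(i <- s) G i) = \sum_(i <- s) form z (G i).
  by elim: s => [|i s IH]; rewrite ?big_nil ?(inner0r fI) // !big_cons (innerDr fI) IH.
rewrite formsl formsr mulr_sumr; apply: eq_bigr => a _.
by rewrite opP_adj // opQ_adj // exprD mulrA.
Qed.

Variable occ : int -> nat -> bool.

Definition occupation (c : nat) : nat :=
  if @unpickle (int * nat)%type c is Some pa
  then (~~ podd pa.1 && occ pa.1 pa.2) : nat else 0%N.

Lemma occupation_mode p a : occupation (mode p a) = (~~ podd p && occ p a).
Proof. by rewrite /occupation /mode pickleK. Qed.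

Definition fermi_state : F := state C occupation.

Lemma fermi_state_neq0 : fermi_state != 0.
Proof. exact: state_neq0. Qed.

(** On the negative side the operators are exchanged, so fermionic weights count empty modes, and
    each bosonic vacuum mode contributes -1. *)
Definition fermi_weight (p : int) : C :=
  if podd p then (if 0 < p then 0 else - d%:R)
  else (\sum_(a < d) (occ p a == (0 < p)%R))%:R.

Lemma fermi_weightP : has_weight fock_rep fermi_weight fermi_state.
Proof.
move=> p p0; rewrite /fock_rep /fermi_weight.
rewrite (eq_bigr (fun a : 'I_d => (if podd p then (if 0 < p then 0 else -1)
    else (occ p a == (0 < p))%:R) *: fermi_state)).
  rewrite -scaler_suml; congr (_ *: _); case: (podd p); last by rewrite natr_sum.
  case: (0 < p); first by rewrite big1.
  by rewrite big_const_ord iter_addr addr0 mulNrn.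
move=> a _; rewrite /opP /opQ; have om := occupation_mode p a.
have fm := fermionic_mode p a; case: (boolP (0 < p)) => p1 /=; have [po|po] := boolP (podd p).
- by rewrite /fermi_state ann_state0 ?om ?po // linear0 /= scale0r.
- rewrite cre_ann_state ?fm ?po ?om //=; last by rewrite po; case: (occ p a).
  by rewrite po /=; case: (occ p a).
- rewrite linearZ /= ann_cre fm andbb eqxx scale1r.
  by rewrite /fermi_state ann_state0 ?om ?po // linear0 scaler0 add0r expr1.
- rewrite linearZ /= ann_cre fm andbb eqxx scale1r po /=.
  rewrite cre_ann_state ?fm ?po ?om //=; last by rewrite po; case: (occ p a).
  rewrite po expr1 -/fermi_state scalerA -scalerDl.
  congr (_ *: _).
  by case: (occ p a); rewrite /= ?mulr1 ?mulr0 ?addNr ?add0r.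
Qed.

(** For each colour one of the two factors of [E p q] annihilates the state; for [p != q] they can
    be interchanged up to sign, so it does not matter which. *)
Lemma fermi_state_kill p q : p != 0 -> q != 0 -> p != q ->
    (forall a : nat, (a < d)%N ->
       (if 0 < q then podd q || ~~ occ q a else ~~ podd q && occ q a) \/
       (if 0 < p then ~~ podd p && occ p a else podd p || ~~ occ p a)) ->
  fock_rep p q fermi_state = 0.
Proof.
move=> p0 q0 pq H; rewrite /fock_rep big1 // => a _.
have [h|h] := H a (ltn_ord a).
  rewrite (_ : opQ q a _ = 0) ?linear0 // /opQ; case: ifP h => q1 h.
    by rewrite ann_state0 // occupation_mode; move: h; case: (podd q) => //= /negPf ->.
  by move: h => /andP[qo qa]; rewrite cre_state1 ?scaler0 ?fermionic_mode // occupation_mode qo qa.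
have -> : opP p a (opQ q a fermi_state) = eps q p *: opQ q a (opP p a fermi_state).
  by rewrite opQP (eq_sym q) (negPf pq) andFb scale0r addr0 scalerA eps2 scale1r.
rewrite (_ : opP p a _ = 0) ?linear0 ?scaler0 // /opP; case: ifP h => p1 h.
  by move: h => /andP[qo qa]; rewrite cre_state1 ?fermionic_mode // occupation_mode qo qa.
by rewrite ann_state0 // occupation_mode; move: h; case: (podd p) => //= /negPf ->.
Qed.

End FockRepresentation.

(** * Odd reflections *)

Section OddReflections.
Variables (C : numClosedFieldType) (M : lmodType C) (E : int -> int -> M -> M).
Variable (f : M -> M -> C).
Hypotheses (EP : is_gl_rep E) (fP : is_inner f) (fE : is_star_form E f).

Definition killed (K : rel int) (u : M) : Prop :=
  forall r s : int, r != 0 -> s != 0 -> K r s -> E r s u = 0.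

(** The condition relating [K] and [K'] says that [(q, p)] is simple for [K]: moving [E r s] past
    [E p q] leaves only [E r q] (if [s = p]) and [E p s] (if [r = q]), and both must already kill
    [u]. When the two weights cancel, [E p q u = 0], and [u] itself serves for the new order. *)
Lemma reflect_killed (K K' : rel int) (p q : int) (eta : int -> C) (u : M) :
    p != 0 -> q != 0 -> podd (q - p) -> K q p ->
    (forall r s : int, r != 0 -> s != 0 -> K' r s -> (r = p /\ s = q) \/
      [/\ K r s, ~ (r = q /\ s = p), s = p -> K r q & r = q -> K p s]) ->
    u != 0 -> has_weight E eta u -> killed K u ->
  if eta q + eta p == 0 then killed K' u
  else [/\ E p q u != 0,
    has_weight E (fun t => eta t + (t == p)%:R - (t == q)%:R) (E p q u)
    & killed K' (E p q u)].
Proof.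
move=> p0 q0 o Kqp KK' u0 wu Ku.
have Eqp : E q p u = 0 by apply: Ku.
have o' : podd (p - q) by rewrite poddBC.
case: eqP => [h|/eqP h].
  move=> r s r0 s0 /(KK' _ _ r0 s0)[[-> ->]|[Krs _ _ _]]; last exact: Ku.
  exact: (odd_reflection_eq0 EP fP fE q0 p0 o' wu Eqp h).
split; first exact: (odd_reflection_neq0 EP q0 p0 o' u0 wu Eqp h).
  exact: (has_weight_rep EP).
move=> r s r0 s0 /(KK' _ _ r0 s0)[[-> ->]|[Krs ne sp rq]].
  exact: (rep_odd_sqr EP).
rewrite (rep_br EP) // (Ku r s) // (rep0 EP) scaler0 add0r.
case: (eqVneq s p) => [spE|_]; case: (eqVneq q r) => [qr|_].
- by case: ne.
- by rewrite (Ku r q) ?sp // scaler0 mulr0 scale0r subr0.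
- by rewrite (Ku p s) ?rq // !scaler0 scale0r subr0.
- by rewrite mulr0 !scale0r subr0.
Qed.

End OddReflections.

(** * The sequence of adjacent swaps and its effect on weights *)

Section Reordering.
Local Open Scope nat_scope.
Variable N : nat.

(* Half-integers: the odd index [2i+1] precedes the even index [2j] once the
   pair [(i, j)], [i < j], is processed.  Pairs with [j > N] are processed from
   the start, the others in the order given by [i * (N + 1) + (N - j)]. *)
Definition processed (t i j : nat) : bool :=
  (N < j)%N || (i * N.+1 + (N - j) < t)%N.

(** At [t = 0] the order reads 2, 4, ..., 2N, 1, 3, ..., 2N+1, 2N+2, 2N+3, and so on. The odd
    indices then move left one after another until the natural order is reached; pairs with [j <= i]
    are in natural order throughout. *)
Definition prec (t r s : nat) : bool :=
  if odd r then
    if odd s then (r < s)%N else (r./2 < s./2)%N && processed t r./2 s./2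
  else if odd s then ~~ ((s./2 < r./2)%N && processed t s./2 r./2) else (r < s)%N.

(** The reflection in the pair [(i, j)] is non-trivial exactly when [i < c j]; it then moves one
    unit of weight from [2j] to [2i + 1]. *)
Definition removed (c : nat -> nat) (t j : nat) : nat :=
  \sum_(i < j) ((i < c j) && processed t i j)%N.
Definition added (c : nat -> nat) (t i : nat) : nat :=
  \sum_(j < N.+1) [&& i < j, i < c j & processed t i j]%N.

Definition half_weight (c : nat -> nat) (t m : nat) : int :=
  if odd m then (added c t m./2)%:Z else ((c m./2)%:Z - (removed c t m./2)%:Z)%R.

Lemma processedS t i j : (j <= N)%N -> processed t.+1 i j =
  processed t i j || ((i == t %/ N.+1) && (j == N - t %% N.+1)%N).
Proof.
move=> jN; rewrite /processed ltnNge jN /= ltnS leq_eqVlt orbC; congr (_ || _).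
have h : (N - j < N.+1)%N by rewrite ltnS leq_subr.
apply/eqP/andP => [<-|[/eqP -> /eqP ->]].
  rewrite divnMDl // (divn_small h) addn0 eqxx modnMDl modn_small //.
  by rewrite subKn.
by rewrite subKn -?divn_eq // -ltnS ltn_mod.
Qed.

Lemma processedS_far t i j : (N < j)%N -> processed t.+1 i j = processed t i j.
Proof. by rewrite /processed => ->. Qed.

(** With [(i, j)] read off from the division of [t] by [N + 1], the pairs already treated are those
    before it in the lexicographic order with [i] increasing and [j] decreasing. *)
Lemma processed_cur t i j : (j <= N)%N -> i = t %/ N.+1 -> j = (N - t %% N.+1)%N ->
  forall i' j', (j' <= N)%N ->
  processed t i' j' = (i' < i)%N || ((i' == i) && (j < j')%N).
Proof.
move=> jN iE jE i' j' j'N; rewrite /processed [(N < j')%N]ltnNge j'N /=.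
have te := divn_eq t N.+1; have tm : (t %% N.+1 < N.+1)%N by rewrite ltn_mod.
rewrite -iE in te; set m := (t %% N.+1)%N in te jE tm.
have [lt|gt|ee] := ltngtP i' i => /=; last by rewrite ee; lia.
  have : (i' * N.+1 + N.+1 <= i * N.+1)%N by rewrite -mulSnr leq_mul2r lt orbT.
  by lia.
have : (i * N.+1 + N.+1 <= i' * N.+1)%N by rewrite -mulSnr leq_mul2r gt orbT.
by lia.
Qed.


Lemma sum_ord_lt n m : \sum_(a < n) (a < m) = minn m n.
Proof.
elim: n => [|n IH]; first by rewrite big_ord0 minn0.
by rewrite big_ord_recr /= IH; lia.
Qed.

Section Step.
Variables (t i j : nat).
Hypotheses (jN : j <= N) (iE : i = t %/ N.+1) (jE : j = N - t %% N.+1).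

Let cur := processed_cur jN iE jE.

Let stepP a b : processed t.+1 a b = processed t a b || ((a == i) && (b == j)).
Proof.
have [bN|bN] := leqP b N; first by rewrite processedS // -iE -jE.
by rewrite processedS_far // /processed bN.
Qed.

Lemma prec_cur : i < j -> prec t j.*2 i.*2.+1.
Proof.
move=> ij; rewrite /prec odd_double /= odd_double /=.
by rewrite doubleK uphalf_double ij /= cur // !ltnn andbF.
Qed.

Let proc_gt b : j < b -> processed t i b.
Proof.
move=> jb; have [bN|bN] := leqP b N; last by rewrite /processed bN.
by rewrite cur // eqxx jb orbT.
Qed.

(** In [prec t] the index [2j] comes immediately before [2i + 1]: larger even indices up to [2N]
    have been passed by [2i + 1], and smaller odd ones have passed [2j]. This yields the simplicity
    condition of [reflect_killed]. *)
Lemma prec_step r s : i < j -> prec t.+1 r s ->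
  (r = i.*2.+1 /\ s = j.*2) \/
  [/\ prec t r s, ~ (r = j.*2 /\ s = i.*2.+1), s = i.*2.+1 -> prec t r j.*2
    & r = j.*2 -> prec t i.*2.+1 s].
Proof.
move=> ij; rewrite {1}/prec; have [ro|re] := boolP (odd r);
    have [so|se] := boolP (odd s).
- move=> rs; right; split; [by rewrite /prec ro so| by lia | | by lia].
  move=> sE; rewrite /prec ro odd_double doubleK cur // (_ : r./2 < i) //; lia.
- move=> /andP[rs]; rewrite stepP => /orP[h|/andP[/eqP ri /eqP sj]]; last first.
    by left; split; lia.
  by right; split; [rewrite /prec ro (negPf se) rs|lia|lia|lia].
- move=> h; right.
  have Hb : ~~ ((s./2 < r./2) && processed t s./2 r./2).
    by apply: contra h => /andP[-> h]; rewrite stepP h.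
  split; first by rewrite /prec (negPf re) so.
  + move=> [rE sE]; move: h; rewrite rE sE doubleK /= uphalf_double ij stepP !eqxx.
    by rewrite orbT.
  + move=> sE; rewrite /prec (negPf re) odd_double; rewrite ltnNge.
    apply: contra h => jr; rewrite sE /= uphalf_double stepP eqxx /=.
    have jr2 : j <= r./2 by lia.
    rewrite (leq_trans ij jr2) /=; move: jr2; rewrite leq_eqVlt => /orP[/eqP <-|].
      by rewrite eqxx orbT.
    by move=> /proc_gt ->.
  + move=> rE; rewrite /prec so /= odd_double /= ltnNge; apply: contra h => si.
    have si2 : s./2 <= i by lia.
    rewrite rE doubleK (leq_ltn_trans si2 ij) /= stepP eqxx andbT.
    by move: si2; rewrite leq_eqVlt => /orP[->|si2]; rewrite ?orbT // cur // si2.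
- move=> rs; right; split; [by rewrite /prec (negPf re) (negPf se)|by lia|by lia|].
  move=> rE; rewrite /prec /= odd_double /= (negPf se) uphalf_double.
  have js : j < s./2 by lia.
  by rewrite (ltn_trans ij js) proc_gt.
Qed.

(** The enumeration runs through a full square of pairs; those with [j <= i] are idle steps. *)
Lemma prec_step_id r s : ~~ (i < j) -> prec t.+1 r s = prec t r s.
Proof.
move=> ij; have H a b : (a < b) && processed t.+1 a b = (a < b) && processed t a b.
  rewrite stepP; case: (ltnP a b) => //= ab.
  by case: eqP => [ai|_]; rewrite ?orbF //; case: eqP => [bE|_]; rewrite ?orbF //; lia.
by rewrite /prec !H.
Qed.

Variable c : nat -> nat.

Lemma removed_step b : removed c t.+1 b = removed c t b + [&& i < j, b == j & i < c j].
Proof.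
rewrite /removed; case: (ltnP i j) => /= ij; last first.
  rewrite addn0; apply: eq_bigr => a _; rewrite stepP.
  case: eqP => [ai|_]; rewrite ?orbF //; case: eqP => [bj|_]; rewrite ?orbF //.
  by have := ltn_ord a; lia.
case: (eqVneq b j) => [->|bj] /=; last first.
  by rewrite addn0; apply: eq_bigr => a _; rewrite stepP (negPf bj) andbF orbF.
rewrite (bigD1 (Ordinal ij)) //= [in RHS](bigD1 (Ordinal ij)) //= addnAC.
congr (_ + _); last first.
  by apply: eq_bigr => a; rewrite -val_eqE /= => /negPf ai; rewrite stepP ai orbF.
by rewrite stepP !eqxx orbT andbT cur // !ltnn !andbF.
Qed.

Lemma added_step a : added c t.+1 a = added c t a + [&& i < j, a == i & i < c j].
Proof.
rewrite /added; case: (ltnP i j) => /= ij; last first.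
  rewrite addn0; apply: eq_bigr => b _; rewrite stepP.
  case: eqP => [ai|_]; rewrite ?orbF //; case: eqP => [bj|_]; rewrite ?orbF //.
  by rewrite ai bj ltnNge ij.
case: (eqVneq a i) => [->|ai] /=; last first.
  by rewrite addn0; apply: eq_bigr => b _; rewrite stepP (negPf ai) /= orbF.
have jN1 : j < N.+1 by [].
rewrite (bigD1 (Ordinal jN1)) //= [in RHS](bigD1 (Ordinal jN1)) //= addnAC.
congr (_ + _); last first.
  by apply: eq_bigr => b; rewrite -val_eqE /= => /negPf bj; rewrite stepP bj andbF orbF.
by rewrite stepP !eqxx orbT andbT cur // !ltnn !andbF ij.
Qed.

Hypothesis c_mono : forall a b, a <= b -> c b <= c a.

Lemma removed_cur : i < j -> removed c t j = minn i (c j).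
Proof.
move=> ij; rewrite /removed (eq_bigr (fun a : 'I_j => (a < minn i (c j)) : nat)).
  by rewrite sum_ord_lt (minn_idPl _) // geq_min (ltnW ij).
by move=> a _; rewrite cur // ltnn andbF orbF ltn_min andbC.
Qed.

(** The even index has lost [minn i (c j)] units so far. If [c j <= i] it is empty, and by
    monotonicity of [c] the columns beyond [j] gave nothing to [2i + 1], so both weights are 0.
    Otherwise the even weight is already positive. *)
Lemma half_weight_cur : i < j ->
  (half_weight c t j.*2 + half_weight c t i.*2.+1 == 0)%R = ~~ (i < c j).
Proof.
move=> ij; rewrite /half_weight odd_double /= odd_double /= doubleK uphalf_double.
rewrite removed_cur //; case: (ltnP i (c j)) => ic /=; first by apply/eqP; lia.
have -> : added c t i = 0; last by lia.
rewrite /added big1 // => b _; case: (ltnP i b) => //= ib.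
case: (ltnP i (c b)) => //= icb; have bN : b <= N by rewrite -ltnS.
rewrite cur // ltnn eqxx /=.
by case: (ltnP j b) => // jb; have := c_mono (ltnW jb); lia.
Qed.

Lemma half_weight_step m : half_weight c t.+1 m =
  if (i < j) && (i < c j) then
   (half_weight c t m + (m == i.*2.+1)%N%:R - (m == j.*2)%N%:R)%R
  else half_weight c t m.
Proof.
rewrite /half_weight added_step removed_step; have [mo|me] := boolP (odd m).
  have -> : (m == j.*2) = false by lia.
  have -> : (m == i.*2.+1) = (m./2 == i) by lia.
  by case: (i < j); case: (i < c j); case: eqP => //=; lia.
have -> : (m == i.*2.+1) = false by lia.
have -> : (m == j.*2) = (m./2 == j) by lia.
by case: (i < j); case: (i < c j); case: eqP => //=; lia.
Qed.

End Step.

End Reordering.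

(** * Carrying out all reflections on both sides of 0 *)

Section Chain.
Variables (C : numClosedFieldType) (M : lmodType C) (E : int -> int -> M -> M).
Variable (f : M -> M -> C).
Hypotheses (EP : is_gl_rep E) (fP : is_inner f) (fE : is_star_form E f).
Variables (d N : nat) (cp cm : nat -> nat).
Hypotheses (cp_mono : forall a b, (a <= b)%N -> (cp b <= cp a)%N).
Hypotheses (cm_mono : forall a b, (a <= b)%N -> (cm b <= cm a)%N).

(** Every negative index precedes every positive one throughout; the negative side carries the
    mirror image of [prec]. *)
Definition raising (tp tm : nat) : rel int := fun r s =>
  if r < 0 then (s < 0) ==> prec N tm `|s| `|r|
  else (0 <= s) && prec N tp `|r| `|s|.

Definition chain_weight (tp tm : nat) (p : int) : int :=
  if 0 < p then half_weight N cp tp `|p|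
  else (if podd p then - d%:Z else d%:Z) - half_weight N cm tm `|p|.

Definition chain_vector (tp tm : nat) (u : M) : Prop :=
  [/\ u != 0, has_weight E (fun p => (chain_weight tp tm p)%:~R) u
    & killed E (raising tp tm) u].

Lemma chain_step_pos tp tm :
  (exists u, chain_vector tp tm u) -> exists u, chain_vector tp.+1 tm u.
Proof.
move=> [u [u0 wu Ku]].
pose i := (tp %/ N.+1)%N; pose j := (N - tp %% N.+1)%N.
have jN : (j <= N)%N by rewrite leq_subr.
have [ij|ij] := boolP (i < j)%N; last first.
  exists u; split=> //.
    move=> p p0; rewrite wu // /chain_weight; case: ifP => // _.
    by rewrite (half_weight_step jN (erefl i) (erefl j)) (negPf ij).
  move=> r s r0 s0; rewrite /raising; case: ifP => r1 h; apply: Ku => //;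
    rewrite /raising r1 //.
  by move: h; rewrite (prec_step_id jN (erefl i) (erefl j)).
pose p : int := i.*2.+1%:Z; pose q : int := j.*2%:Z.
have p0 : p != 0 by [].
have q0 : q != 0 by rewrite /q; lia.
have wp : chain_weight tp tm p = half_weight N cp tp i.*2.+1 by [].
have wq : chain_weight tp tm q = half_weight N cp tp j.*2.
  by rewrite /chain_weight (_ : 0 < q) //; rewrite /q; lia.
have qp : podd (q - p) by rewrite /p /q /podd; lia.
have Kqp : raising tp tm q p by rewrite /raising /= prec_cur.
have := reflect_killed EP fP fE (K' := raising tp.+1 tm) p0 q0 qp Kqp _ u0 wu Ku.
rewrite -intrD intr_eq0 wp wq half_weight_cur //.
move=> H; move: H; set T := (if _ then _ else _) => H; have {H} : T; last rewrite /T {T}.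
  apply: H => r s r0 s0.
  rewrite /raising; case: ifP => r1 h.
    by right; split=> //; rewrite /p /q; lia.
  move: h => /andP[s1 /(prec_step jN (erefl i) (erefl j) ij)].
  case=> [[rE sE]|[h1 h2 h3 h4]]; [left; rewrite /p /q|right].
    by move: rE sE r1 s1; case: r r0 => // r _; case: s s0 => // s _ /= -> ->.
  split.
  + by rewrite s1.
  + by move=> [rE sE]; apply: h2; rewrite rE sE.
  + by move=> sE; rewrite h3 // sE.
  + by move=> rE; rewrite s1 h4 // rE.
have [ic|ic] := boolP (i < cp j)%N => /=.
  case=> Eu0 wE KE; exists (E p q u); split=> // t t0; rewrite wE //.
  congr (_ *: _); rewrite /chain_weight; case: ifP => t1.
    rewrite (half_weight_step jN (erefl i) (erefl j)) ij ic /= rmorphB rmorphD /=.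
    case: t t0 t1 => // t _ _.
    by rewrite !rmorph_nat.
  have -> : (t == p) = false by rewrite /p; lia.
  have -> : (t == q) = false by rewrite /q; lia.
  by rewrite addr0 subr0.
move=> Ku'; exists u; split=> // t t0; rewrite wu //; congr (_ *: _).
rewrite /chain_weight; case: ifP => // _.
by rewrite (half_weight_step jN (erefl i) (erefl j)) (negPf ic) andbF.
Qed.

(** The mirror image exchanges the roles of even and odd index in the reflection. The contributions
    [d] and [- d] cancel in the sum of the two weights, so the criterion for a trivial step is again
    [half_weight_cur]. *)
Lemma chain_step_neg tp tm :
  (exists u, chain_vector tp tm u) -> exists u, chain_vector tp tm.+1 u.
Proof.
move=> [u [u0 wu Ku]].
pose i := (tm %/ N.+1)%N; pose j := (N - tm %% N.+1)%N.
have jN : (j <= N)%N by rewrite leq_subr.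
have [ij|ij] := boolP (i < j)%N; last first.
  exists u; split=> //.
    move=> p p0; rewrite wu // /chain_weight; case: ifP => // _.
    by rewrite (half_weight_step jN (erefl i) (erefl j)) (negPf ij).
  move=> r s r0 s0; rewrite /raising; case: ifP => r1 h; apply: Ku => //;
    rewrite /raising r1 //.
  by move: h; rewrite (prec_step_id jN (erefl i) (erefl j)).
pose q : int := - i.*2.+1%:Z; pose p : int := - j.*2%:Z.
have q0 : q != 0 by [].
have p0 : p != 0 by rewrite /p; lia.
have aq : `|q|%N = i.*2.+1 by [].
have ap : `|p|%N = j.*2 by rewrite /p; lia.
have wq : chain_weight tp tm q = - d%:Z - half_weight N cm tm i.*2.+1.
  rewrite /chain_weight aq (_ : 0 < q = false) // /podd aq /= odd_double //.
have wp : chain_weight tp tm p = d%:Z - half_weight N cm tm j.*2.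
  rewrite /chain_weight ap /podd ap odd_double (_ : 0 < p = false) //; rewrite /p; lia.
have cq : ((chain_weight tp tm q)%:~R + (chain_weight tp tm p)%:~R == 0 :> C) =
   ~~ (i < cm j)%N.
  rewrite -intrD intr_eq0 wp wq -(half_weight_cur jN (erefl i) (erefl j)) //.
  by apply/eqP/eqP; lia.
have p1 : p < 0 by rewrite /p; lia.
have q1 : q < 0 by [].
have qp : podd (q - p) by rewrite /p /q /podd; lia.
have Kqp : raising tp tm q p by rewrite /raising q1 p1 implyTb aq ap prec_cur.
have := reflect_killed EP fP fE (K' := raising tp tm.+1) p0 q0 qp Kqp _ u0 wu Ku.
rewrite cq.
move=> H; move: H; set T := (if _ then _ else _) => H; have {H} : T; last rewrite /T {T}.
  apply: H => r s r0 s0.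
  rewrite /raising; case: ifP => r1 h; last first.
    right; split=> //; lia.
  have [s1|s1] := ltrP s 0; last first.
    by right; split=> // [[_ sE]|sE|_]; [lia|lia|rewrite p1].
  move: h; rewrite s1 /= => /(prec_step jN (erefl i) (erefl j) ij).
  case=> [[rE sE]|[h1 h2 h3 h4]]; [left; rewrite /p /q; lia|right].
  split=> //.
  + by move=> [rE sE]; apply: h2; rewrite rE sE.
  + by move=> sE; rewrite ?q1 ?aq; apply: h4; rewrite sE.
  + by move=> rE; rewrite p1 /= ap; apply: h3; rewrite rE.
have [ic|ic] := boolP (i < cm j)%N => /=.
  case=> Eu0 wE KE; exists (E p q u); split=> // t t0; rewrite wE //.
  congr (_ *: _); rewrite /chain_weight; case: ifP => t1.
    have -> : (t == p) = false by lia.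
    have -> : (t == q) = false by lia.
    by rewrite addr0 subr0.
  rewrite (half_weight_step jN (erefl i) (erefl j)) ij ic /=.
  have -> : (t == p) = (`|t|%N == j.*2) by rewrite -ap; lia.
  have -> : (t == q) = (`|t|%N == i.*2.+1) by rewrite -aq; lia.
  rewrite !rmorphB rmorphD /= !rmorph_nat; ring.
move=> Ku'; exists u; split=> // t t0; rewrite wu //; congr (_ *: _).
rewrite /chain_weight; case: ifP => // _.
by rewrite (half_weight_step jN (erefl i) (erefl j)) (negPf ic) andbF.
Qed.

Lemma chain_end tp tm :
  (exists u, chain_vector 0 0 u) -> exists u, chain_vector tp tm u.
Proof.
move=> h; elim: tm => [|tm IH]; last exact: chain_step_neg.
by elim: tp => [//|tp IH]; exact: chain_step_pos.
Qed.

End Chain.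

Lemma processed_end N a b : (a < b)%N -> processed N (N.+1 * N.+1) a b.
Proof.
move=> ab; rewrite /processed; case: ltnP => //= bN.
have : (a.+1 * N.+1 <= N * N.+1)%N by rewrite leq_mul2r; lia.
by rewrite !mulSn; lia.
Qed.

Lemma prec_end N r s : (r < s)%N -> prec N (N.+1 * N.+1) r s.
Proof.
move=> rs; rewrite /prec; have [ro|re] := boolP (odd r);
    have [so|se] := boolP (odd s) => //.
  have rs2 : (r./2 < s./2)%N by lia.
  by rewrite rs2 processed_end.
by have -> : (s./2 < r./2)%N = false by lia.
Qed.

(** For column lengths [c], row [i] (from 0) contains column [j] iff [i < c j]. The odd case thus
    counts the boxes of row [i] beyond column [i]; the even case is the leg, with truncated
    subtraction beyond the rank. *)
Definition frobenius (c : nat -> nat) (N m : nat) : nat :=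
  if odd m then (\sum_(j < N.+1) ((m./2 < j) && (m./2 < c j)))%N
  else (c m./2 - m./2)%N.

Lemma half_weight_end c N m :
  half_weight N c (N.+1 * N.+1) m = (frobenius c N m)%:Z.
Proof.
rewrite /half_weight /frobenius; case: ifP => mo.
  congr (Posz _); apply: eq_bigr => j _; case: ltnP => //= mj.
  by rewrite processed_end // andbT.
rewrite /removed (eq_bigr (fun a : 'I_(m./2) => (a < c m./2)%N : nat)).
  by rewrite sum_ord_lt; lia.
by move=> a _; rewrite processed_end // andbT.
Qed.

Lemma half_weight_start c N m : (forall j, (N < j)%N -> c j = 0%N) ->
  half_weight N c 0 m = if odd m then 0 else (c m./2)%:Z.
Proof.
move=> cN; rewrite /half_weight; case: ifP => mo.
  rewrite /added big1 // => j _.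
  have /negPf jN : ~~ (N < j)%N by rewrite -leqNgt -ltnS.
  by rewrite /processed jN ltn0 !andbF.
rewrite /removed big1 ?subr0 // => a _.
by rewrite /processed ltn0 orbF; case: (ltnP N) => [/cN ->|]; rewrite ?andbF.
Qed.

(** * The Fock vector that is highest for the standard order *)

Section HighestWeightVector.
Variables (C : numClosedFieldType) (d N : nat) (cp cm : nat -> nat).
Hypotheses (cp_mono : forall a b, (a <= b)%N -> (cp b <= cp a)%N).
Hypotheses (cm_mono : forall a b, (a <= b)%N -> (cm b <= cm a)%N).
Hypotheses (cpN : forall j, (N < j)%N -> cp j = 0%N).
Hypotheses (cmN : forall j, (N < j)%N -> cm j = 0%N).
Hypothesis cd : (cp 1 + cm 1 <= d)%N.

(** Colours are filled from opposite ends on the two sides of 0. By [cd] no colour is filled on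
    both, which is what the operators from a positive to a negative fermionic index need in order to
    kill the state. *)
Let occ (p : int) (a : nat) : bool :=
  if 0 < p then (a < cp `|p|./2)%N else (d - cm `|p|./2 <= a)%N.

Lemma chain_start :
  chain_vector (@fock_rep C d) d N cp cm 0 0 (fermi_state C occ).
Proof.
split; first exact: fermi_state_neq0.
  move=> p p0; rewrite fermi_weightP //; congr (_ *: _).
  rewrite /fermi_weight /chain_weight !half_weight_start //.
  have [po|pe] := boolP (podd p); rewrite -?/(podd p) ?po ?(negPf pe).
    by case: (0 < p) => //=; rewrite subr0 rmorphN.
  have j1 : (0 < `|p|./2)%N by move: pe; rewrite /podd; lia.
  have := cp_mono j1; have := cm_mono j1; rewrite /occ.
  set x := cp _; set y := cm _ => yd xd; case: ltrP => p1.
    rewrite (eq_bigr (fun a : 'I_d => (a < x)%N : nat)) => [|a _].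
      by rewrite sum_ord_lt (minn_idPl _) //; lia.
    by rewrite eqb_id.
  rewrite (eq_bigr (fun a : 'I_d => (a < d - y)%N : nat)) => [|a _].
    rewrite sum_ord_lt (minn_idPl _) ?leq_subr // natrB; last by lia.
    by rewrite rmorphB.
  by rewrite eqbF_neg -ltnNge.
move=> r s r0 s0 rs; apply: fermi_state_kill => //.
  apply: contraTneq rs => ->; rewrite /raising /prec; case: ifP => s1.
    by rewrite s1 ltnn; case: (odd _).
  by rewrite ltnn andbC; case: (odd _).
move=> a ad; move: rs; rewrite /raising /occ /podd.
have [r1|r1] := ltrP r 0; last first.
  move=> /andP[s1]; have -> : 0 < s by lia.
  have -> : 0 < r by lia.
  rewrite /prec; have [so|se] := boolP (odd `|s|); first by left.
  have [ro|re] := boolP (odd `|r|).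
    (* At the start an odd index precedes an even one only beyond [N], where the column is empty. *)
    rewrite /processed ltn0 orbF => /andP[_ /cpN ->]; left; lia.
  move=> rs; have : (`|r|./2 <= `|s|./2)%N by lia.
  move=> /cp_mono h; case: (ltnP a (cp `|s|./2)) => h'; last by left.
  by right; lia.
have -> : 0 < r = false by lia.
have [ro|re] := boolP (odd `|r|); first by right.
have [s1|s1] := ltrP s 0.
  have -> : 0 < s = false by lia.
  rewrite /= /prec (negPf re); have [so|se] := boolP (odd `|s|).
    rewrite /processed ltn0 orbF => /andP[_ /cmN ->]; right; lia.
  move=> rs; have : (`|s|./2 <= `|r|./2)%N by lia.
  move=> /cm_mono h; case: (leqP (d - cm `|r|./2) a) => h'; last by right.
  by left; lia.
move=> _; have -> : 0 < s by lia.
have [so|se] := boolP (odd `|s|); first by left.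
have js : (1 <= `|s|./2)%N by lia.
have jr : (1 <= `|r|./2)%N by lia.
have := cp_mono js; have := cm_mono jr; move=> h1 h2.
by case: (ltnP a (cp `|s|./2)) => h'; [right; lia|left].
Qed.

Lemma unitary_highest_weight : exists (M : lmodType C) (E : int -> int -> M -> M)
    (f : M -> M -> C) (w : M),
  [/\ is_gl_rep E, is_inner f, is_star_form E f, w != 0 &
  [/\ has_weight E (fun p => (if 0 < p then (frobenius cp N `|p|)%:Z
       else (if podd p then - d%:Z else d%:Z) - (frobenius cm N `|p|)%:Z)%:~R) w &
    forall p q : int, p != 0 -> q != 0 -> p < q -> E p q w = 0]].
Proof.
have EP := fock_rep_gl C d; have fP := fock_form_inner C.
have fE := @fock_rep_star C d.
have [|w [w0 ww Kw]] := @chain_end _ _ _ _ EP fP fE d N _ _ cp_mono cm_mono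
  (N.+1 * N.+1)%N (N.+1 * N.+1)%N.
  by exists (fermi_state C occ); exact: chain_start.
exists (fock C), (@fock_rep C d), (@fock_form C), w; do 2 split=> //.
  by move=> p p0; rewrite ww // /chain_weight !half_weight_end.
move=> p q p0 q0 pq; apply: Kw => //; rewrite /raising.
have [p1|p1] := ltrP p 0.
  by apply/implyP => q1; rewrite prec_end //; lia.
by rewrite (le_trans p1 (ltW pq)) prec_end //; lia.
Qed.

End HighestWeightVector.

(** * Homogeneous elements of the algebra *)

Lemma fsum_single (V : nmodType) (p : int) (F : int -> V) :
  (forall r, r != p -> F r = 0) -> \sum_(r \in [set: int]) F r = F p.
Proof.
move=> F0; rewrite -[RHS](fsbig_set1 +%R p F).
by apply/esym/fsbig_widen => // r [_ /= /eqP/F0].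
Qed.

Section Elements.
Variable R : realType.
Local Notation C := R[i].

Definition ent (x : Ahat R) (i j : int) : C := (Ahat_val x).1 i j.
Definition cen (x : Ahat R) : C := (Ahat_val x).2.

Lemma AhatP (x y : Ahat R) :
  (forall i j, ent x i j = ent y i j) -> cen x = cen y -> x = y.
Proof.
move=> e c; apply: val_inj; rewrite /= (surjective_pairing (Ahat_val x)).
rewrite (surjective_pairing (Ahat_val y)); congr (_, _) => //.
by apply: val_inj; apply/funext => i; apply/funext => j; exact: e.
Qed.

Lemma entD x y i j : ent (x + y) i j = ent x i j + ent y i j. Proof. by []. Qed.
Lemma entN x i j : ent (- x) i j = - ent x i j. Proof. by []. Qed.
Lemma entZ c x i j : ent (c *: x) i j = c * ent x i j. Proof. by []. Qed.
Lemma cenD x y : cen (x + y) = cen x + cen y. Proof. by []. Qed.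
Lemma cenN x : cen (- x) = - cen x. Proof. by []. Qed.
Lemma cenZ c x : cen (c *: x) = c * cen x. Proof. by []. Qed.

Lemma ent0l x j : ent x 0 j = 0.
Proof. by have /asboolP h := valP x; apply: h; left. Qed.
Lemma ent0r x i : ent x i 0 = 0.
Proof. by have /asboolP h := valP x; apply: h; right. Qed.

Lemma Ahat_degP k (x : Ahat R) : x \in Ahat_deg k <->
  (forall i j, j - i != k -> ent x i j = 0) /\ (k != 0 -> cen x = 0).
Proof. by split=> [/asboolP|/asboolP]. Qed.

Lemma ent_deg k x i j : x \in Ahat_deg k -> j - i != k -> ent x i j = 0.
Proof. by move=> /Ahat_degP[h _]; exact: h. Qed.

Fact diag_band k (a : int -> C) :
  (fun i j => if [&& j - i == k, i != 0 & j != 0] then a j else 0 : C) \in @band R.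
Proof.
by apply/asboolP; exists `|k|%N => i j ij; case: ifP => // /andP[/eqP]; lia.
Qed.

Fact diag_in k a c : ((Gl (diag_band k a), c : C^o) : glhat R) \in @in_Ahat R.
Proof.
by apply/asboolP => i j /= [->|->]; rewrite eqxx ?andbF.
Qed.

(* The matrix [sum_j a_j e_(j-k,j)] plus [c] times the central element. *)
Definition diag_elt (k : int) (a : int -> C) (c : C) : Ahat R :=
  MkAhat (diag_in k a c).

Lemma ent_diag k a c i j :
  ent (diag_elt k a c) i j = if [&& j - i == k, i != 0 & j != 0] then a j else 0.
Proof. by []. Qed.
Lemma cen_diag k a c : cen (diag_elt k a c) = c. Proof. by []. Qed.

Lemma diag_deg k a c : (k != 0 -> c = 0) -> diag_elt k a c \in Ahat_deg k.
Proof. by move=> c0; apply/Ahat_degP; split=> // i j /negPf ij; rewrite ent_diag ij. Qed.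

Lemma deg_diag k (x : Ahat R) : x \in Ahat_deg k -> x = diag_elt k (fun j => ent x (j - k) j) (cen x).
Proof.
move=> xk; apply: AhatP => // i j; rewrite ent_diag.
have [ji|ji] /= := eqVneq (j - i) k; last by rewrite (ent_deg xk).
have -> : j - k = i by lia.
by have [->|] := eqVneq i 0; have [->|] := eqVneq j 0; rewrite ?ent0l ?ent0r.
Qed.

Lemma gl_mul_deg k (A B : gl R) i j : (forall i j, j - i != k -> A i j = 0) ->
  gl_mul A B i j = A i (i + k) * B (i + k) j.
Proof.
move=> Ak; rewrite /gl_mul /= (@fsum_single _ (i + k)) // => r rk.
by rewrite Ak ?mul0r //; lia.
Qed.

Lemma gl_partE b k (A : gl R) i j : (forall i j, j - i != k -> A i j = 0) ->
  gl_part b A i j = if podd k == b then A i j else 0.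
Proof.
move=> Ak; rewrite /gl_part /=; have [<-//|ji] := eqVneq (j - i) k.
by rewrite Ak // !if_same.
Qed.

Lemma gl_br_deg k l (A B : gl R) i j :
    (forall i j, j - i != k -> A i j = 0) -> (forall i j, j - i != l -> B i j = 0) ->
  gl_br A B i j = A i (i + k) * B (i + k) j
     - (-1) ^+ (podd k && podd l) * (B i (i + l) * A (i + l) j).
Proof.
move=> Ak Bl.
have sub (X Y : gl R) : (X - Y) i j = X i j - Y i j by [].
have add (X Y : gl R) : (X + Y) i j = X i j + Y i j by [].
have scl (c : C) (X : gl R) : (c *: X) i j = c * X i j by [].
rewrite /gl_br sub (gl_mul_deg _ _ _ Ak); congr (_ - _).
have pBl b : forall i j, j - i != l -> gl_part b B i j = 0.
  by move=> i' j' h; rewrite (gl_partE _ _ _ Bl) Bl // if_same.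
rewrite !big_bool !add !scl !(gl_mul_deg _ _ _ (pBl _)).
rewrite !(gl_partE _ _ _ Bl) !(gl_partE _ _ _ Ak).
by case: (podd k); case: (podd l); rewrite /= ?(mulr0, mul0r) ?addr0 ?add0r.
Qed.

Lemma ent_br k l (x y : Ahat R) i j : x \in Ahat_deg k -> y \in Ahat_deg l ->
  ent (Ahat_br x y) i j = ent x i (i + k) * ent y (i + k) j
     - (-1) ^+ (podd k && podd l) * (ent y i (i + l) * ent x (i + l) j).
Proof.
by move=> /Ahat_degP[xk _] /Ahat_degP[yl _]; rewrite -gl_br_deg.
Qed.

(** Bracketing with [J] multiplies the entry [(i, j)] by a difference of indicators, so only the
    finitely many entries that cross 0 contribute. *)
Lemma cen_br k l (x y : Ahat R) : x \in Ahat_deg k -> y \in Ahat_deg l ->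
  cen (Ahat_br x y) = \sum_(r \in [set: int]) ((-1) ^+ podd r *
     (((r <= 0)%R%:R - (r + k <= 0)%R%:R) * ent x r (r + k) * ent y (r + k) r)).
Proof.
move=> /Ahat_degP[xk _] /Ahat_degP[yl _].
rewrite -[LHS]/(gl_cocycle (Ahat_val x).1 (Ahat_val y).1) /gl_cocycle /Str.
have J0 : forall i j : int, j - i != 0 -> gl_J R i j = 0.
  by move=> i j ij /=; rewrite (negPf (_ : i != j)) //; lia.
have Jx : forall i j, gl_br (gl_J R) (Ahat_val x).1 i j =
    ((i <= 0)%R%:R - (j <= 0)%R%:R) * ent x i j.
  move=> i j; rewrite (gl_br_deg _ _ J0 xk) /= addr0 eqxx /=.
  have [ij|ij] := eqVneq (j - i) k.
    have -> : i + k = j by lia.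
    rewrite eqxx /= mul1r mulrBl; congr (_ - _); rewrite /ent.
      by case: (i <= 0); rewrite ?mul1r ?mul0r.
    by case: (j <= 0); rewrite ?mulr1 ?mulr0 ?mul0r ?mul1r.
  have e0 : ent x i j = 0 by exact: xk.
  have -> : (i + k == j) = false by lia.
  by rewrite -/(ent x i j) e0 !mulr0 subr0.
apply: eq_fsbigr => r _; congr (_ * _).
rewrite (@gl_mul_deg k) => [|i j ij]; first by rewrite Jx.
by rewrite Jx (xk _ _ ij) mulr0.
Qed.

Lemma br_deg k l (x y : Ahat R) : x \in Ahat_deg k -> y \in Ahat_deg l ->
  Ahat_br x y \in Ahat_deg (k + l).
Proof.
move=> xk yl; apply/Ahat_degP; split=> [i j ij|kl].
  rewrite (ent_br _ _ xk yl) (ent_deg yl); last by lia.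
  by rewrite mulr0 (ent_deg xk) ?mulr0 ?subr0 //; lia.
rewrite (cen_br xk yl); apply: fsbig1 => r _.
by rewrite (ent_deg yl) ?mulr0 //; lia.
Qed.

Lemma diag_br k (t : int -> C) (x : Ahat R) : x \in Ahat_deg k ->
  Ahat_br (diag_elt 0 t 0) x =
    diag_elt k (fun j => (t (j - k) - t j) * ent x (j - k) j) 0.
Proof.
move=> xk; have hk : diag_elt 0 t 0 \in Ahat_deg 0 by exact: diag_deg.
apply: AhatP => [i j|].
  rewrite (ent_br _ _ hk xk) !ent_diag addr0 mul1r subrr eqxx /=.
  have [ij|ij] := eqVneq (j - i) k; last first.
    rewrite (ent_deg xk ij) mulr0 sub0r.
    have -> : (j - (i + k) == 0) = false by lia.
    by rewrite mulr0 oppr0.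
  have -> : i + k = j by lia.
  have -> : j - k = i by lia.
  rewrite subrr eqxx /=.
  have [->|i0] := eqVneq i 0; first by rewrite !ent0l !mul0r mulr0 subr0.
  have [->|j0] := eqVneq j 0; first by rewrite !ent0r !mul0r mulr0 subr0.
  by rewrite /=; ring.
rewrite (cen_br hk xk) cen_diag; apply: fsbig1 => r _.
by rewrite addr0 subrr !mul0r mulr0.
Qed.

Definition far (N : nat) (x : Ahat R) : Prop :=
  (forall i j, (`|j| <= N)%N -> ent x i j = 0) /\ cen x = 0.

(** Entries that cross 0 lie close to 0, so far elements do not meet the cocycle; the margin pays
    for the shifts by [k] and [l]. *)
Lemma far_br k l N (x y : Ahat R) : x \in Ahat_deg k -> y \in Ahat_deg l ->
  far (N + `|k| + `|l|) x -> far N (Ahat_br x y).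
Proof.
move=> xk yl [fx _]; split=> [i j jN|].
  rewrite (ent_br _ _ xk yl) [ent x (i + l) j]fx; last by lia.
  rewrite !mulr0 subr0; have [ij|ij] := eqVneq (j - (i + k)) l; last first.
    by rewrite (ent_deg yl ij) mulr0.
  by rewrite fx ?mul0r //; lia.
rewrite (cen_br xk yl); apply: fsbig1 => r _.
have [rk|rk] := leqP `|r + k| (N + `|k| + `|l|).
  by rewrite fx // mulr0 mul0r mulr0.
have -> : (r + k <= 0) = (r <= 0) by lia.
by rewrite subrr !mul0r mulr0.
Qed.

(* Adding [(-1)^p] times the central element to [e_pp] for [p < 0] absorbs the
   cocycle: the relations below are those of plain matrix units. *)
Definition unit_elt (p q : int) : Ahat R :=
  diag_elt (q - p) (fun j => (j == q)%:R)
    (if (p == q) && (p < 0) then (-1) ^+ podd p else 0).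

Lemma unit_deg p q : unit_elt p q \in Ahat_deg (q - p).
Proof. by apply: diag_deg; rewrite subr_eq0 eq_sym => /negPf ->. Qed.

Lemma ent_unit p q i j : p != 0 -> q != 0 ->
  ent (unit_elt p q) i j = ((i == p) && (j == q))%R%:R.
Proof.
move=> p0 q0; rewrite ent_diag; have [->|jq] := eqVneq j q; last first.
  by rewrite andbF mulr0n if_same.
have -> : (q - i == q - p) = (i == p) by lia.
by have [->|] := eqVneq i p; rewrite //= p0 q0.
Qed.

Lemma cen_unit p q :
  cen (unit_elt p q) = if (p == q) && (p < 0) then (-1) ^+ podd p else 0.
Proof. by []. Qed.

Lemma unit_br p q r s : p != 0 -> q != 0 -> r != 0 -> s != 0 ->
  Ahat_br (unit_elt p q) (unit_elt r s) = (q == r)%:R *: unit_elt p s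
   - ((-1) ^+ (podd (q - p) && podd (s - r)) * (s == p)%:R) *: unit_elt r q.
Proof.
move=> p0 q0 r0 s0; have u := unit_deg p q; have u' := unit_deg r s.
apply: AhatP => [i j|].
  rewrite (ent_br _ _ u u') entD entN !entZ !ent_unit // -!natrM -mulrA -natrM.
  rewrite !mulnb; congr (_ - _ * _); congr (nat_of_bool _)%:R; lia.
rewrite (cen_br u u') cenD cenN !cenZ !cen_unit (@fsum_single _ p).
  rewrite !ent_unit // (_ : p + (q - p) = q); last by lia.
  rewrite !eqxx /= mulr1 [s == p]eq_sym.
  have [<-|_] := eqVneq q r; last by rewrite /= !mulr0 mul0r subr0.
  have [<-|_] := eqVneq p s; last by rewrite /= !mulr0 mul0r subr0.
  rewrite /= !mulr1 mul1r (poddBC q p) andbb !poddB.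
  have -> : (p <= 0) = (p < 0) by lia.
  have -> : (q <= 0) = (q < 0) by lia.
  by case: (p < 0); case: (q < 0); case: (podd p); case: (podd q);
    rewrite /= ?expr0 ?expr1; ring.
by move=> t tp; rewrite !ent_unit // (negPf tp) mulr0 mul0r mulr0.
Qed.

Lemma star_unit p q : p != 0 -> q != 0 ->
  star (unit_elt p q) = (-1) ^+ (sbrk p + sbrk q) *: unit_elt q p.
Proof.
move=> p0 q0; apply: AhatP => [i j|].
  rewrite entZ -[LHS]/((-1) ^+ (sbrk i + sbrk j) * (ent (unit_elt p q) j i)^*).
  rewrite !ent_unit // andbC rmorph_nat.
  case: eqP => [->|]; case: eqP => [->|] //=; rewrite ?mulr0 //.
  by rewrite addnC.
rewrite cenZ -[LHS]/((cen (unit_elt p q))^*) !cen_unit eq_sym.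
have [<-|_] := eqVneq p q; last by rewrite conjC0 mulr0.
rewrite addnn -mul2n exprM sqrrN !expr1n mul1r.
by case: (p < 0); rewrite /= ?conjC0 // rmorph_sign.
Qed.

End Elements.

(** * Quasi-finiteness and local finiteness *)

(** On each residue class modulo [K] take 0 on the representative in [[0, K)] and solve the
    recursion in both directions. It is used with [eps] the identity, for commutators with Cartan
    elements, and with [eps] the negation, for anticommutators of odd elements. *)
Lemma twisted_primitive (A : zmodType) (K : int) (eps : {additive A -> A})
    (b : int -> A) : 0 < K -> involutive eps ->
  exists t : int -> A, (forall j, t (j + K) = eps (t j) + b j) /\
    forall N : nat, (forall j, (`|j| <= N)%N -> b j = 0) ->
      forall j, (`|j| <= N)%N -> t j = 0.
Proof.
move=> K0 epsK.
pose tp (c : int) := fix F (n : nat) : A :=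
  if n is n'.+1 then eps (F n') + b (n'%:Z * K + c) else 0.
pose tn (c : int) := fix F (n : nat) : A :=
  if n is n'.+1 then eps (F n' - b (- n%:Z * K + c)) else 0.
pose t (j : int) : A := let c := (j %% K)%Z in
  match (j %/ K)%Z with Posz n => tp c n | Negz n => tn c n.+1 end.
have tE (m c : int) : 0 <= c < K ->
    t (m * K + c) = match m with Posz n => tp c n | Negz n => tn c n.+1 end.
  move=> /andP[c0 cK]; have K1 : K != 0 by lia.
  have cK' : c < `|K| by lia.
  by rewrite /t modzMDl divzMDl // modz_small ?c0 // divz_small ?c0 // addr0.
have jE (j : int) : exists m c, [/\ j = m * K + c & 0 <= c < K].
  exists (j %/ K)%Z, (j %% K)%Z; split; first exact: divz_eq.
  by rewrite modz_ge0 ?ltz_pmod //; lia.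
exists t; split=> [j|N bN j].
  have [m [c [-> cK]]] := jE j.
  have -> : m * K + c + K = (m + 1) * K + c by ring.
  rewrite !tE //; case: m => [n|[|n]].
  - by rewrite (_ : n%:Z + 1 = n.+1%:Z) //; lia.
  - rewrite -[Negz 0 + 1]/(0%:Z) /= epsK sub0r addNr //.
  - have -> : Negz n.+1 + 1 = Negz n by lia.
    by rewrite [tn c n.+2]/= epsK -[- n.+2%:Z]/(Negz n.+1) subrK.
have [m [c [-> /[dup] cK /andP[c0 cK']]]] := jE j; rewrite tE // => jN.
case: m jN => [n|n] jN.
  elim: n jN => [//|n IH] jN /=.
  rewrite IH ?raddf0 ?add0r ?bN //; move: jN; rewrite -addn1 PoszD mulrDl;
    have : 0 <= n%:Z * K by rewrite mulr_ge0 // ltW.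
    by lia.
  by lia.
suff H n' : (n' <= n.+1)%N -> tn c n' = 0 by exact: H.
elim: n' => [//|n' IH] nn /=.
rewrite IH ?sub0r ?bN ?oppr0 ?raddf0 //; last exact: ltnW.
move: jN; rewrite NegzE.
have : 0 <= (n - n')%:Z * K by rewrite mulr_ge0 // ltW.
have h1 : (n - n')%:Z = n%:Z - n'%:Z by lia.
have h2 : 0 <= n'%:Z * K by rewrite mulr_ge0 // ltW.
rewrite h1 mulrBl !mulNr -[n'.+1]addn1 -[n.+1]addn1 !PoszD !mulrDl; lia.
Qed.

Lemma poly_int_roots_bounded (C : numClosedFieldType) (P : {poly C}) : P != 0 ->
  exists N : nat, forall j : int, (N < `|j|)%N -> P.[j%:~R] != 0.
Proof.
move=> P0; have [rs PE] := closed_field_poly_normal P.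
have [N HN] : exists N : nat, forall j : int, (j%:~R : C) \in rs -> (`|j| <= N)%N.
  elim: rs {PE} => [|z rs [N IH]]; first by exists 0%N.
  have [[j0 j0z]|nj] := pselect (exists j : int, j%:~R = z).
    exists (N + `|j0|)%N => j; rewrite inE => /orP[/eqP jz|/IH]; last by lia.
    by have /eqP := etrans jz (esym j0z); rewrite eqr_int => /eqP ->; lia.
  exists N => j; rewrite inE => /orP[/eqP jz|/IH//].
  by case: nj; exists j.
exists N => j jN; apply/negP => rj; move: jN; rewrite ltnNge HN //.
move: rj; rewrite PE hornerZ mulf_eq0 lead_coef_eq0 (negPf P0) /=.
by rewrite -[_ == 0]/(root _ _) root_prod_XsubC.
Qed.

Lemma lspan_coord (R : realType) (V : lmodType R[i]) (s : seq V) (w : V) :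
  lspan (fun u => u \in s) w ->
  exists a : 'rV[R[i]]_(size s), w = \sum_i a 0 i *: s`_i.
Proof.
move=> [t ts ->]; elim: t ts => [|p t IH] ts.
  by exists 0; rewrite big_nil big1 // => i _; rewrite mxE scale0r.
have [|a aE] := IH; first by move=> q qt; apply: ts; rewrite inE qt orbT.
have ps : p.2 \in s by apply: ts; rewrite inE eqxx.
have lt : (index p.2 s < size s)%N by rewrite index_mem.
exists (a + p.1 *: delta_mx 0 (Ordinal lt)); rewrite big_cons aE.
rewrite [RHS](eq_bigr (fun i => a 0 i *: s`_i +
   (p.1 * (i == Ordinal lt)%:R) *: s`_i)); last first.
  by move=> i _; rewrite !mxE eqxx /= scalerDl.
rewrite big_split /= addrC; congr (_ + _); rewrite (bigD1 (Ordinal lt)) //= eqxx.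
rewrite mulr1 nth_index // big1 ?addr0 // => i /negPf ->.
by rewrite mulr0 scale0r.
Qed.

(** More vectors than generators: a kernel row of the coordinate matrix. The relation is recorded as
    a polynomial because [u m] will come from the sequence of [m]-th powers. *)
Lemma lspan_dependent (R : realType) (V : lmodType R[i]) (s : seq V) (u : nat -> V) :
  (forall m, lspan (fun w => w \in s) (u m)) ->
  exists P : {poly R[i]}, P != 0 /\ \sum_(m < size P) P`_m *: u m = 0.
Proof.
move=> us; have /choice[A AE] := fun m => lspan_coord (us m).
pose n := size s; pose B : 'M_(n.+1, n) := \matrix_(m, i) A m 0 i.
have k0 : kermx B != 0.
  rewrite -mxrank_eq0 mxrank_ker -lt0n subn_gt0 ltnS.
  exact: leq_trans (rank_leq_col B) _.
pose c := nz_row (kermx B); have c0 : c != 0 by rewrite nz_row_eq0.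
have cB : c *m B = 0 by apply/sub_kermxP; exact: nz_row_sub.
pose P := \poly_(m < n.+1) c 0 (inord m).
have PE (m : 'I_n.+1) : P`_m = c 0 m by rewrite coef_poly ltn_ord inord_val.
exists P; split.
  apply: contra c0 => /eqP P0; apply/eqP/rowP => m.
  by rewrite -PE P0 coef0 mxE.
have -> : \sum_(m < size P) P`_m *: u m = \sum_(m < n.+1) P`_m *: u m.
  rewrite (big_ord_widen n.+1 (fun m => P`_m *: u m)) ?size_poly //.
  rewrite big_mkcond; apply: eq_bigr => m _; case: ltnP => // sm.
  by rewrite nth_default // scale0r.
rewrite (eq_bigr (fun m : 'I_n.+1 => \sum_i (c 0 m * B m i) *: s`_i)).
  rewrite exchange_big big1 //= => i _; rewrite -scaler_suml.
  have := congr1 (fun M : 'rV_n => M 0 i) cB; rewrite !mxE => ->.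
  by rewrite scale0r.
move=> m _; rewrite PE AE scaler_sumr; apply: eq_bigr => i _.
by rewrite scalerA mxE.
Qed.

Section Module.
Variables (R : realType) (V : lmodType R[i]).
Variables (Vpar : bool -> {pred V}) (act : Ahat R -> V -> V).
Variables (xi : {scalar Ahat0 R}) (v : V).
Hypotheses (mod : is_supermodule Vpar act) (hw : is_highest_weight_module act xi v).
Hypothesis qf : quasi_finite act v.
Local Notation C := R[i].

Lemma actZDl c x y w : act (c *: x + y) w = c *: act x w + act y w.
Proof. exact: (act_linearl mod w c x y). Qed.
Lemma actDl x y w : act (x + y) w = act x w + act y w.
Proof. by have := actZDl 1 x y w; rewrite !scale1r. Qed.
Lemma act0l w : act 0 w = 0.
Proof. by have := actZDl (-1) 0 0 w; rewrite !scaleN1r !addNr. Qed.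
Lemma actZl c x w : act (c *: x) w = c *: act x w.
Proof. by have := actZDl c x 0 w; rewrite !addr0 act0l addr0. Qed.
Lemma actNl x w : act (- x) w = - act x w.
Proof. by rewrite -(scaleN1r x) actZl scaleN1r. Qed.
Lemma actDr x w w' : act x (w + w') = act x w + act x w'.
Proof. by have := act_linearr mod x 1 w w'; rewrite !scale1r. Qed.
Lemma act0r x : act x 0 = 0.
Proof. by have := act_linearr mod x (-1) 0 0; rewrite !scaleN1r !addNr. Qed.
Lemma actZr c x w : act x (c *: w) = c *: act x w.
Proof. by have := act_linearr mod x c w 0; rewrite !addr0 act0r addr0. Qed.

Lemma act_swap k l x y w : x \in Ahat_deg k -> y \in Ahat_deg l ->
  act x (act y w) = (-1) ^+ (podd k && podd l) *: act y (act x w) + act (Ahat_br x y) w.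
Proof. by move=> xk yl; rewrite (act_br mod _ xk yl) addrC subrK. Qed.

Lemma act_deg0 (x : Ahat R) : x \in Ahat_deg 0 -> exists c, act x v = c *: v.
Proof. by move=> x0; case: hw => _ h _ _; exists (xi (MkAhat0 x0)); rewrite -h. Qed.

Lemma act_pos k (x : Ahat R) : 0 < k -> x \in Ahat_deg k -> act x v = 0.
Proof. by case: hw => _ _ h _; exact: h. Qed.

Definition Eact (p q : int) (w : V) : V := act (unit_elt R p q) w.

Lemma Eact_gl_rep : is_gl_rep Eact.
Proof.
split=> [p q|p q r s u p0 q0 r0 s0]; first exact: act_linearr mod _.
rewrite /Eact (act_swap _ (unit_deg R p q) (unit_deg R r s)) unit_br //.
by rewrite actDl actNl !actZl.
Qed.

Lemma neg_one_shift k (x : Ahat R) : k < 0 -> x \in Ahat_deg k ->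
  homogeneous_component act v k (act x v).
Proof.
move=> k0 xk; exists [:: (1, act x v)] => [p|]; last by rewrite big_seq1 scale1r.
rewrite inE => /eqP -> /=; exists [:: (k, x)]; split=> //; last by rewrite big_seq1.
by move=> p'; rewrite inE => /eqP ->.
Qed.

(** The image of the power sequences lies in a finite dimensional component, so some polynomial
    sequence [P] kills [v]. The killing sequences form an ideal, and beyond the integer roots of [P]
    every sequence is a multiple of [P]. *)
Lemma far_kills_negative k : k < 0 -> exists N, forall x,
  x \in Ahat_deg k -> far N x -> act x v = 0.
Proof.
move=> k0; pose L (a : int -> C) := act (diag_elt k a 0) v.
have dk (a : int -> C) : diag_elt k a 0 \in Ahat_deg k by exact: diag_deg.
have LZ (c : C) a b : L (fun j => c * a j + b j) = c *: L a + L b.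
  rewrite /L -actZDl; congr (act _ v); apply: AhatP => [i j|].
    rewrite entD entZ !ent_diag; case: ifP => // _.
    by rewrite mulr0 addr0.
  by rewrite cenD cenZ !cen_diag mulr0 addr0.
have L0 : L (fun=> 0) = 0.
  rewrite /L (_ : diag_elt _ _ _ = 0) ?act0l //.
  by apply: AhatP => // i j; rewrite ent_diag if_same.
have [s sP] := qf k.
have [P [P0 PL]] : exists P : {poly C}, P != 0 /\
    \sum_(m < size P) P`_m *: L (fun j => j%:~R ^+ m) = 0.
  have us m : lspan (fun w => w \in s) (L (fun j => j%:~R ^+ m)).
    by apply: sP; exact: neg_one_shift.
  exact: (lspan_dependent us).
have Lsum n (c : nat -> C) (g : nat -> int -> C) :
    L (fun j => \sum_(m < n) c m * g m j) = \sum_(m < n) c m *: L (g m).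
  elim: n => [|n IH].
    rewrite big_ord0 -L0; congr L; apply/funext => j; exact: big_ord0.
  rewrite big_ord_recr /= addrC -IH -LZ; congr L; apply/funext => j.
  by rewrite big_ord_recr /= addrC.
have LP : L (fun j => P.[j%:~R]) = 0.
  rewrite -[RHS]PL -(Lsum _ (nth 0 P) (fun m j => j%:~R ^+ m)); congr L.
  by apply/funext => j; rewrite horner_coef.
(* A Cartan element acts on [v] by a scalar, so its bracket with a killing element kills [v] too.
   The bracket multiplies by a difference sequence, and every sequence [b] is one. *)
have Lmul (a b : int -> C) : L a = 0 -> L (fun j => b j * a j) = 0.
  move=> La; have K0 : 0 < - k by lia.
  have [t [tE _]] := @twisted_primitive C (- k) idfun b K0 (fun x => erefl).
  have h0 : diag_elt 0 t 0 \in Ahat_deg 0 by exact: diag_deg.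
  have [c hv] := act_deg0 h0.
  have := act_swap v h0 (dk a); rewrite -/(L a) La act0r hv actZr -/(L a) La.
  rewrite !scaler0 add0r (diag_br _ (dk a)) => /esym.
  rewrite (_ : diag_elt _ _ _ = diag_elt k (fun j => b j * a j) 0) //.
  apply: AhatP => // i j; rewrite !ent_diag; case: ifP => // /and3P[/eqP ij i0 j0].
  have -> : j - (j - k) = k by lia.
  rewrite eqxx j0 (_ : j - k = i) ?i0; last by lia.
  by have := tE j; rewrite (_ : j - k = i) ?i0 => [->|]; [rewrite /= addrAC subrr add0r|lia].
have [N PN] := poly_int_roots_bounded P0; exists N => x xk [fx cx].
rewrite (deg_diag xk) cx.
rewrite (_ : diag_elt _ _ _ = diag_elt k (fun j =>
   (ent x (j - k) j / P.[j%:~R]) * P.[j%:~R]) 0); first exact: Lmul.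
apply: AhatP => // i j; rewrite !ent_diag; case: ifP => // _.
have [jN|jN] := leqP `|j| N; first by rewrite fx // !mul0r.
by rewrite divfK // PN.
Qed.

(** Quasi-finiteness says nothing directly in degree 0. Instead a far diagonal [x] is written as a
    bracket of the shift of degree 1, which kills [v] by positivity, with a far element of degree
    -1. *)
Lemma far_kills_Cartan : exists N, forall x,
  x \in Ahat_deg 0 -> far N x -> act x v = 0.
Proof.
have [//|N HN] := @far_kills_negative (- 1).
exists N.+2 => x x0 [fx cx].
have negK : involutive (-%R : C -> C) by exact: opprK.
(* The bracket of two odd elements is an anticommutator, with diagonal entries [c j + c (j - 1)];
   hence the recursion with the negation. *)
have [c [cE cfar]] := @twisted_primitive C 1 -%R (fun j => ent x (j + 1) (j + 1))
  isT negK.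
have cN j : (`|j| <= N.+1)%N -> c j = 0.
  by apply: cfar => i iN; apply: fx; lia.
pose y := diag_elt 1 (fun=> 1) (0 : C); pose z := diag_elt (- 1) c 0.
have yd : y \in Ahat_deg 1 by exact: diag_deg.
have zd : z \in Ahat_deg (- 1) by exact: diag_deg.
have fz : far N.+1 z.
  by split=> // i j jN; rewrite ent_diag cN // if_same.
have xE : x = Ahat_br y z.
  apply: AhatP => [i j|].
    rewrite (ent_br _ _ yd zd) /= !ent_diag mulN1r opprK.
    have [->|ij] := eqVneq i j; last first.
      have ji : j - i != 0 by lia.
      rewrite (ent_deg x0 ji).
      have -> : (j - (i + 1) == -1) = false by lia.
      have -> : (j - (i - 1) == 1) = false by lia.
      by rewrite !mulr0 addr0.
    have -> : j + 1 - j = 1 by lia.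
    have -> : j - (j + 1) = - 1 by lia.
    have -> : j - 1 - j = - 1 by lia.
    have -> : j - (j - 1) = 1 by lia.
    have [jN|jN] := leqP `|j| N.+1.
      rewrite fx; last by lia.
      have cj : c j = 0 by exact: cN.
      have cj1 : c (j - 1) = 0.
        have := cE (j - 1); rewrite (_ : j - 1 + 1 = j); last by lia.
        rewrite cj fx ?addr0; last by lia.
        by move=> /esym/eqP; rewrite oppr_eq0 => /eqP.
      by rewrite cj cj1 !if_same mulr0 mul0r addr0.
    have j0 : j != 0 by lia.
    have j1 : j + 1 != 0 by lia.
    have j2 : j - 1 != 0 by lia.
    rewrite !j0 !j1 !j2 /= mul1r mulr1.
    have := cE (j - 1); rewrite (_ : j - 1 + 1 = j); last by lia.
    by move=> ->; rewrite addrAC addNr add0r.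
  rewrite cx; apply/esym; rewrite (cen_br yd zd).
  apply: fsbig1 => r _; have [rN|rN] := leqP `|r| N.+1.
    by rewrite [ent z _ _]fz.1 ?mulr0.
  have -> : (r + 1 <= 0) = (r <= 0) by lia.
  by rewrite subrr !mul0r mulr0.
have := act_swap v yd zd; rewrite -xE [act z v]HN //; last first.
  by split=> // i j jN; apply: fz.1; lia.
by rewrite act0r (act_pos _ yd) // act0r scaler0 add0r.
Qed.

Definition locally_finite (w : V) : Prop := forall k, exists N, forall x,
  x \in Ahat_deg k -> far N x -> act x w = 0.

Lemma far_mono N N' (x : Ahat R) : (N <= N')%N -> far N' x -> far N x.
Proof. by move=> NN [fx cx]; split=> // i j jN; apply: fx; exact: leq_trans NN. Qed.

Lemma locally_finiteZD c w w' :
  locally_finite w -> locally_finite w' -> locally_finite (c *: w + w').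
Proof.
move=> lw lw' k; have [N HN] := lw k; have [N' HN'] := lw' k.
exists (maxn N N') => x xk fx; rewrite actDr actZr HN // ?HN' ?scaler0 ?addr0 //;
  apply: far_mono fx; [exact: leq_maxr|exact: leq_maxl].
Qed.

Lemma locally_finite_act l y w : y \in Ahat_deg l ->
  locally_finite w -> locally_finite (act y w).
Proof.
move=> yl lw k; have [N HN] := lw k; have [N' HN'] := lw (k + l).
exists (maxn N (N' + `|k| + `|l|)) => x xk fx; rewrite (act_swap _ xk yl).
rewrite HN ?act0r ?scaler0 ?add0r //; last by apply: far_mono fx; exact: leq_maxl.
apply: HN'; first exact: br_deg xk yl.
by apply: far_br xk yl _; apply: far_mono fx; exact: leq_maxr.
Qed.

Lemma locally_finite_hwv : locally_finite v.
Proof.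
move=> k; have [k0|k0|->] := ltgtP k 0; first exact: far_kills_negative.
  by exists 0%N => x xk _; exact: act_pos xk.
exact: far_kills_Cartan.
Qed.

Lemma lspan_ind (Q Q' : V -> Prop) : Q' 0 ->
  (forall c w w', Q' w -> Q' w' -> Q' (c *: w + w')) -> (forall w, Q w -> Q' w) ->
  forall w, lspan Q w -> Q' w.
Proof.
move=> Q0 QZD QQ w [s sQ ->]; elim: s sQ => [|p s IH] sQ; first by rewrite big_nil.
rewrite big_cons; apply: QZD; first by apply/QQ/sQ; rewrite inE eqxx.
by apply: IH => q qs; apply: sQ; rewrite inE qs orbT.
Qed.

Lemma hw_ind (Q : V -> Prop) : Q v ->
  (forall c w w', Q w -> Q w' -> Q (c *: w + w')) ->
  (forall k x w, k < 0 -> x \in Ahat_deg k -> Q w -> Q (act x w)) -> forall w, Q w.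
Proof.
move=> Qv QZD Qact w; case: hw => _ _ _ /(_ w); apply: lspan_ind => // [|u].
  by have := QZD (-1) v v Qv Qv; rewrite scaleN1r addNr.
move=> [k [s [sP _ ->]]]; elim: s sP => [//|p s IH] sP /=.
have [p0 pd] := sP p (mem_head _ _); apply: Qact p0 pd _.
by apply: IH => q qs; apply: sP; rewrite inE qs orbT.
Qed.

Lemma all_locally_finite w : locally_finite w.
Proof.
elim/hw_ind: w => [|c w w'|k x w _ xk]; first exact: locally_finite_hwv.
  exact: locally_finiteZD.
exact: locally_finite_act xk.
Qed.

End Module.

(** * Reduction of infinite matrices to finite ones *)

Section Truncation.
Variable R : realType.
Local Notation C := R[i].

Lemma ent_sum (I : Type) (s : seq I) (F : I -> Ahat R) i j :
  ent (\sum_(p <- s) F p) i j = \sum_(p <- s) ent (F p) i j.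
Proof. by elim: s => [|p s IH]; rewrite ?big_nil // !big_cons entD IH. Qed.

Lemma cen_sum (I : Type) (s : seq I) (F : I -> Ahat R) :
  cen (\sum_(p <- s) F p) = \sum_(p <- s) cen (F p).
Proof. by elim: s => [|p s IH]; rewrite ?big_nil // !big_cons cenD IH. Qed.

Lemma sum_pred1 (I : eqType) (s : seq I) (F : I -> C) i : uniq s ->
  \sum_(p <- s) F p * (i == p)%:R = if i \in s then F i else 0.
Proof.
move=> us; case: ifP => si.
  rewrite (bigD1_seq i) //= eqxx mulr1 big1 ?addr0 // => p pi.
  by rewrite eq_sym (negPf pi) mulr0.
rewrite big_seq big1 // => p ps; case: eqP => [ip|_]; last by rewrite mulr0.
by rewrite ip ps in si.
Qed.

Definition box (N : nat) : seq int :=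
  [seq p <- [seq i%:Z - N%:Z | i <- iota 0 (2 * N).+1] | p != 0].

Lemma mem_box N p : (p \in box N) = (p != 0) && (`|p| <= N)%N.
Proof.
rewrite mem_filter; congr (_ && _); apply/mapP/idP => [[i ii ->]|pN].
  by move: ii; rewrite mem_iota; lia.
by exists `|(p + N%:Z)%R|%N; [rewrite mem_iota; lia|lia].
Qed.

Lemma box_uniq N : uniq (box N).
Proof.
rewrite filter_uniq // map_inj_uniq ?iota_uniq // => i j; lia.
Qed.

Fact cut_band N (x : Ahat R) :
  (fun i j => if (`|i| <= N)%N && (`|j| <= N)%N then ent x i j else 0 : C) \in @band R.
Proof.
apply/asboolP; exists (N + N)%N => i j ij; case: ifP => // /andP[]; lia.
Qed.

Fact cut_in N (x : Ahat R) : ((Gl (cut_band N x), cen x : C^o) : glhat R) \in @in_Ahat R.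
Proof.
by apply/asboolP => i j /= [->|->]; rewrite ?ent0l ?ent0r if_same.
Qed.
Definition cut N (x : Ahat R) : Ahat R := MkAhat (cut_in N x).

Lemma ent_cut N x i j :
  ent (cut N x) i j = if (`|i| <= N)%N && (`|j| <= N)%N then ent x i j else 0.
Proof. by []. Qed.
Lemma cen_cut N x : cen (cut N x) = cen x. Proof. by []. Qed.

Definition central_elt : Ahat R := diag_elt 0 (fun=> 0) 1.

Lemma cut_sum N x : exists c, cut N x =
  \sum_(p <- box N) \sum_(q <- box N) ent x p q *: unit_elt R p q + c *: central_elt.
Proof.
set S := \sum_(p <- _) _; exists (cen x - cen S).
apply: AhatP => [i j|]; last by rewrite cenD cenZ cen_diag mulr1 addrC subrK.
rewrite ent_cut entD entZ ent_diag if_same mulr0 addr0 /S ent_sum.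
rewrite big_seq (eq_bigr (fun p => (if j \in box N then ent x p j else 0) * (i == p)%:R)).
  rewrite -big_seq sum_pred1 ?box_uniq // !mem_box.
  case: eqP => [->|_]; first by rewrite ent0l !if_same.
  case: eqP => [->|_]; first by rewrite ent0r !if_same.
  by rewrite /=; case: (_ <= _)%N; case: (_ <= _)%N.
move=> p; rewrite mem_box => /andP[p0 _]; rewrite ent_sum big_seq.
rewrite (eq_bigr (fun q => (ent x p q * (i == p)%:R) * (j == q)%:R)).
  by rewrite -big_seq sum_pred1 ?box_uniq //; case: ifP; rewrite ?mul0r.
move=> q; rewrite mem_box => /andP[q0 _].
by rewrite entZ ent_unit // -mulrA -natrM mulnb.
Qed.

Lemma cut_ind (Q : Ahat R -> Prop) :
    (forall c x y, Q x -> Q y -> Q (c *: x + y)) ->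
    (forall p q, p != 0 -> q != 0 -> Q (unit_elt R p q)) -> Q central_elt ->
  forall N x, Q (cut N x).
Proof.
move=> QZD Qu Qc N x.
have Q0 : Q 0 by have := QZD (-1) _ _ Qc Qc; rewrite scaleN1r addNr.
have [c ->] := cut_sum N x; rewrite addrC; apply: (QZD) => //.
rewrite big_seq; apply: (big_ind Q) => // [y z Qy Qz|p].
  by rewrite -(scale1r y); exact: (QZD).
rewrite mem_box => /andP[p0 _]; rewrite big_seq.
apply: (big_ind Q) => // [y z Qy Qz|q].
  by rewrite -(scale1r y); exact: (QZD).
rewrite mem_box => /andP[q0 _]; rewrite -[_ *: _]addr0; apply: (QZD) => //.
exact: Qu.
Qed.

Lemma star_cut N (x : Ahat R) : star (cut N x) = cut N (star x).
Proof.
apply: AhatP => // i j; rewrite ent_cut.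
rewrite -[LHS]/((-1) ^+ (sbrk i + sbrk j) * (ent (cut N x) j i)^*) ent_cut andbC.
by case: ifP => // _; rewrite conjC0 mulr0.
Qed.

Lemma starZD c (x y : Ahat R) : star (c *: x + y) = c^* *: star x + star y.
Proof.
apply: AhatP => [i j|].
  rewrite entD entZ.
  rewrite -[LHS]/((-1) ^+ (sbrk i + sbrk j) * (c * ent x j i + ent y j i)^*).
  rewrite -[ent (star x) i j]/((-1) ^+ (sbrk i + sbrk j) * (ent x j i)^*).
  rewrite -[ent (star y) i j]/((-1) ^+ (sbrk i + sbrk j) * (ent y j i)^*).
  by rewrite rmorphD rmorphM /=; ring.
rewrite cenD cenZ -[LHS]/((c * cen x + cen y)^*).
by rewrite rmorphD rmorphM.
Qed.

Lemma star_central : star central_elt = central_elt.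
Proof.
apply: AhatP => [i j|]; last exact: conjC1.
rewrite -[LHS]/((-1) ^+ (sbrk i + sbrk j) * (ent central_elt j i)^*).
by rewrite !ent_diag !if_same conjC0 mulr0.
Qed.

Lemma central_deg : central_elt \in Ahat_deg 0.
Proof. exact: diag_deg. Qed.

Lemma central_br k (x : Ahat R) : x \in Ahat_deg k -> Ahat_br central_elt x = 0.
Proof.
move=> xk; apply: AhatP => [i j|].
  by rewrite (ent_br _ _ central_deg xk) !ent_diag !if_same mul0r !mulr0 subr0.
rewrite (cen_br central_deg xk); apply: fsbig1 => r _.
by rewrite ent_diag if_same mulr0 mul0r mulr0.
Qed.

Section Action.
Variables (V : lmodType R[i]) (Vpar : bool -> {pred V}) (act : Ahat R -> V -> V).
Variables (xi : {scalar Ahat0 R}) (v : V).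
Hypotheses (mod : is_supermodule Vpar act) (hw : is_highest_weight_module act xi v).
Hypothesis qf : quasi_finite act v.

Lemma act_suml (I : Type) (s : seq I) (F : I -> Ahat R) w :
  act (\sum_(p <- s) F p) w = \sum_(p <- s) act (F p) w.
Proof.
elim: s => [|p s IH]; first by rewrite !big_nil (act0l mod).
by rewrite !big_cons (actDl mod) IH.
Qed.

(** A banded matrix has finitely many diagonals, and local finiteness bounds each; the remainder of
    the truncation is a finite sum of far homogeneous elements. *)
Lemma act_cut (x : Ahat R) w : exists N0, forall N, (N0 <= N)%N ->
  act x w = act (cut N x) w.
Proof.
have /asboolP[B xB] := valP (Ahat_val x).1.
have lf := all_locally_finite mod hw qf w.
have [N0 HN0] : exists N0, forall k y, k \in box B \/ k = 0 -> y \in Ahat_deg k ->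
    far N0 y -> act y w = 0.
  elim: (box B) => [|k s [N IH]].
    by have [N HN] := lf 0; exists N => k y [//|->]; exact: HN.
  have [N' HN'] := lf k; exists (N + N')%N => l y [lks|l0] yl fy; last first.
    by apply: (IH l) => //; [right|apply: far_mono fy; rewrite leq_addr].
  move: lks; rewrite inE => /orP[/eqP lk|ls].
    by apply: HN'; [rewrite -lk|apply: far_mono fy; rewrite leq_addl].
  by apply: (IH l) => //; [left|apply: far_mono fy; rewrite leq_addr].
exists (N0 + B)%N => N NN; apply/eqP; rewrite -subr_eq0 -(actNl mod) -(actDl mod).
set y := x + _.
have ye i j : ent y i j = if (`|i| <= N)%N && (`|j| <= N)%N then 0 else ent x i j.
  rewrite entD entN ent_cut; case: ifP => _; first by rewrite subrr.
  by rewrite subr0.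
have yc : cen y = 0 by rewrite cenD cenN cen_cut subrr.
(* The main diagonal is added by hand since [box] omits 0. *)
have -> : y = \sum_(k <- 0 :: box B) diag_elt k (fun j => ent y (j - k) j) 0.
  apply: AhatP => [i j|]; last by rewrite cen_sum big1.
  rewrite ent_sum.
  have [->|i0] := eqVneq i 0.
    by rewrite ent0l big1 // => k _; rewrite ent_diag eqxx andbF.
  have [->|j0] := eqVneq j 0.
    by rewrite ent0r big1 // => k _; rewrite ent_diag eqxx !andbF.
  rewrite (eq_bigr (fun k => ent y (j - k) j * ((j - i) == k)%:R)); last first.
    by move=> k _; rewrite ent_diag i0 j0 !andbT; case: eqP; rewrite ?mulr1 ?mulr0.
  rewrite sum_pred1; last by rewrite /= box_uniq mem_box eqxx.
  rewrite inE mem_box (_ : j - (j - i) = i); last by lia.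
  case: ifP => // h; rewrite ye; case: ifP => // _.
  apply: xB; lia.
rewrite act_suml big_seq big1 // => k kB; apply: (HN0 k).
- by move: kB; rewrite inE => /orP[/eqP ->|]; [right|left].
- exact: diag_deg.
split=> // i j jN; rewrite ent_diag; case: ifP => // /and3P[/eqP ij _ _].
rewrite ye; case: ifP => // /negP[]; move: kB; rewrite inE mem_box; lia.
Qed.

Lemma central_act w : act central_elt w = xi (MkAhat0 central_deg) *: w.
Proof.
have hv := (let: And4 _ h _ _ := hw in h) (MkAhat0 central_deg).
elim/(hw_ind hw): w => [|c w w' Hw Hw'|k x w _ xk IH]; first exact: hv.
  by rewrite (actDr mod) (actZr mod) Hw Hw' scalerDr !scalerA mulrC.
by rewrite (act_swap mod _ central_deg xk) (central_br xk) (act0l mod) addr0 scale1r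
  IH (actZr mod).
Qed.

(** On a given vector any [x] acts as a truncation, that is, through finitely many matrix units and
    the centre, which acts by a scalar. *)
Lemma submodule_act (W : V -> Prop) :
    (forall c w w', W w -> W w' -> W (c *: w + w')) ->
    (forall p q w, p != 0 -> q != 0 -> W w -> W (Eact act p q w)) ->
  forall x w, W w -> W (act x w).
Proof.
move=> WZD WE x w Ww; have [N HN] := act_cut x w; rewrite (HN N) //.
have W0 : W 0 by have := WZD (-1) w w Ww Ww; rewrite scaleN1r addNr.
apply: (cut_ind (Q := fun y => W (act y w))) => [c y z Wy Wz|p q p0 q0|].
- by rewrite (actZDl mod); exact: WZD.
- exact: WE.
- by rewrite central_act -[_ *: w]addr0; exact: WZD.
Qed.

Lemma star_form_contravariant (form : V -> V -> C) :
    is_inner form -> is_star_form (Eact act) form ->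
    xi (MkAhat0 central_deg) \is Num.real ->
  forall x w w', form (act x w) w' = form w (act (star x) w').
Proof.
move=> fP fE dR x w w'.
have [N HN] := act_cut x w; have [N' HN'] := act_cut (star x) w'.
rewrite (HN _ (leq_maxl N N')) (HN' _ (leq_maxr N N')) -star_cut.
apply: (cut_ind (Q := fun y => form (act y w) w' = form w (act (star y) w'))).
- move=> c y z Hy Hz; rewrite starZD !(actZDl mod) (innerDl fP) (innerZl fP) Hy Hz.
  by rewrite (innerDr fP) (innerZr fP) conjCK.
- move=> p q p0 q0; rewrite star_unit // (actZl mod) (innerZr fP) rmorph_sign.
  exact: fE.
- rewrite star_central !central_act (innerZl fP) (innerZr fP).
  by rewrite (conj_Creal dR).
Qed.

Definition dunit (p : int) : Ahat R := diag_elt 0 (fun j => (j == p)%:R) 0.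

Lemma dunit_deg p : dunit p \in Ahat_deg 0.
Proof. exact: diag_deg. Qed.

Lemma xi_act (h : Ahat0 R) : act h v = xi h *: v.
Proof. by case: hw => _ H _ _; exact: H. Qed.

Lemma hwv_neq0 : v != 0.
Proof. by case: hw. Qed.

Lemma scale_hwv_inj (a b : C) : a *: v = b *: v -> a = b.
Proof.
by move=> /eqP; rewrite -subr_eq0 -scalerBl scaler_eq0 (negPf hwv_neq0) orbF subr_eq0 => /eqP.
Qed.

Definition diag_wt (p : int) : C := xi (MkAhat0 (dunit_deg p)).
Definition level : C := xi (MkAhat0 central_deg).

(** A priori [xi] is any functional on infinite sequences. Since far Cartan elements kill [v], it is
    a finite combination of coordinates and the level. *)
Lemma xi_expansion : exists N0 : nat,
  (forall p, (N0 < `|p|)%N -> diag_wt p = 0) /\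
  forall (M : nat) (h : Ahat0 R), (N0 <= M)%N -> xi h =
    \sum_(1 <= m < M.+1) (diag_wt m%:Z * omega_wt m%:Z h
       + diag_wt (- m%:Z) * omega_wt (- m%:Z) h) + level * Lambda0 h.
Proof.
have [N0 HN0] := far_kills_Cartan mod hw qf; exists N0; split=> [p pN|M h NM].
  apply: scale_hwv_inj; rewrite scale0r -xi_act; apply: HN0; first exact: dunit_deg.
  split=> // i j jN; rewrite ent_diag (_ : (j == p) = false) ?if_same //; lia.
apply: scale_hwv_inj; rewrite -xi_act.
pose y := \sum_(1 <= m < M.+1) (omega_wt m%:Z h *: dunit m%:Z +
   omega_wt (- m%:Z) h *: dunit (- m%:Z)) + Lambda0 h *: central_elt.
have h0 : Ahat0_val h \in Ahat_deg 0 := valP h.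
have dy : Ahat0_val h - y \in Ahat_deg 0.
  rewrite rpredB // rpredD ?rpredZ ?central_deg // rpred_sum // => m _.
  by rewrite rpredD // rpredZ // dunit_deg.
have yE : act (Ahat0_val h - y) v = 0.
  apply: HN0 => //; split=> [i j jN|]; last first.
    rewrite cenD cenN cenD cenZ cen_diag mulr1 cen_sum big1 ?add0r.
      by rewrite -[cen _]/(Lambda0 h) subrr.
    by move=> m _; rewrite cenD !cenZ !cen_diag !mulr0 addr0.
  have [ij|ij] := eqVneq (j - i) 0; last by rewrite (ent_deg dy).
  have {ij} -> : i = j by lia.
  have [->|j0] := eqVneq j 0; first by rewrite ent0r.
  rewrite entD entN entD entZ ent_diag if_same mulr0 addr0 ent_sum.
  rewrite (eq_big_nat _ _ (F2 := fun m : nat => ent h j j * (m == `|j|%N)%:R)).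
    rewrite -big_distrr /= -natr_sum.
    rewrite (_ : (\sum_(1 <= m < M.+1) (m == `|j|))%N = 1%N) ?mulr1 ?subrr //.
    rewrite (big_rem `|j|%N) /=; last by rewrite mem_index_iota; lia.
    rewrite eqxx big_seq big1 // => m; rewrite mem_rem_uniq ?iota_uniq // inE.
    by case/andP => /negPf ->.
  move=> m /andP[m1 _]; rewrite entD !entZ !ent_diag subrr eqxx j0 /=.
  have [jm|jm] := eqVneq j m%:Z.
    have -> : (j == - m%:Z) = false by lia.
    have -> : m == `|j|%N by lia.
    by rewrite mulr0 addr0 jm.
  have [jm'|jm'] := eqVneq j (- m%:Z).
    have -> : m == `|j|%N by lia.
    by rewrite mulr0 add0r jm'.
  have -> : (m == `|j|%N) = false by lia.
  by rewrite !mulr0 addr0.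
have := actDl mod (Ahat0_val h - y) y v; rewrite yE subrK add0r => ->.
rewrite /y (actDl mod) act_suml (actZl mod) central_act scalerDl scaler_suml.
rewrite mulrC scalerA; congr (_ + _); apply: eq_bigr => m _.
rewrite (actDl mod) !(actZl mod) scalerDl.
have e p : act (dunit p) v = diag_wt p *: v by rewrite -xi_act.
by rewrite !e !scalerA mulrC [in RHS]mulrC; congr (_ + _); rewrite mulrC.
Qed.

End Action.
End Truncation.

(** * Necessity of the conditions *)

Lemma dot_inner (R : realType) (V : lmodType R[i]) (form : {dot V for @Num.conj R[i]}) :
  is_inner form.
Proof.
split.
- by move=> u v w; rewrite linearDl.
- by move=> c u w; rewrite linearZl_LR.
- by move=> u w; rewrite (@hermitian_subproof _ _ _ _ form u w) expr0 mul1r.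
- exact: neq0_dnorm_gt0.
Qed.

Lemma inner_dot (R : realType) (V : lmodType R[i]) (f : V -> V -> R[i]) :
  is_inner f -> exists form : {dot V for @Num.conj R[i]}, form =2 f.
Proof.
move=> fP.
pose S : GRing.Scale.law R[i] R[i] := *%R.
pose S' : GRing.Scale.law R[i] R[i] := (@Num.conj R[i] \; *%R).
have bil : bilinear_for S S' f.
  split=> [w c u u'|w c u u'].
    by rewrite (innerDl fP) (innerZl fP).
  by rewrite (innerDr fP) (innerZr fP).
pose b := bilinear_isBilinear.Build _ _ _ _ S S' f bil.
have hm x y : f x y = (-1) ^+ false * Num.conj (f y x).
  by rewrite expr0 mul1r; exact: innerC fP _ _.
pose h := isHermitianSesquilinear.Build _ _ false (@Num.conj R[i]) f hm.
pose p := isDotProduct.Build _ _ f (inner_gt0 fP).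
pose D : {dot V for @Num.conj R[i]} := HB.pack f b h p.
by exists D.
Qed.

Section SmallWeights.
Variables (a : nat -> nat).
Hypothesis (a_step : forall m, (0 < m)%N -> (a m.+2 <= a m)%N).
Hypothesis (a_strict : forall m, (0 < m)%N -> (0 < a m + a m.+1)%N -> (a m.+2 < a m)%N).
Variable N : nat.
Hypothesis aN : forall m, (N < m)%N -> a m = 0%N.

(** The rank is the number [r0] of non-zero entries at odd positions, except that the zero sequence
    receives rank 1 by convention. *)
Lemma decreasing_frob_cond : exists r, [/\ (0 < r)%N,
  forall m, (2 * r < m)%N -> a m = 0%N & frob_cond r (fun m => (a m)%:Z)].
Proof.
have odd_mono t t' : (t <= t')%N -> (a (2 * t' + 1)%N <= a (2 * t + 1)%N)%N.
  elim: t' => [|t' IH]; first by case: t.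
  rewrite leq_eqVlt => /orP[/eqP -> //|]; rewrite ltnS => /IH; apply: leq_trans.
  by have := @a_step (2 * t' + 1)%N; rewrite (_ : (2 * t'.+1 + 1 = (2 * t' + 1).+2)%N); [apply; lia|lia].
have ex : exists t, a (2 * t + 1)%N == 0%N by exists N; rewrite aN //; lia.
pose r0 := ex_minn ex; have [rE rmin] : a (2 * r0 + 1)%N = 0%N /\
    forall t, a (2 * t + 1)%N = 0%N -> (r0 <= t)%N.
  rewrite /r0; case: ex_minnP => t /eqP t0 tm; split=> // t' /eqP; exact: tm.
have zero m : (2 * r0 < m)%N -> a m = 0%N.
  move=> rm; have [mo|me] := boolP (odd m).
    have := @odd_mono r0 m./2; rewrite rE (_ : (2 * m./2 + 1 = m)%N); last by lia.
    by move=> h; apply/eqP; rewrite -leqn0; apply: h; lia.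
  (* A positive even entry beyond [2 * r0] would force a strict drop from the odd entry before it,
     which is already 0. *)
  apply/eqP; rewrite -leqn0 leqNgt; apply/negP => am.
  have := @a_strict m.-1; have -> : m.-1.+1 = m by lia.
  have -> : a m.-1 = 0%N.
    have := @odd_mono r0 m.-1./2; rewrite rE (_ : (2 * m.-1./2 + 1 = m.-1)%N); last by lia.
    by move=> h; apply/eqP; rewrite -leqn0; apply: h; lia.
  by rewrite add0n am ltn0 => h; have : false by apply: h => //; lia.
have [r00|r0p] := posnP r0.
  have z m : (0 < m)%N -> a m = 0%N by move=> m0; apply: zero; rewrite r00.
  exists 1%N; split=> // [m m2|]; first by apply: z; lia.
  split; [by move=> t; lia|by []|by move=> t; lia|by []|].
  by split=> // _; rewrite !z.
exists r0; split=> //.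
have pos t : (t < r0)%N -> (0 < a (2 * t + 1))%N.
  by move=> tr; rewrite lt0n; apply/eqP => /rmin; lia.
split=> [t tr||t /andP[t0 tr]||].
- rewrite ltz_nat (_ : (2 * t + 3 = (2 * t + 1).+2)%N); last by lia.
  apply: a_strict; first by lia.
  by rewrite addn_gt0 pos //; lia.
- by [].
- rewrite ltz_nat (_ : (2 * t + 2 = (2 * t).+2)%N); last by lia.
  apply: a_strict; first by lia.
  by rewrite addn_gt0 -[(2 * t).+1]addn1 pos ?orbT.
- by [].
- have := pos r0.-1; rewrite (_ : (2 * r0.-1 + 1 = 2 * r0 - 1)%N); last by lia.
  move=> h; split=> [h0|[r1 a1 _]]; first by move: h; rewrite (_ : a _ = 0%N) //; lia.
  by rewrite r1.
Qed.

End SmallWeights.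

Section FrobWeight.
Variable R : realType.
Local Notation C := R[i].

Lemma trunc_sum (g : nat -> int) (w : nat -> C) (r M : nat) : (r <= M)%N ->
  \sum_(1 <= m < r.+1) (g m)%:~R * w m =
  \sum_(1 <= m < M.+1) (if (m <= r)%N then g m else 0)%:~R * w m.
Proof.
move=> rM; rewrite [RHS](@big_cat_nat _ _ _ r.+1) //=.
rewrite [X in _ + X]big_nat_cond [X in _ + X]big1 ?addr0; last first.
  by move=> m /andP[/andP[rm _] _]; rewrite leqNgt rm mul0r.
by apply: eq_big_nat => m /andP[_ mr]; rewrite -ltnS mr.
Qed.

(** Both halves are padded with zeros up to a common [M], so that weights of different ranks can be
    compared term by term. *)
Lemma frob_weightE (xip xim : nat -> int) (r s d M : nat) (h : Ahat0 R) :
  (2 * r <= M)%N -> (2 * s <= M)%N -> frob_weight xip xim r s d h =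
  \sum_(1 <= m < M.+1) ((if (m <= 2 * r)%N then xip m else 0)%:~R * omega_wt m%:Z h
     + (- if (m <= 2 * s)%N then xim m else 0)%:~R * omega_wt (- m%:Z) h)
  + d%:R * Lambda0 h.
Proof.
move=> rM sM.
have -> : frob_weight xip xim r s d h =
   \sum_(1 <= m < (2 * r).+1) (xip m)%:~R * omega_wt m%:Z h
   - \sum_(1 <= m < (2 * s).+1) (xim m)%:~R * omega_wt (- m%:Z) h
   + d%:R * Lambda0 h.
  have S (t : seq nat) (F : nat -> Ahat0 R -> C^o) :
    (\sum_(m <- t) F m) h = \sum_(m <- t) F m h.
    by elim: t => [|m t IH]; rewrite ?big_nil // !big_cons -IH.
  by rewrite -(S _ (fun m => (xip m)%:~R *: omega_wt m%:Z))
    -(S _ (fun m => (xim m)%:~R *: omega_wt (- m%:Z))).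
rewrite (trunc_sum _ _ rM) (trunc_sum _ _ sM) -sumrB; congr (_ + _).
by apply: eq_bigr => m _; rewrite rmorphN mulNr.
Qed.
End FrobWeight.

Section Necessity.
Variables (R : realType) (V : lmodType R[i]).
Variables (Vpar : bool -> {pred V}) (act : Ahat R -> V -> V).
Variables (xi : {scalar Ahat0 R}) (v : V).
Hypotheses (mod : is_supermodule Vpar act) (hw : is_highest_weight_module act xi v).
Hypothesis qf : quasi_finite act v.
Local Notation C := R[i].
Local Notation E := (Eact act).
Local Notation dw := (diag_wt xi).
Local Notation lev := (level xi).

Definition shifted_wt (p : int) : C :=
  dw p + (if p < 0 then (-1) ^+ podd p else 0) * lev.

Lemma unit_diag p : unit_elt R p p =
  dunit R p + (if p < 0 then (-1) ^+ podd p else 0) *: central_elt R.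
Proof.
apply: AhatP => [i j|].
  by rewrite entD entZ !ent_diag if_same mulr0 addr0 subrr.
by rewrite cenD cenZ !cen_diag eqxx /= mulr1 add0r.
Qed.

Lemma hwv_weight : has_weight E shifted_wt v.
Proof.
move=> p p0; rewrite /Eact unit_diag (actDl mod) (actZl mod).
rewrite (central_act mod hw) scalerA scalerDl; congr (_ + _).
by rewrite -(xi_act hw).
Qed.

Lemma hwv_killed p q : p < q -> E p q v = 0.
Proof. by move=> pq; apply: (act_pos hw (k := q - p)); [lia|exact: unit_deg]. Qed.

Section Unitary.
Variable form : V -> V -> C.
Hypotheses (fP : is_inner form) (fE : is_star_form E form).

Let EP : is_gl_rep E := Eact_gl_rep mod.
Let v0 : v != 0 := hwv_neq0 hw.
Let wv := hwv_weight.

Lemma dom (p q : int) eta u : u != 0 -> has_weight E eta u -> E p q u = 0 ->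
    p != 0 -> q != 0 -> p != q -> ~~ podd (q - p) -> sbrk p = sbrk q ->
  exists n : nat, eta p - eta q = n%:R.
Proof.
move=> u0 wu Eu p0 q0 pq o sg; apply: (dominance EP fP fE p0 q0 pq o _ u0 wu Eu).
by rewrite sg addnn odd_double.
Qed.

Lemma dom_hwv (p q : int) :
    p != 0 -> q != 0 -> p < q -> ~~ podd (q - p) -> sbrk p = sbrk q ->
  exists n : nat, shifted_wt p - shifted_wt q = n%:R.
Proof.
move=> p0 q0 pq o sg; apply: (dom v0 wv (hwv_killed pq) p0 q0 _ o sg); lia.
Qed.


Lemma shifted_wt_pos (m : nat) : shifted_wt m%:Z = dw m%:Z.
Proof. by rewrite /shifted_wt /= mul0r addr0. Qed.

Lemma shifted_wt_neg (m : nat) : (0 < m)%N ->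
  shifted_wt (- m%:Z) = dw (- m%:Z) + (-1) ^+ odd m * lev.
Proof.
move=> m0; rewrite /shifted_wt (_ : - m%:Z < 0); last by lia.
by rewrite /podd abszN.
Qed.

Lemma sbrk_pos (m : nat) : sbrk m%:Z = false.
Proof. by rewrite /sbrk andbF. Qed.

Lemma sbrk_neg (m : nat) : (0 < m)%N -> sbrk (- m%:Z) = odd m.
Proof. by move=> m0; rewrite /sbrk (_ : - m%:Z < 0) ?andbT /podd ?abszN //; lia. Qed.

(** Dominance is applied to [m] and an index of the same parity and sign so far out that its
    diagonal weight is 0. For the level, a far integer is paired with its negative: the shifted
    weights there are [lev] and 0. *)
Lemma pos_weights : exists (a : nat -> nat) (b : nat -> nat) (d N : nat),
  [/\ forall m, (0 < m)%N -> dw m%:Z = (a m)%:R,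
      forall m, (0 < m)%N -> dw (- m%:Z) = - (b m)%:R, lev = d%:R &
      forall m, (N < m)%N -> a m = 0%N /\ b m = 0%N].
Proof.
have [N [dN _]] := xi_expansion mod hw qf.
have Hp m : (0 < m)%N -> exists n : nat, dw m%:Z = n%:R.
  move=> m0; pose q : nat := (m + 2 * N.+1)%N.
  have [|||||n nE] := @dom_hwv (m%:Z) (q%:Z);
    rewrite ?sbrk_pos //; try (rewrite /q /podd; lia).
  exists n; rewrite -nE !shifted_wt_pos (dN q%:Z) ?subr0 // /q; lia.
have Hn m : (0 < m)%N -> exists n : nat, dw (- m%:Z) = - n%:R.
  move=> m0; pose q : nat := (m + 2 * N.+1)%N.
  have q0 : (0 < q)%N by rewrite /q; lia.
  have qm : odd q = odd m by rewrite /q; lia.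
  have [|||||n nE] := @dom_hwv (- q%:Z) (- m%:Z);
    rewrite ?sbrk_neg ?qm //; try (rewrite /q /podd; lia).
  exists n; rewrite -nE !shifted_wt_neg // qm (dN (- q%:Z)); last by rewrite /q; lia.
  by rewrite add0r; ring.
have [d dE] : exists d : nat, lev = d%:R.
  pose q : nat := (2 * N.+1)%N; have qo : odd q = false by rewrite /q; lia.
  have q0 : (0 < q)%N by rewrite /q; lia.
  have [|||||n nE] := @dom_hwv (- q%:Z) (q%:Z);
    rewrite ?sbrk_neg ?sbrk_pos ?qo //; try (rewrite /q /podd; lia).
  exists n; rewrite -nE shifted_wt_pos shifted_wt_neg // qo !dN; try (rewrite /q; lia).
  by rewrite add0r mul1r subr0.
have /choice[a aE] : forall m, exists n : nat, (0 < m)%N -> dw m%:Z = n%:R.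
  by case=> [|m]; [exists 0%N|have [n nE] := Hp m.+1 isT; exists n].
have /choice[b bE] : forall m, exists n : nat, (0 < m)%N -> dw (- m%:Z) = - n%:R.
  by case=> [|m]; [exists 0%N|have [n nE] := Hn m.+1 isT; exists n].
exists a, b, d, N; split=> // m mN; have m0 : (0 < m)%N by lia.
split; apply/eqP; rewrite -(eqr_nat C).
  by rewrite -aE // dN.
by rewrite -[_%:R]opprK -bE // dN ?abszN // oppr0.
Qed.

Variables (a b : nat -> nat) (d N : nat).
Hypotheses (aE : forall m, (0 < m)%N -> dw m%:Z = (a m)%:R).
Hypotheses (bE : forall m, (0 < m)%N -> dw (- m%:Z) = - (b m)%:R).
Hypothesis dE : lev = d%:R.

Lemma natr_diff_ge (x y k n : nat) : x%:R - y%:R - k%:R = n%:R :> C -> (y + k <= x)%N.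
Proof.
move=> /eqP; rewrite !subr_eq -!natrD eqr_nat => /eqP ->; lia.
Qed.

Lemma pos_step m : (0 < m)%N -> (a m.+2 <= a m)%N.
Proof.
move=> m0; have [|||||n nE] := @dom_hwv (m%:Z) (m.+2%:Z);
  rewrite ?sbrk_pos //; try (rewrite /podd; lia).
move: nE; rewrite !shifted_wt_pos !aE // => nE.
by rewrite -[a m.+2]addn0; apply: (@natr_diff_ge _ _ 0 n); rewrite -nE subr0.
Qed.

Lemma neg_step m : (0 < m)%N -> (b m.+2 <= b m)%N.
Proof.
move=> m0; have [|||||n nE] := @dom_hwv (- m.+2%:Z) (- m%:Z);
  rewrite ?sbrk_neg //= ?negbK //; try (rewrite /podd; lia).
move: nE; rewrite !shifted_wt_neg // !bE //= negbK => nE.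
rewrite -[b m.+2]addn0; apply: (@natr_diff_ge _ _ 0 n); rewrite -nE mulr0n; ring.
Qed.

(** The reflection [E (m+1) m v] is non-zero, is still killed by [E m (m+2)], and has lost one unit
    at [m]; dominance for this vector is the strict inequality. *)
Lemma pos_strict m : (0 < m)%N -> (0 < a m + a m.+1)%N -> (a m.+2 < a m)%N.
Proof.
move=> m0 am; pose u := E m.+1%:Z m%:Z v.
have m1 : m%:Z != 0 by lia.
have u0 : u != 0.
  apply: (odd_reflection_neq0 EP m1 _ _ v0 wv) => //.
  - by rewrite /podd; lia.
  - by apply: hwv_killed; lia.
  by rewrite !shifted_wt_pos !aE // -natrD pnatr_eq0 -lt0n.
have wu := has_weight_rep EP (p := m.+1%:Z) isT m1 wv.
have Eu : E m%:Z m.+2%:Z u = 0.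
  rewrite (rep_br EP) // (_ : (m.+2%:Z == m.+1%:Z) = false); last by lia.
  have h1 : m%:Z < m.+2%:Z by lia.
  have h2 : m.+1%:Z < m.+2%:Z by lia.
  by rewrite (hwv_killed h1) (hwv_killed h2) (rep0 EP) scale0r !scaler0 subr0 addr0.
have [|||||n nE] := dom (p := m%:Z) (q := m.+2%:Z) u0 wu Eu;
  rewrite ?sbrk_pos //; try (rewrite /podd; lia).
move: nE; rewrite !shifted_wt_pos !aE // eqxx.
rewrite (_ : (m%:Z == m.+1%:Z) = false); last by lia.
rewrite (_ : (m.+2%:Z == m.+1%:Z) = false); last by lia.
rewrite (_ : (m.+2%:Z == m%:Z) = false); last by lia.
rewrite mulr0n !addr0 subr0 => nE; rewrite -addn1; apply: (@natr_diff_ge _ _ 1 n).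
by rewrite -nE mulr1n; ring.
Qed.

(** As in [pos_strict]; the reflected vector gains a unit at [- m], and the level terms cancel
    because [m] and [m + 2] have equal parity. *)
Lemma neg_strict m : (0 < m)%N -> (0 < b m + b m.+1)%N -> (b m.+2 < b m)%N.
Proof.
move=> m0 bm; pose u := E (- m%:Z) (- m.+1%:Z) v.
have m1 : - m%:Z != 0 by lia.
have u0 : u != 0.
  apply: (odd_reflection_neq0 EP _ m1 _ v0 wv) => //.
  - by rewrite /podd; lia.
  - by apply: hwv_killed; lia.
  rewrite !shifted_wt_neg // !bE //=.
  have -> : - (b m.+1)%:R + (-1) ^+ (~~ odd m) * lev + (- (b m)%:R + (-1) ^+ odd m * lev)
     = - (b m + b m.+1)%:R.
    by rewrite natrD; case: (odd m); rewrite /= ?expr0 ?expr1; ring.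
  by rewrite oppr_eq0 pnatr_eq0 -lt0n.
have wu := has_weight_rep EP (q := - m.+1%:Z) m1 isT wv.
have Eu : E (- m.+2%:Z) (- m%:Z) u = 0.
  rewrite (rep_br EP) // (_ : (- m.+1%:Z == - m.+2%:Z) = false); last by lia.
  have h1 : - m.+2%:Z < - m%:Z by lia.
  have h2 : - m.+2%:Z < - m.+1%:Z by lia.
  rewrite (hwv_killed h1) (hwv_killed h2) (rep0 EP) mulr0 scale0r !scaler0.
  by rewrite subr0 addr0.
have [|||||n nE] := dom (p := - m.+2%:Z) (q := - m%:Z) u0 wu Eu;
  rewrite ?sbrk_neg //= ?negbK //; try (rewrite /podd; lia).
move: nE; rewrite !shifted_wt_neg // !bE // eqxx /= negbK.
rewrite (_ : (- m%:Z == - m.+1%:Z) = false); last by lia.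
rewrite (_ : (- m.+2%:Z == - m.+1%:Z) = false); last by lia.
rewrite (_ : (- m.+2%:Z == - m%:Z) = false); last by lia.
rewrite !mulr0n !addr0 !subr0 => nE; rewrite -addn1; apply: (@natr_diff_ge _ _ 1 n).
by rewrite -nE mulr1n; ring.
Qed.

(** Dominance for the integers -1 and 1 (indices -2 and 2) gives [a 2 + b 2 <= d] on [v]. Each of
    the reflections [E 2 1] and [E (-1) (-2)], available when [a 1], respectively [b 1], is
    positive, narrows the gap by one more, whence the two minima. *)
Lemma level_bound : (minn (a 1) 1 + minn (b 1) 1 + a 2 + b 2 <= d)%N.
Proof.
(* [E (-2) (-1)] must kill the vector for the second reflection to apply, and [E (-1) 2] is the
   commutator term met when [E (-2) 2] passes that reflection. *)
pose K (u : V) := [/\ E (- 2) 2 u = 0, E (- 2) (- 1) u = 0 & E (- 1) 2 u = 0].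
pose wt (x y : C) (u : V) := exists eta, [/\ has_weight E eta u,
  eta (- 2) = d%:R - (b 2)%:R - y, eta 2 = (a 2)%:R + x & eta (-1) = - (b 1)%:R - d%:R].
have wtv : wt 0 0 v.
  exists shifted_wt; split=> //.
  - by rewrite -[- 2]/(- 2%:Z) shifted_wt_neg // bE // dE subr0 mul1r addrC.
  - by rewrite -[2]/(2%:Z) shifted_wt_pos aE // addr0.
  - by rewrite -[- 1]/(- 1%:Z) shifted_wt_neg // bE // dE mulN1r.
have Kv : K v by split; exact: hwv_killed.
have [u [u0 Ku wu]] : exists u, [/\ u != 0, K u & wt (minn (a 1) 1)%:R 0 u].
  have [a1|a1] := posnP (a 1); first by exists v; rewrite a1.
  have -> : minn (a 1) 1 = 1%N by lia.
  exists (E 2 1 v); split.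
  - apply: (odd_reflection_neq0 EP (p := 1) (q := 2) _ _ _ v0 wv) => //.
      exact: hwv_killed.
    rewrite -[1]/(1%:Z) -[2]/(2%:Z) !shifted_wt_pos !aE // -natrD pnatr_eq0; lia.
  - split; last 2 first.
    + by apply: (rep_comm0 EP) => //; exact: hwv_killed.
    + rewrite (rep_br EP) // (@hwv_killed (-1) 2) // (@hwv_killed (-1) 1) //.
      by rewrite (rep0 EP) !scaler0 mulr0 scale0r subr0 addr0.
    rewrite (rep_br EP) // (@hwv_killed (-2) 2) // (@hwv_killed (-2) 1) //.
    by rewrite (rep0 EP) !scaler0 mulr0 scale0r subr0 addr0.
  - have [eta [we e1 e2 e3]] := wtv; exists (fun t => eta t + (t == 2)%:R - (t == 1)%:R).
    split; first exact: (has_weight_rep EP _ _ we).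
    + by rewrite e1 /= !subr0 addr0.
    + by rewrite e2 /= addr0 subr0.
    + by rewrite e3 /= subr0 addr0.
have [w [w0 Kw [eta [ww e1 e2]]]] : exists w, [/\ w != 0, E (- 2) 2 w = 0 &
    exists eta, [/\ has_weight E eta w, eta (- 2) = d%:R - (b 2)%:R - (minn (b 1) 1)%:R
      & eta 2 = (a 2)%:R + (minn (a 1) 1)%:R]].
  have [b1|b1] := posnP (b 1).
    by exists u; rewrite b1; case: Ku; case: wu => eta [we e1 e2 _]; split=> //; exists eta.
  have -> : minn (b 1) 1 = 1%N by lia.
  have [k1 k2 k3] := Ku; have [eta [we e1 e2 e3]] := wu.
  exists (E (- 1) (- 2) u); split.
  - apply: (odd_reflection_neq0 EP (p := - 2) (q := - 1) _ _ _ u0 we) => //.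
    rewrite e1 e3.
    have -> : d%:R - (b 2)%:R - 0 + (- (b 1)%:R - d%:R) = - (b 1 + b 2)%:R :> C.
      by rewrite natrD; ring.
    rewrite oppr_eq0 pnatr_eq0; lia.
  - rewrite (rep_br EP) // k1 k3 (rep0 EP) !scaler0 scale0r subr0 addr0 //.
  - exists (fun t => eta t + (t == - 1)%:R - (t == - 2)%:R).
    split; first exact: (has_weight_rep EP _ _ we).
    + by rewrite e1 /= subr0 addr0.
    + by rewrite e2 /= addr0 subr0.
have [|||||n nE] := dom (p := - 2) (q := 2) w0 ww Kw => //.
move: nE; rewrite e1 e2 => /eqP; rewrite !subr_eq -!natrD eqr_nat => /eqP ->; lia.
Qed.


End Unitary.

Lemma unitarizable_conditions : unitarizable act ->
  exists (d r s : nat) (xip xim : nat -> int),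
     [/\ (0 < r)%N /\ (0 < s)%N,
         xi =1 frob_weight xip xim r s d,
         frob_cond r xip,
         frob_cond s xim &
         Num.min (xip 1%N) 1 + Num.min (xim 1%N) 1 + xip 2%N + xim 2%N
           <= d%:Z].
Proof.
move=> [form formP]; have fP := dot_inner form.
have fE : is_star_form E form.
  move=> p q u w p0 q0; rewrite formP star_unit // (actZl mod) (innerZr fP).
  by rewrite rmorph_sign.
have [a [b [d [N [aE bE dE abN]]]]] := pos_weights fP fE.
have [r [r0 ar ac]] := decreasing_frob_cond (pos_step fP fE aE)
  (pos_strict fP fE aE) (fun m mN => (abN m mN).1).
have [s [s0 bs bc]] := decreasing_frob_cond (neg_step fP fE bE)
  (neg_strict fP fE bE) (fun m mN => (abN m mN).2).
exists d, r, s, (fun m => (a m)%:Z), (fun m => (b m)%:Z); split=> //.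
  have [N0 [_ xiE]] := xi_expansion mod hw qf.
  move=> h; pose M := (N0 + 2 * r + 2 * s)%N.
  rewrite (@frob_weightE _ _ _ _ _ _ M) ?(xiE M); try (rewrite /M; lia).
  rewrite -/lev dE; congr (_ + _); apply: eq_big_nat => m /andP[m0 _].
  rewrite aE // bE //; congr (_ * _ + _ * _).
    by case: leqP => // /ar ->.
  by rewrite rmorphN /=; case: leqP => // /bs ->.
have := level_bound fP fE aE bE dE; lia.
Qed.

End Necessity.

(** * Transporting the form from an oscillator module *)

Section Sufficiency.
Variables (R : realType) (V : lmodType R[i]).
Variables (Vpar : bool -> {pred V}) (act : Ahat R -> V -> V).
Variables (xi : {scalar Ahat0 R}) (v : V).
Hypotheses (mod : is_supermodule Vpar act) (hw : is_highest_weight_module act xi v).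
Hypotheses (qf : quasi_finite act v) (irr : irreducible_module Vpar act).
Local Notation C := R[i].
Local Notation E := (Eact act).

Definition degree_elt : Ahat R := diag_elt 0 (fun j => - j%:~R) 0.

Lemma degree_deg : degree_elt \in Ahat_deg 0.
Proof. exact: diag_deg. Qed.

Lemma degree_br k (x : Ahat R) : x \in Ahat_deg k -> cen x = 0 ->
  Ahat_br degree_elt x = k%:~R *: x.
Proof.
move=> xk x0; rewrite /degree_elt (diag_br _ xk); apply: AhatP => [i j|]; last first.
  by rewrite cenZ x0 mulr0.
rewrite entZ ent_diag; have [ij|ij] := eqVneq (j - i) k; last first.
  by rewrite (ent_deg xk ij) mulr0.
have -> : j - k = i by lia.
have [->|i0] := eqVneq i 0; first by rewrite ent0l !mulr0.
have [->|j0] := eqVneq j 0; first by rewrite ent0r !mulr0.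
rewrite /=; congr (_ * _); rewrite -ij opprK addrC rmorphB //.
Qed.

Definition Vneg : V -> Prop := lspan (fun u => exists2 k, k < 0 & neg_monomial act v k u).

Lemma Vneg_ZD c u u' : Vneg u -> Vneg u' -> Vneg (c *: u + u').
Proof.
move=> [s sP ->] [s' sP' ->]; exists ([seq (c * p.1, p.2) | p <- s] ++ s').
  move=> p; rewrite mem_cat => /orP[/mapP[q /sP h ->]//|]; exact: sP'.
rewrite big_cat big_map scaler_sumr /=; congr (_ + _).
by apply: eq_bigr => p _; rewrite scalerA.
Qed.

Lemma Vneg0 : Vneg 0.
Proof. by exists [::]; rewrite ?big_nil. Qed.

Lemma act_neg_Vneg k (x : Ahat R) u : k < 0 -> x \in Ahat_deg k -> Vneg (act x u).
Proof.
move=> k0 xk; have [_ _ _ /(_ u)] := hw.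
apply: (lspan_ind (Q' := fun u => Vneg (act x u))) => [|c w w' Hw Hw'|w [l [s [sP lE ->]]]].
- by rewrite (act0r mod); exact: Vneg0.
- by rewrite (actDr mod) (actZr mod); exact: Vneg_ZD.
exists [:: (1, act x (foldr (fun p u => act p.2 u) v s))]; last by rewrite big_seq1 scale1r.
move=> p; rewrite inE => /eqP -> /=; exists (k + l).
  rewrite lE; have : \sum_(p <- s) p.1 <= 0.
    by rewrite big_seq; apply: sumr_le0 => q /sP[/ltW].
  by lia.
exists ((k, x) :: s); split=> //; last by rewrite big_cons lE.
by move=> q; rewrite inE => /orP[/eqP ->|/sP].
Qed.

(* [v] is separated from the monomials of negative degree by the eigenvalues of
   the degree operator. *)
Lemma Vneg_hwv c : Vneg (c *: v) -> c = 0.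
Proof.
have [dl dv] := act_deg0 hw degree_deg.
(* The operators [A k] commute, [A k] kills the monomials of degree [k], and on [v] it is
   multiplication by [- k]. A product over negative degrees therefore kills a given element of
   [Vneg] but acts on [v] by a non-zero scalar. *)
pose A (k : int) u := act degree_elt u - (dl + k%:~R) *: u.
have AZD k a u u' : A k (a *: u + u') = a *: A k u + A k u'.
  rewrite /A (actDr mod) (actZr mod) scalerDr scalerBr !scalerA.
  by rewrite [_ * a]mulrC opprD addrACA.
have A0 k : A k 0 = 0 by rewrite /A (act0r mod) scaler0 subr0.
have AC k l u : A k (A l u) = A l (A k u).
  rewrite /A !(actDr mod) -!scaleNr !(actZr mod) !scalerDr !scalerA.
  rewrite -!addrA; congr (_ + _); rewrite [in RHS]addrCA; congr (_ + (_ + _)).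
  by rewrite mulrC.
pose B ks u := foldr A u ks.
have B0 ks : B ks 0 = 0 by elim: ks => [|k ks IH] //=; rewrite IH.
have BZD ks a u u' : B ks (a *: u + u') = a *: B ks u + B ks u'.
  by elim: ks => [|k ks IH] //=; rewrite IH AZD.
have BA ks k u : B ks (A k u) = A k (B ks u).
  by elim: ks => [|l ks IH] //=; rewrite IH AC.
have BC ks ls u : B ks (B ls u) = B ls (B ks u).
  by elim: ls => [|l ls IH] //=; rewrite BA IH.
have Bv ks : B ks v = (\prod_(k <- ks) (- k%:~R)) *: v.
  elim: ks => [|k ks IH]; first by rewrite big_nil scale1r.
  rewrite /= IH big_cons /A (actZr mod) dv !scalerA -scalerBl.
  by congr (_ *: _); ring.
have mono s : (forall p : int * Ahat R, p \in s -> p.1 < 0 /\ p.2 \in Ahat_deg p.1) ->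
    A (\sum_(p <- s) p.1) (foldr (fun p u => act p.2 u) v s) = 0.
  rewrite /A => sP; apply/eqP; rewrite subr_eq0; apply/eqP.
  elim: s sP => [|[k x] s IH] sP.
    by rewrite big_nil /= addr0.
  have [/= k0 xk] := sP (k, x) (mem_head _ _).
  rewrite big_cons /= (act_swap mod _ degree_deg xk) scale1r.
  rewrite (degree_br xk) ?(actZl mod); last first.
    by have [_ h] := (Ahat_degP k x).1 xk; apply: h; lia.
  rewrite IH => [|p ps]; last by apply: sP; rewrite inE ps orbT.
  by rewrite (actZr mod) -scalerDl rmorphD /= addrAC -addrA.
have neg u : Vneg u -> exists ks : seq int, all (fun k => k < 0) ks /\ B ks u = 0.
  apply: (lspan_ind (Q' := fun u => exists ks : seq int,
    all (fun k => k < 0) ks /\ B ks u = 0)) => [|a u1 u2 [ks [ksn kse]] [ls [lsn lse]]|w [k k0 [s [sP kE ->]]]].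
  - by exists [::].
  - exists (ks ++ ls); rewrite all_cat ksn lsn; split=> //.
    rewrite /B foldr_cat -/(B ls _) -/(B ks _) BZD lse addr0 -[a *: _]addr0 BZD.
    by rewrite BC kse !B0 scaler0 addr0.
  - by exists [:: k]; rewrite /= k0 kE mono.
move=> /neg[ks [ksn]]; rewrite -[c *: v]addr0 BZD B0 addr0 Bv scalerA.
move/eqP; rewrite scaler_eq0 (negPf (hwv_neq0 hw)) orbF mulf_eq0 => /orP[/eqP //|].
rewrite prodf_seq_eq0 => /hasP[k kk]; have := allP ksn _ kk.
by rewrite /= oppr_eq0 intr_eq0; lia.
Qed.

Section Graph.
Variables (F : lmodType C) (EF : int -> int -> F -> F) (fF : F -> F -> C) (w : F).
Hypotheses (EFP : is_gl_rep EF) (fP : is_inner fF) (fE : is_star_form EF fF).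
Hypotheses (w0 : w != 0) (ww : has_weight EF (shifted_wt xi) w).
Hypothesis wk : forall p q : int, p != 0 -> q != 0 -> p < q -> EF p q w = 0.

Let EP : is_gl_rep E := Eact_gl_rep mod.

(** Only lowering units generate, so that pairings with the highest weight vectors can be read off
    by induction; closure under the other units is then proved in [graph_act]. *)
Inductive graph : V -> F -> Prop :=
| graph_base : graph v w
| graph_ZD c u f u' f' : graph u f -> graph u' f' -> graph (c *: u + u') (c *: f + f')
| graph_low p q u f : p != 0 -> q != 0 -> q < p -> graph u f -> graph (E p q u) (EF p q f).

Lemma graph0 : graph 0 0.
Proof.
by have := graph_ZD (-1) graph_base graph_base; rewrite !scaleN1r !addNr.
Qed.

Lemma graphZ c u f : graph u f -> graph (c *: u) (c *: f).
Proof. by move=> h; rewrite -[c *: u]addr0 -[c *: f]addr0; exact: graph_ZD graph0. Qed.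

Lemma graphB u f u' f' : graph u f -> graph u' f' -> graph (u - u') (f - f').
Proof.
move=> h h'; rewrite addrC [f - f']addrC -(scaleN1r u') -(scaleN1r f').
exact: graph_ZD.
Qed.

Lemma graphD u f u' f' : graph u f -> graph u' f' -> graph (u + u') (f + f').
Proof. by move=> h h'; rewrite -(scale1r u) -(scale1r f); exact: graph_ZD. Qed.

Lemma graph_act u f : graph u f -> forall p q, p != 0 -> q != 0 ->
  graph (E p q u) (EF p q f).
Proof.
elim=> {u f} [p q p0 q0|c u f u' f' _ IH _ IH' p q p0 q0|r s u f r0 s0 sr _ IH p q p0 q0].
- have [pq|pq|<-] := ltgtP p q.
  + by rewrite wk // (hwv_killed hw pq); exact: graph0.
  + by apply: graph_low => //; exact: graph_base.
  + by rewrite ww // (hwv_weight mod hw p0); apply: graphZ; exact: graph_base.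
- rewrite !(repD EP) !(repZ EP) !(repD EFP) !(repZ EFP); apply: graph_ZD; [exact: IH|exact: IH'].
- rewrite (rep_br EP) // (rep_br EFP) //; apply: graphD.
    by apply/graphZ/graph_low => //; exact: IH.
  by apply: graphB; apply: graphZ; exact: IH.
Qed.

(** The coefficient of [v] in [u] is the coefficient of [w] in [f]: a lowered pair has first entry
    in [Vneg] and second entry orthogonal to [w], as the adjoint is a raising operator. *)
Lemma graph_hwv u f : graph u f -> exists2 c, Vneg (u - c *: v) & fF f w = c * fF w w.
Proof.
elim=> {u f} [|c u f u' f' _ [a ua fa] _ [a' ua' fa']|p q u f p0 q0 qp _ _].
- by exists 1; rewrite ?scale1r ?subrr ?mul1r //; exact: Vneg0.
- exists (c * a + a').
    have -> : c *: u + u' - (c * a + a') *: v = c *: (u - a *: v) + (u' - a' *: v).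
      by rewrite scalerBr scalerDl scalerA opprD addrACA.
    exact: Vneg_ZD.
  by rewrite (innerDl fP) (innerZl fP) fa fa'; ring.
- exists 0; last by rewrite mul0r fE // wk // (inner0r fP) mulr0.
  rewrite scale0r subr0; apply: (act_neg_Vneg (k := q - p)); first by lia.
  exact: unit_deg.
Qed.

(** The fibre over 0 is stable under all matrix units, and by [graph_hwv] and [Vneg_hwv] it is
    orthogonal to [w]. Passing to adjoints, it is orthogonal to every second entry, including
    [f]. *)
Lemma graph_fun0 f : graph 0 f -> f = 0.
Proof.
move=> g0f; apply: (inner_eq0 fP).
have H u' f' : graph u' f' -> forall f, graph 0 f -> fF f f' = 0.
  elim=> {u' f'} [g gg|c u1 f1 u2 f2 _ IH1 _ IH2 g gg|p q u1 f1 p0 q0 _ _ IH g gg].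
  - have [c cn ->] := graph_hwv gg; move: cn; rewrite sub0r -scaleNr => /Vneg_hwv.
    by move/eqP; rewrite oppr_eq0 => /eqP ->; rewrite mul0r.
  - by rewrite (innerDr fP) (innerZr fP) IH1 // IH2 // mulr0 addr0.
  - have := fE g f1 q0 p0; rewrite IH; last first.
      by rewrite -(rep0 EP q p); exact: graph_act.
    by move/esym/eqP; rewrite mulf_eq0 signr_eq0 => /eqP.
exact: (H _ _ g0f _ g0f).
Qed.

Lemma graph_total u : exists f, graph u f.
Proof.
elim/(hw_ind hw): u => [|c u u' [f h] [f' h']|k x u _ _ [f h]].
- by exists w; exact: graph_base.
- by exists (c *: f + f'); exact: graph_ZD.
- apply: (submodule_act mod hw qf (W := fun u => exists f, graph u f)); last by exists f.
    by move=> c u1 u2 [f1 h1] [f2 h2]; exists (c *: f1 + f2); exact: graph_ZD.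
  by move=> p q u1 p0 q0 [f1 h1]; exists (EF p q f1); exact: graph_act.
Qed.

Lemma intertwiner : exists T : V -> F, [/\ forall c u u', T (c *: u + u') = c *: T u + T u',
  forall p q u, p != 0 -> q != 0 -> T (E p q u) = EF p q (T u) & T v = w].
Proof.
have /choice[T TP] := graph_total; exists T.
have uniq u f : graph u f -> T u = f.
  move=> g; apply/eqP; rewrite -subr_eq0; apply/eqP/graph_fun0.
  by rewrite -(subrr u); exact: graphB.
split=> [c u u'|p q u p0 q0|]; apply: uniq; last exact: graph_base.
  exact: graph_ZD.
exact: graph_act.
Qed.

Lemma parity_projection : exists pr : V -> V,
  [/\ forall c u u', pr (c *: u + u') = c *: pr u + pr u',
      forall u, u \in Vpar false -> pr u = u & forall u, u \in Vpar true -> pr u = 0] /\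
  forall u, pr u \in Vpar false /\ u - pr u \in Vpar true.
Proof.
have /choice[pr prP] : forall u, exists u0, u0 \in Vpar false /\ u - u0 \in Vpar true.
  by move=> u; have [u0 h0 h1] := par_add mod u; exists u0.
have submZD b c u u' : u \in Vpar b -> u' \in Vpar b -> c *: u + u' \in Vpar b.
  by have [_ h] := par_submod mod b; move=> *; exact: h.
have par0 b : 0 \in Vpar b by have [] := par_submod mod b.
have uniq u u0 : u0 \in Vpar false -> u - u0 \in Vpar true -> pr u = u0.
  move=> h0 h1; apply/eqP; rewrite -subr_eq0; apply/eqP; have [p0 p1] := prP u.
  apply: (par_cap mod).
    by rewrite addrC -scaleN1r; exact: submZD.
  have -> : pr u - u0 = -1 *: (u - pr u) + (u - u0).
    by rewrite scaleN1r opprB addrA subrK.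
  exact: submZD.
exists pr; split=> //; split=> [c u u'|u u0|u u1]; apply: uniq => //.
- by apply: submZD; [exact: (prP u).1|exact: (prP u').1].
- have -> : c *: u + u' - (c *: pr u + pr u') = c *: (u - pr u) + (u' - pr u').
    by rewrite scalerBr opprD addrACA.
  by apply: submZD; [exact: (prP u).2|exact: (prP u').2].
- by rewrite subrr.
- by rewrite subr0.
Qed.

(** The form is the sum of the pullbacks along [T] from the even and the odd part. A matrix unit
    permutes the two parts by its own parity, so contravariance survives the splitting. *)
Lemma unitarizable_of_vector : level xi \is Num.real -> unitarizable act.
Proof.
move=> lev; have [T [TZD TE Tv]] := intertwiner.
have [pr [[prZD pr0 pr1] prP]] := parity_projection.
pose pi b u := if b then u - pr u else pr u.
have piZD b c u u' : pi b (c *: u + u') = c *: pi b u + pi b u'.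
  by case: b; rewrite /pi prZD // scalerBr opprD addrACA.
have piP b u : pi b u \in Vpar b by case: b; have [] := prP u.
have pi_id b u : u \in Vpar b -> pi b u = u.
  by case: b => h; rewrite /pi; [rewrite pr1 // subr0|rewrite pr0].
have pi_0 b u : u \in Vpar (~~ b) -> pi b u = 0.
  by case: b => /= h; rewrite /pi; [rewrite pr0 // subrr|rewrite pr1].
have pisum u : u = pi false u + pi true u by rewrite /pi addrC subrK.
have TD u u' : T (u + u') = T u + T u' by rewrite -[u]scale1r TZD !scale1r.
have piD b u1 u2 : pi b (u1 + u2) = pi b u1 + pi b u2.
  by rewrite -[u1]scale1r piZD !scale1r.
have piE b p q u : p != 0 -> q != 0 -> pi b (E p q u) = E p q (pi (podd (q - p) (+) b) u).
  move=> p0 q0; have Epar c u' : u' \in Vpar c -> E p q u' \in Vpar (podd (q - p) (+) c).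
    by apply: act_par mod _ _ _ _ _; exact: unit_deg.
  have ED u1 u2 : E p q (u1 + u2) = E p q u1 + E p q u2 by exact: repD.
  rewrite {1}[u]pisum ED piD; set o := podd _ in Epar *.
  have Hs c : pi b (E p q (pi c u)) = if c == o (+) b then E p q (pi c u) else 0.
    have := Epar c _ (piP c u); case: eqP => [->|cb].
      by rewrite addKb => /pi_id.
    move=> h; apply: pi_0; move: h; congr (_ \in Vpar _).
    by move: cb; case: (o); case: (b); case: c.
  rewrite !Hs; case: (o (+) b); rewrite /= ?add0r ?addr0 //.
pose form u u' := fF (T (pi false u)) (T (pi false u')) + fF (T (pi true u)) (T (pi true u')).
have inj u : T (pi false u) = 0 -> T (pi true u) = 0 -> u = 0.
  (* The kernel of [T] itself might not be graded; the vectors with both components in it form a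
     graded submodule, and it is proper because [T v = w] is non-zero. *)
  pose W : {pred V} := fun u => `[< T (pi false u) = 0 /\ T (pi true u) = 0 >].
  have T0 : T 0 = 0 by have := TZD (-1) 0 0; rewrite !scaleN1r addNr addNr.
  have pi0 b : pi b 0 = 0 by have := piZD b (-1) 0 0; rewrite !scaleN1r addNr addNr.
  have WZD c u1 u2 : u1 \in W -> u2 \in W -> c *: u1 + u2 \in W.
    move=> /asboolP[a1 b1] /asboolP[a2 b2]; apply/asboolP.
    by rewrite !piZD !TZD a1 a2 b1 b2 scaler0 addr0.
  have Wsub : is_subsupermodule Vpar act W.
    split.
    - by split=> [|c u1 u2]; [apply/asboolP; rewrite !pi0 T0|exact: WZD].
    - apply: (submodule_act mod hw qf (W := fun u => u \in W)) => [c u1 u2|p q u1 p0 q0].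
        exact: WZD.
      move=> /asboolP[a1 b1]; apply/asboolP; rewrite !piE // !TE //.
      by case: (podd _); rewrite /= a1 b1 (rep0 EFP).
    - move=> u0 u1 h0 h1 /asboolP[a1 _]; apply/asboolP; move: a1.
      have -> : u0 + u1 = 1 *: u0 + u1 by rewrite scale1r.
      rewrite piZD scale1r !(pi_id false u0) // (pi_0 false u1) // addr0 => ->.
      by rewrite (pi_0 true) // T0.
  move=> t0 t1; have [_ /(_ W Wsub)[Wz|Wall]] := irr.
    by apply: Wz; apply/asboolP.
  have /asboolP[v0 v1] := Wall v.
  by move: w0; rewrite -Tv [v]pisum TD v0 v1 addr0 eqxx.
have formP : is_inner form.
  split.
  - by move=> u1 u2 u3; rewrite /form !piD !TD !(innerDl fP); ring.
  - move=> c u1 u3; rewrite /form -[c *: u1]addr0 !piZD !TZD !(innerDl fP) !(innerZl fP).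
    have z b : T (pi b 0) = 0.
      have := piZD b (-1) 0 0; rewrite !scaleN1r addNr addNr => ->.
      by have := TZD (-1) 0 0; rewrite !scaleN1r addNr addNr.
    by rewrite !z !(inner0l fP); ring.
  - move=> u1 u2; rewrite /form rmorphD /= -!(innerC fP) //.
  - move=> u1; rewrite lt0r addr_ge0 ?(inner_ge0 fP) // andbT; apply: contraNneq => h.
    have [h0 h1] : fF (T (pi false u1)) (T (pi false u1)) = 0 /\
       fF (T (pi true u1)) (T (pi true u1)) = 0.
      have /eqP := h; rewrite paddr_eq0 ?(inner_ge0 fP) // => /andP[/eqP -> /eqP ->] //.
    by rewrite (inj u1) //; apply: (inner_eq0 fP).
have formE : is_star_form E form.
  move=> p q u1 u2 p0 q0; rewrite /form !piE // !TE // (poddBC q p) !fE // -mulrDr.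
  by congr (_ * _); case: (podd _); rewrite //= addrC.
have [D DE] := inner_dot formP; exists D => x u1 u2; rewrite !DE.
exact: (star_form_contravariant mod hw qf).
Qed.

End Graph.
End Sufficiency.

(** * Partitions and Frobenius coordinates *)

Definition is_partition (mu : seq int) : Prop :=
  sorted >=%R mu /\ all (fun x => 0 <= x) mu.

Lemma conj_partP (mu : seq int) (i j : nat) : is_partition mu -> (0 < j)%N ->
  (i < conj_part mu j)%N = (j%:Z <= mu`_i).
Proof.
move=> [so po] j0; elim: mu so po i => [|x mu IH] so po i.
  by rewrite nth_nil /=; lia.
move: po => /= /andP[x0 po].
have so' : sorted >=%R mu by exact: path_sorted so.
have xmax : all (fun y => y <= x) mu by apply: order_path_min so; exact: ge_trans.
rewrite /conj_part /= -/(conj_part mu j).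
have [jx|xj] := lerP j%:Z x.
  by case: i => [|i] /=; [rewrite jx|rewrite -IH // add1n].
have c0 : conj_part mu j = 0%N.
  apply/eqP; rewrite -leqn0 leqNgt -has_count; apply/hasPn => y /(allP xmax) /= yx; lia.
rewrite c0; case: i => [|i] /=; first by lia.
have [im|im] := ltnP i (size mu); last by rewrite nth_default //; lia.
have := allP xmax _ (mem_nth 0 im); rewrite /= => yx.
by rewrite addn0 ltn0 leNgt (le_lt_trans yx xj).
Qed.

Lemma conj_part_mono mu a b : (a <= b)%N -> (conj_part mu b <= conj_part mu a)%N.
Proof. by move=> ab; apply: sub_count => x /=; lia. Qed.

Lemma part_nth_ge0 mu i : is_partition mu -> 0 <= mu`_i.
Proof.
move=> [_ po]; have [im|im] := ltnP i (size mu); last by rewrite nth_default.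
exact: (allP po _ (mem_nth 0 im)).
Qed.

Lemma part_nth_mono mu i k : is_partition mu -> (i <= k)%N -> mu`_k <= mu`_i.
Proof.
move=> muP ik; have [k0|k0] := leP mu`_k 0.
  exact: le_trans k0 (part_nth_ge0 i muP).
have h : (0 < absz (mu`_k)%R)%N by lia.
have := conj_partP k muP h; have := conj_partP i muP h; lia.
Qed.

(* The shifted Frobenius coordinates, extended by zero beyond the rank. *)
Definition frob_ext (mu : seq int) (m : nat) : int :=
  if odd m then Num.max (mu`_m./2 - m./2%:Z) 0
  else Num.max ((conj_part mu m./2)%:Z - m./2%:Z) 0.

Lemma part_rankP mu i : is_partition mu -> (i < part_rank mu)%N = (i.+1%:Z <= mu`_i).
Proof.
move=> muP; apply/idP/idP => [ir|im].
  have [k [ks kP ik]] : exists k : nat, [/\ (k < size mu)%N, k.+1%:Z <= mu`_k & (i <= k)%N].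
    move: ir; rewrite /part_rank => ir.
    have [k kP ik] : exists2 k : 'I_(size mu), (k.+1%:Z <= mu`_k) & (i < k.+1)%N.
      apply: contrapT => nk; move: ir; rewrite ltnNge => /negP[].
      apply/bigmax_leqP => k kP; rewrite leqNgt; apply/negP => ik; apply: nk.
      by exists k.
    by exists k; split=> //; exact: ltn_ord.
  by have := part_nth_mono muP ik; lia.
have is_ : (i < size mu)%N.
  by rewrite ltnNge; apply/negP => si; move: im; rewrite nth_default //; lia.
exact: (@leq_bigmax_cond _ _ (fun k : 'I_(size mu) => k.+1) (Ordinal is_) im).
Qed.

(** With rows counted from 0, [i < rank] iff [mu_i >= i + 1], and [j <= rank] iff column [j] has
    length at least [j]. So truncating at the rank is the same as taking positive parts; the rank 1
    convention for the zero partition adds only zeros. *)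
Lemma frob_coord_ext mu m : is_partition mu -> (0 < m)%N ->
  (if (m <= 2 * frob_rank mu)%N then frob_coord mu m else 0) = frob_ext mu m.
Proof.
move=> muP m0; rewrite /frob_rank /frob_coord /frob_ext.
have [zp|nz] := boolP (zero_part mu).
  have nth0 i : mu`_i = 0.
    have [im|im] := ltnP i (size mu); last by rewrite nth_default.
    by apply/eqP; exact: (allP zp _ (mem_nth 0 im)).
  rewrite if_same; case: ifP => mo; first by rewrite nth0; lia.
  have m2 : (0 < m./2)%N by lia.
  by have := conj_partP 0 muP m2; rewrite nth0; lia.
have [mo|mo] := boolP (odd m).
  by have := part_rankP m./2 muP; case: (leqP m (2 * part_rank mu)); lia.
have m2 : (0 < m./2)%N by lia.
have := part_rankP m./2.-1 muP; have := conj_partP m./2.-1 muP m2.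
have -> : m./2.-1.+1 = m./2 by lia.
by case: (leqP m (2 * part_rank mu)); lia.
Qed.

(** Row [i] has its boxes beyond column [i] in columns [j] with [i < j <= mu_i]; the bound on the
    parts keeps them all below [N + 1]. *)
Lemma frobenius_ext mu N m : is_partition mu -> all (fun x => x <= N%:Z) mu ->
  (frobenius (conj_part mu) N m)%:Z = frob_ext mu m.
Proof.
move=> muP muN; rewrite /frobenius /frob_ext; case: ifP => mo; last by lia.
set i := m./2.
have mN : mu`_i <= N%:Z.
  have [im|im] := ltnP i (size mu); last by rewrite nth_default.
  exact: (allP muN _ (mem_nth 0 im)).
have m0 := part_nth_ge0 i muP; have cP j := @conj_partP mu i j muP.
move: (mu`_i : int) mN m0 cP => y mN m0 cP.
rewrite (eq_bigr (fun j : 'I_N.+1 => ((i < j) && (j <= `|y|))%N : nat)); last first.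
  move=> j _; case: (ltnP i j) => //= ij; rewrite cP; last by lia.
  by congr nat_of_bool; lia.
have H n : (\sum_(j < n.+1) ((i < j) && (j <= `|y|)) = minn n `|y| - i)%N.
  elim: n => [|n IH]; first by rewrite big_ord_recr big_ord0 /=; lia.
  by rewrite big_ord_recr /= IH; lia.
by rewrite H; lia.
Qed.

Lemma frob_ext_cat0 mu k m : (0 < m)%N ->
  frob_ext (mu ++ nseq k 0) m = frob_ext mu m.
Proof.
move=> m0; rewrite /frob_ext nth_cat nth_nseq if_same; case: ifP => mo.
  by case: ltnP => // mm; rewrite nth_default.
rewrite /conj_part count_cat count_nseq (_ : m./2%:Z <= 0 = false) ?addn0 //; lia.
Qed.

(** * Reconstruction of a partition from its Frobenius coordinates *)

Section FromFrobenius.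
Variables (r : nat) (x : nat -> int).
Hypotheses (r0 : (0 < r)%N) (xP : frob_cond r x).

Lemma partition_of_frobenius : exists mu : seq int,
  [/\ is_partition mu, (size mu)%:Z = Num.min (x 1%N) 1 + x 2%N &
    forall m, (0 < m)%N -> frob_ext mu m = if (m <= 2 * r)%N then x m else 0].
Proof.
have [xo xo0 xe xe0 xz] := xP.
have [z|nz] := eqVneq (x (2 * r - 1)%N) 0.
  have [r1 x1 x2] := xz.1 z; exists [::]; split=> //; first by rewrite x1 x2.
  move=> m m0; rewrite /frob_ext /conj_part nth_nil /=.
  have [m2|m2] := leqP m (2 * r); last by case: ifP => _; lia.
  have [->|->] : m = 1%N \/ m = 2%N by lia.
    by rewrite x1.
  by rewrite x2.
(* Strictly decreasing integers ending in a positive value at [r - 1]; the even coordinates below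
   may end in 0, with the matching count. *)
have xoge t : (t < r)%N -> (r - t)%N%:Z <= x (2 * t + 1)%N.
  move=> tr; have [k kE] : exists k, (t + k.+1 = r)%N by exists (r - t).-1; lia.
  elim: k t tr kE => [|k IH] t tr kE.
    have := xo0; rewrite (_ : (2 * t + 1 = 2 * r - 1)%N); last by lia.
    by move=> h; have : x (2 * r - 1)%N != 0 by []; lia.
  have := IH t.+1; have := xo t; rewrite (_ : (2 * t.+1 + 1 = 2 * t + 3)%N); last by lia.
  by lia.
have xege t : (0 < t)%N -> (t <= r)%N -> (r - t)%N%:Z <= x (2 * t)%N.
  move=> t0 tr; have [k kE] : exists k, (t + k = r)%N by exists (r - t)%N; lia.
  elim: k t t0 tr kE => [|k IH] t t0 tr kE.
    by rewrite (_ : t = r) ?subnn //; lia.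
  have := IH t.+1; have := xe t; rewrite (_ : (2 * t.+1 = 2 * t + 2)%N); last by lia.
  by lia.
(* The lengths of the first [r] columns. *)
pose g (j : nat) : int := x (2 * j.+1)%N + j.+1%:Z.
pose gs := mkseq g r.
have gsn j : (j < r)%N -> gs`_j = g j by move=> jr; rewrite nth_mkseq.
have gpos j : (j < r)%N -> r%:Z <= g j.
  by move=> jr; have := @xege j.+1 isT jr; rewrite /g; lia.
have gsP : is_partition gs.
  split; last first.
    by apply/allP => y /mapP[j]; rewrite mem_iota => jr ->; have := @gpos j; lia.
  apply/(sortedP 0) => j; rewrite size_mkseq => jr; rewrite !gsn //; last by lia.
  have := xe j.+1; rewrite /g (_ : (2 * j.+2 = 2 * j.+1 + 2)%N); last by lia.
  by lia.
(* The first [r] rows come from the odd coordinates. A lower row meets only the first [r] columns,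
   so its length is the number of those that reach it. *)
pose f (i : nat) : int := if (i < r)%N then x (2 * i + 1)%N + i%:Z else (conj_part gs i.+1)%:Z.
have fs (i : nat) : (conj_part gs i.+1 <= r)%N.
  by apply: leq_trans (count_size _ _) _; rewrite size_mkseq.
have fpos i : 0 <= f i.
  by rewrite /f; case: ltnP => // /xoge; lia.
(* The number of rows is the length of the first column, [x 2 + 1] in the non-zero case; this is the
   quantity entering condition (iii). *)
pose L := `|(x 2%N + 1)%R|%N.
have LE : L%:Z = x 2%N + 1 by have := @xege 1%N isT r0; rewrite muln1; rewrite /L; lia.
have rL : (r <= L)%N by have := @xege 1%N isT r0; rewrite muln1; lia.
pose mu := mkseq f L.
have mun i : (i < L)%N -> mu`_i = f i by move=> iL; rewrite nth_mkseq.
have muP : is_partition mu.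
  split; last by apply/allP => y /mapP[j _ ->].
  apply/(sortedP 0) => i; rewrite size_mkseq => iL; rewrite !mun //; last by lia.
  rewrite /f; have [h1|h1] := ltnP i.+1 r.
    rewrite (_ : (i < r)%N); last by lia.
    by have := xo i h1; rewrite (_ : (2 * i.+1 + 1 = 2 * i + 3)%N); lia.
  have [h2|h2] := ltnP i r.
    by have := xoge i h2; have := fs i.+1; lia.
  by have := @conj_part_mono gs i.+1 i.+2 (leqnSn _); lia.
have cE j : (0 < j)%N -> (j <= r)%N -> (conj_part mu j)%:Z = x (2 * j)%N + j%:Z.
  move=> j0 jr; have gj := gpos j.-1; rewrite /g (_ : j.-1.+1 = j) in gj; last by lia.
  have jr' : (j.-1 < r)%N by lia.
  have gE : gs`_j.-1 = x (2 * j)%N + j%:Z.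
    by rewrite gsn // /g (_ : j.-1.+1 = j) //; lia.
  have e (i : nat) : (i < conj_part mu j)%N = (i%:Z < x (2 * j)%N + j%:Z).
    rewrite (conj_partP _ muP) //.
    have [iL|iL] := ltnP i L; last first.
      rewrite nth_default ?size_mkseq //.
      have := @part_nth_mono gs 0 j.-1 gsP (leq0n _); rewrite gE gsn // /g muln1; lia.
    rewrite mun // /f; have [ir|ir] := ltnP i r.
      by have := xoge i ir; have := gj jr; lia.
    have := conj_partP j.-1 gsP (ltn0Sn i); rewrite gE; lia.
  have := e (conj_part mu j); rewrite ltnn.
  have := e (conj_part mu j).-1; have := gj jr; lia.
have nthr i : (r <= i)%N -> mu`_i <= r%:Z.
  move=> ri; have [iL|iL] := ltnP i L; last by rewrite nth_default ?size_mkseq.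
  by rewrite mun // /f ltnNge ri /=; have := fs i; lia.
exists mu; split=> //.
  rewrite size_mkseq LE.
  by have := xoge 0%N r0; rewrite muln0 add0n; lia.
move=> m m0; rewrite /frob_ext; have [mo|mo] := boolP (odd m).
  have mE : (2 * m./2 + 1 = m)%N by lia.
  have [ir|ir] := ltnP m./2 r.
    rewrite mun ?(leq_trans ir) // /f ir mE (_ : (m <= 2 * r)%N); last by lia.
    by have := xoge _ ir; rewrite mE; lia.
  rewrite (_ : (m <= 2 * r)%N = false); last by lia.
  by have := nthr _ ir; lia.
have mE : (2 * m./2 = m)%N by lia.
have m2 : (0 < m./2)%N by lia.
have [jr|jr] := leqP m./2 r.
  rewrite (_ : (m <= 2 * r)%N); last by lia.
  by rewrite (cE _ m2 jr) mE; have := xege _ m2 jr; rewrite mE; lia.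
rewrite (_ : (m <= 2 * r)%N = false); last by lia.
have := conj_partP r muP m2; have := nthr r (leqnn r); lia.
Qed.

End FromFrobenius.

Lemma pos_part_partition la : is_gen_partition la -> is_partition (pos_part la).
Proof.
move=> laP; split; last by apply/allP => y /mapP[x _ ->]; lia.
apply: homo_sorted laP => x y /=; lia.
Qed.

Lemma neg_part_partition la : is_gen_partition la -> is_partition (neg_part la).
Proof.
move=> laP; split; last by rewrite all_rev; apply/allP => y /mapP[x _ ->] /=; lia.
by rewrite rev_sorted; apply: homo_sorted laP => x y /=; lia.
Qed.

(** An integer cannot be both positive and negative, so each entry is counted at most once. *)
Lemma conj_part_parts la :
  (conj_part (pos_part la) 1 + conj_part (neg_part la) 1 <= size la)%N.
Proof.
rewrite /conj_part count_rev !count_map.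
elim: la => [//|x la IH] /=.
  have h : ((1%:Z <= Num.max x 0)%R + (1%:Z <= - Num.min x 0)%R <= 1)%N by lia.
by rewrite addnACA -[(size la).+1]add1n; exact: leq_add.
Qed.

Lemma gen_partition_join (mu nu : seq int) k : is_partition mu -> is_partition nu ->
  let la := mu ++ nseq k 0 ++ rev [seq - x | x <- nu] in
  [/\ is_gen_partition la, pos_part la = mu ++ nseq (k + size nu) 0
    & neg_part la = nu ++ nseq (k + size mu) 0].
Proof.
move=> [smu pmu] [snu pnu] la.
have z (s : seq int) (g : int -> int) : {in s, forall x, g x = 0} ->
    [seq g x | x <- s] = nseq (size s) 0.
  elim: s => [//|x s IH] h /=; rewrite h ?mem_head // IH // => y ys.
  by apply: h; rewrite inE ys orbT.
have np y : y \in rev [seq - x | x <- nu] -> y <= 0.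
  by rewrite mem_rev => /mapP[x /(allP pnu) /= x0 ->]; lia.
split.
- have tr : transitive (>=%R : rel int) by exact: ge_trans.
  rewrite /is_gen_partition sorted_pairwise // !pairwise_cat allrel_catr.
  have -> : pairwise >=%R mu by rewrite -sorted_pairwise.
  have -> : pairwise >=%R (rev [seq - x | x <- nu]).
    rewrite -sorted_pairwise // rev_sorted.
    by apply: homo_sorted snu => x y /=; lia.
  have -> : pairwise >=%R (nseq k (0 : int)).
    elim: (k) => //= n ->; rewrite andbT; apply/allP => y /nseqP[-> _] /=; exact: lexx.
  rewrite !andbT; apply/andP; split; last first.
    by apply/allrelP => x y /nseqP[-> _] /np.
  apply/andP; split; apply/allrelP => x y /(allP pmu) /= x0.
    by move=> /nseqP[-> _].
  by move=> /np y0; exact: le_trans y0 x0.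
- rewrite /pos_part /la !map_cat nseqD; congr (_ ++ _).
    by rewrite -[RHS]map_id; apply/eq_in_map => x /(allP pmu) /=; lia.
  congr (_ ++ _); first by rewrite map_nseq; congr nseq; lia.
  by rewrite z ?size_rev ?size_map // => x /np; lia.
rewrite /neg_part /la !map_cat !rev_cat -catA -map_rev revK -map_comp.
congr (_ ++ _).
  by rewrite -[RHS]map_id; apply/eq_in_map => x /(allP pnu) /=; lia.
rewrite nseqD map_nseq rev_nseq; congr (nseq _ _ ++ _).
by rewrite z ?rev_nseq // => x /(allP pmu) /=; lia.
Qed.

(** Condition (iii) says that the two reconstructed partitions have total length at most [d]; the
    gap between them is filled with zeros. *)
Lemma frob_weight_gen_partition (R : realType) (d r s : nat) (xip xim : nat -> int) :
    (0 < r)%N -> (0 < s)%N -> frob_cond r xip -> frob_cond s xim ->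
    Num.min (xip 1%N) 1 + Num.min (xim 1%N) 1 + xip 2%N + xim 2%N <= d%:Z ->
  exists2 la, is_gen_partition la & frob_weight xip xim r s d =1 @Lambda_Ahat R la.
Proof.
move=> r0 s0 rP sP dP.
have [mu [muP mus muE]] := partition_of_frobenius r0 rP.
have [nu [nuP nus nuE]] := partition_of_frobenius s0 sP.
have le : (size mu + size nu <= d)%N by lia.
pose k := (d - (size mu + size nu))%N.
pose la := mu ++ nseq k 0 ++ rev [seq - x | x <- nu].
have [laP pE nE] := gen_partition_join k muP nuP; exists la => // h.
have sla : size la = d.
  by rewrite !size_cat size_nseq size_rev size_map addnCA subnK.
pose M := (2 * r + 2 * s + 2 * frob_rank (pos_part la) + 2 * frob_rank (neg_part la))%N.
rewrite /Lambda_Ahat !(@frob_weightE _ _ _ _ _ _ M); try (rewrite /M; lia).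
rewrite sla; congr (_ + _); apply: eq_big_nat => m /andP[m0 _].
rewrite !frob_coord_ext //; [|exact: neg_part_partition|exact: pos_part_partition].
by rewrite pE nE !frob_ext_cat0 // muE // nuE.
Qed.

(** * Comparison of highest weights, and the equivalence *)

Section Weights.
Variables (R : realType) (xi : {scalar Ahat0 R}).
Variables (xip xim : nat -> int) (r s d : nat).
Hypothesis xiE : xi =1 frob_weight xip xim r s d.
Local Notation C := R[i].

Lemma diag_wt_pos m : (0 < m)%N ->
  diag_wt xi m%:Z = (if (m <= 2 * r)%N then xip m else 0)%:~R.
Proof.
move=> m0; pose M := (2 * r + 2 * s + m)%N.
rewrite /diag_wt xiE (@frob_weightE _ _ _ _ _ _ M); try (rewrite /M; lia).
rewrite (_ : Lambda0 _ = 0) // mulr0 addr0.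
rewrite (eq_big_nat _ _ (F2 := fun k => (if (k <= 2 * r)%N then xip k else 0)%:~R * (m == k)%:R)).
  by rewrite sum_pred1 ?iota_uniq // mem_index_iota m0 /= ltnS leq_addl.
move=> k /andP[k0 _]; rewrite /omega_wt -!/(ent _ _ _) !ent_diag !subrr !eqxx /=.
rewrite (_ : k%:Z != 0); last by lia.
rewrite (_ : - k%:Z == m%:Z = false); last by lia.
by rewrite if_same mulr0 addr0 eq_sym.
Qed.

Lemma diag_wt_neg m : (0 < m)%N ->
  diag_wt xi (- m%:Z) = (- if (m <= 2 * s)%N then xim m else 0)%:~R.
Proof.
move=> m0; pose M := (2 * r + 2 * s + m)%N.
rewrite /diag_wt xiE (@frob_weightE _ _ _ _ _ _ M); try (rewrite /M; lia).
rewrite (_ : Lambda0 _ = 0) // mulr0 addr0.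
rewrite (eq_big_nat _ _ (F2 := fun k => (- if (k <= 2 * s)%N then xim k else 0)%:~R * (m == k)%:R)).
  by rewrite sum_pred1 ?iota_uniq // mem_index_iota m0 /= ltnS leq_addl.
move=> k /andP[k0 _]; rewrite /omega_wt -!/(ent _ _ _) !ent_diag !subrr !eqxx /=.
rewrite (_ : - k%:Z != 0); last by lia.
rewrite (_ : k%:Z == - m%:Z = false); last by lia.
by rewrite if_same mulr0 add0r eqr_opp eq_sym.
Qed.

Lemma level_frob_weight : level xi = d%:R.
Proof.
pose M := (2 * r + 2 * s)%N.
rewrite /level xiE (@frob_weightE _ _ _ _ _ _ M); try (rewrite /M; lia).
rewrite (_ : Lambda0 _ = 1) // mulr1 big1 ?add0r // => k _.
by rewrite /omega_wt -!/(ent _ _ _) !ent_diag !if_same !mulr0 addr0.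
Qed.

End Weights.

Lemma gen_partition_unitarizable (R : realType) (V : lmodType R[i])
    (Vpar : bool -> {pred V}) (act : Ahat R -> V -> V)
    (xi : {scalar Ahat0 R}) (v : V) (la : seq int) :
  is_supermodule Vpar act -> irreducible_module Vpar act ->
  is_highest_weight_module act xi v -> quasi_finite act v ->
  is_gen_partition la -> xi =1 Lambda_Ahat la -> unitarizable act.
Proof.
move=> mod irr hw qf laP xiE.
have muP := pos_part_partition laP; have nuP := neg_part_partition laP.
set mu := pos_part la in muP *; set nu := neg_part la in nuP *.
have bound (t : seq int) : is_partition t -> exists N : nat, forall n : nat, (N <= n)%N ->
    all (fun x => x <= n%:Z) t /\ forall j, (n < j)%N -> conj_part t j = 0%N.
  move=> tP; exists `|(t`_0)%R|%N => n nN.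
  have tn i : t`_i <= n%:Z.
    have := part_nth_mono tP (leq0n i); have := part_nth_ge0 0 tP.
    by move: (t`_0 : int) (t`_i : int) nN => y z; lia.
  split=> [|j nj]; first by apply/(all_nthP 0) => i _; exact: tn.
  by have := conj_partP 0 tP (leq_ltn_trans (leq0n n) nj); have := tn 0%N; lia.
have [N1 HN1] := bound _ muP; have [N2 HN2] := bound _ nuP.
pose N := (N1 + N2)%N.
have [muN muz] := HN1 N (leq_addr _ _); have [nuN nuz] := HN2 N (leq_addl _ _).
have [F [E [f [w [EP fP fE w0 [ww wk]]]]]] := @unitary_highest_weight R[i] (size la) N
  _ _ (@conj_part_mono mu) (@conj_part_mono nu) muz nuz (conj_part_parts la).
apply: (unitarizable_of_vector mod hw qf irr EP fP fE w0 _ wk); last first.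
  by rewrite (level_frob_weight xiE) realn.
(* The Fock weight is that of the corrected matrix units, so it is matched with [shifted_wt]; for
   negative [p] the terms with [d] are the central corrections. *)
move=> p p0; rewrite ww //; congr (_ *: _); rewrite /shifted_wt (level_frob_weight xiE).
have [p1|p1] := ltrP 0 p.
  have -> : p < 0 = false by lia.
  have pE : p = `|p|%N%:Z by lia.
  rewrite mul0r addr0 {2}pE (diag_wt_pos xiE) ?frob_coord_ext //; try lia.
  by rewrite frobenius_ext.
have -> : p < 0 by lia.
have pE : p = - `|p|%N%:Z by lia.
rewrite {3}pE (diag_wt_neg xiE) ?frob_coord_ext //; try lia.
rewrite frobenius_ext // rmorphB rmorphN /= addrC; congr (_ + _).
by case: (podd p); rewrite ?rmorphN /= ?expr0 ?expr1 ?mul1r ?mulN1r.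
Qed.

Theorem theorem5p5 (R : realType) (V : lmodType R[i])
    (Vpar : bool -> {pred V}) (act : Ahat R -> V -> V)
    (xi : {scalar Ahat0 R}) (v : V) :
  is_supermodule Vpar act ->
  irreducible_module Vpar act ->
  is_highest_weight_module act xi v ->
  quasi_finite act v ->
  (unitarizable act <->
   exists la : seq int, is_gen_partition la /\ xi =1 Lambda_Ahat la) /\
  (unitarizable act <->
   exists (d r s : nat) (xip xim : nat -> int),
     [/\ (0 < r)%N /\ (0 < s)%N,
         xi =1 frob_weight xip xim r s d,
         frob_cond r xip,
         frob_cond s xim &
         Num.min (xip 1%N) 1 + Num.min (xim 1%N) 1 + xip 2%N + xim 2%N
           <= d%:Z]).
Proof.
move=> mod irr hw qf.
have AB := unitarizable_conditions mod hw qf.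
have BL : (exists (d r s : nat) (xip xim : nat -> int),
     [/\ (0 < r)%N /\ (0 < s)%N, xi =1 frob_weight xip xim r s d,
         frob_cond r xip, frob_cond s xim &
         Num.min (xip 1%N) 1 + Num.min (xim 1%N) 1 + xip 2%N + xim 2%N <= d%:Z]) ->
   exists la : seq int, is_gen_partition la /\ xi =1 Lambda_Ahat la.
  move=> [d [r [s [xip [xim [[r0 s0] xiE rP sP dP]]]]]].
  have [la laP laE] := frob_weight_gen_partition R r0 s0 rP sP dP.
  by exists la; split=> // h; rewrite xiE laE.
have LA : (exists la : seq int, is_gen_partition la /\ xi =1 Lambda_Ahat la) ->
    unitarizable act.
  by move=> [la [laP xiE]]; exact: gen_partition_unitarizable mod irr hw qf laP xiE.
split; split=> [/AB|].
- exact: BL.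
- exact: LA.
- by [].
- by move=> /BL; exact: LA.
Qed.
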